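(* Let $\nu>0$. If $\|y_\nu(\cdot,T)-y_\Omega\|_{L^2(0,1)}>0$, then each of the four equations $$\varphi_\nu(1,t)+\mu+\nu b=0,\quad \varphi_\nu(1,t)+\mu=0,\quad \varphi_\nu(1,t)-\mu=0,\quad \varphi_\nu(1,t)-\mu+\nu a=0$$ has at most countably many solutions $t\in[0,T]$, and these can accumulate only at $t=T$. Therefore, $u_\nu$ has at most countably many switching points, and these can accumulate only at $t=T$.
   Context: Fix $T>0$, $\alpha>0$, $\mu>0$, $a<0<b$ and $y_\Omega\in C[0,1]$; $Q=(0,1)\times(0,T)$. Let $U_{ad}=\{u\in L^2(0,T): a\le u(t)\le b \text{ for a.a. } t\in[0,T]\}$. For $u\in U_{ad}$, $y_u\in C(\bar Q)$ denotes the weak solution of $y_t-y_{xx}=0$ in $Q$, $y_x(0,t)=0$, $y_x(1,t)+\alpha y(1,t)=u(t)$ for $t\in(0,T)$, $y(x,0)=0$; and $\varphi_u\in C(\bar Q)$ denotes the weak solution of the adjoint equation $-\varphi_t-\varphi_{xx}=0$ in $Q$, $\varphi_x(0,t)=0$, $\varphi_x(1,t)+\alpha\varphi(1,t)=0$ for $t\in(0,T)$, $\varphi(x,T)=y_u(x,T)-y_\Omega(x)$. Problem $(P_\nu)$, $\nu>0$: minimize $F_\nu(u)=\frac12\int_0^1|y_u(x,T)-y_\Omega(x)|^2\,dx+\frac\nu2\int_0^T|u(t)|^2\,dt+\mu\int_0^T|u(t)|\,dt$ over $u\in U_{ad}$. It has a unique solution $u_\nu$; write $y_\nu=y_{u_\nu}$,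 $\varphi_\nu=\varphi_{u_\nu}$. A switching point of $u_\nu$ is a point $t\in(0,T)$ at which one of the four functions $\varphi_\nu(1,t)+\mu+\nu b$, $\varphi_\nu(1,t)+\mu$, $\varphi_\nu(1,t)-\mu$, $\varphi_\nu(1,t)-\mu+\nu a$ of $t$ changes its sign. *)

(* Defs.v *)
(* MathComp world, with MathComp-Analysis. *)
From HB Require Import structures.
From mathcomp Require Import all_boot all_order all_algebra.
From mathcomp Require Import all_classical all_reals all_analysis.

Set Implicit Arguments.
Unset Strict Implicit.
Unset Printing Implicit Defensive.

Import Order.TTheory GRing.Theory Num.Theory.
Import numFieldNormedType.Exports.

Local Open Scope classical_set_scope.
Local Open Scope ring_scope.

Section heat_control.
Context {R : realType}.

(* A function of (x, t) is a total curried map R -> R -> R, of which only the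
   values on the closed cylinder matter; a control is a total map R -> R, of
   which only the values on [0, T] matter. *)

Definition leb1 : {measure set (measurableTypeR R) -> \bar R} :=
  @lebesgue_measure R.

Definition leb2 :
    {measure set (measurableTypeR R * measurableTypeR R) -> \bar R} :=
  (@lebesgue_measure R \x @lebesgue_measure R)%E.

Definition cyl (T : R) : set (R * R) := `]0, 1[%classic `*` `]0, T[%classic.

Definition closed_cyl (T : R) : set (R * R) :=
  `[0, 1]%classic `*` `[0, T]%classic.

Definition continuous_closed_cyl (T : R) (y : R -> R -> R) : Prop :=
  {within closed_cyl T, continuous (fun p : R * R => y p.1 p.2)}.

Definition dx (v : R -> R -> R) (x t : R) : R := derive1 (v ^~ t) x.
Definition dt (v : R -> R -> R) (x t : R) : R := derive1 (v x) t.

(* Continuity of v itself follows from that of the partial derivatives. *)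
Definition C1 (v : R -> R -> R) : Prop :=
  [/\ forall x t, derivable (v ^~ t) x 1 /\ derivable (v x) t 1,
      continuous (fun p : R * R => dx v p.1 p.2) &
      continuous (fun p : R * R => dt v p.1 p.2)].

Definition compact_support_in (D : set (R * R)) (v : R -> R -> R) : Prop :=
  exists K : set (R * R), [/\ compact K, K `<=` D &
    forall x t, ~ K (x, t) -> v x t = 0].

(* [g] represents the weak derivative y_x of [y] in L^2 of the cylinder. *)
Definition weak_dx (T : R) (y g : R -> R -> R) : Prop :=
  ((fun p : R * R => g p.1 p.2) \_ (cyl T)) \in Lfun leb2 2%:E /\
  forall psi : R -> R -> R, C1 psi -> compact_support_in (cyl T) psi ->
    (\int[leb2]_(p in cyl T) (y p.1 p.2 * dx psi p.1 p.2)) =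
    - (\int[leb2]_(p in cyl T) (g p.1 p.2 * psi p.1 p.2)).

(* Weak solution of  y_t - y_xx = 0,  y_x(0,.) = 0,
   y_x(1,.) + alpha y(1,.) = u,  y(.,0) = 0: multiply the equation by a test
   function vanishing at t = T and integrate by parts in t and in x. *)
Definition weak_state (T alpha : R) (u : R -> R) (y : R -> R -> R) : Prop :=
  continuous_closed_cyl T y /\
  exists2 g : R -> R -> R, weak_dx T y g &
    forall v : R -> R -> R, C1 v -> (forall x, x \in `[0, 1] -> v x T = 0) ->
      - (\int[leb2]_(p in cyl T) (y p.1 p.2 * dt v p.1 p.2))
      + (\int[leb2]_(p in cyl T) (g p.1 p.2 * dx v p.1 p.2))
      + alpha * (\int[leb1]_(t in `[0, T]) (y 1 t * v 1 t))
      = (\int[leb1]_(t in `[0, T]) (u t * v 1 t)).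

(* Weak solution of  - phi_t - phi_xx = 0,  phi_x(0,.) = 0,
   phi_x(1,.) + alpha phi(1,.) = 0,  phi(.,T) = y(.,T) - yOmega: here the test
   functions vanish at t = 0. *)
Definition weak_adjoint (T alpha : R) (yOmega : R -> R)
    (y phi : R -> R -> R) : Prop :=
  continuous_closed_cyl T phi /\
  exists2 g : R -> R -> R, weak_dx T phi g &
    forall v : R -> R -> R, C1 v -> (forall x, x \in `[0, 1] -> v x 0 = 0) ->
      (\int[leb2]_(p in cyl T) (phi p.1 p.2 * dt v p.1 p.2))
      + (\int[leb2]_(p in cyl T) (g p.1 p.2 * dx v p.1 p.2))
      + alpha * (\int[leb1]_(t in `[0, T]) (phi 1 t * v 1 t))
      = (\int[leb1]_(x in `[0, 1]) ((y x T - yOmega x) * v x T)).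

Definition Uad (T a b : R) (u : R -> R) : Prop :=
  u \_ `[0, T] \in Lfun leb1 2%:E /\
  {ae leb1, forall t, t \in `[0, T] -> a <= u t <= b}.

(* F_nu(u), with [y] in the place of y_u *)
Definition objective (T nu mu : R) (yOmega : R -> R) (u : R -> R)
    (y : R -> R -> R) : R :=
  2^-1 * (\int[leb1]_(x in `[0, 1]) (`|y x T - yOmega x| ^+ 2))
  + nu / 2 * (\int[leb1]_(t in `[0, T]) (`|u t| ^+ 2))
  + mu * (\int[leb1]_(t in `[0, T]) `|u t|).

(* [u] solves (P_nu) and [y] is its state. *)
Definition optimal_pair (T alpha nu mu a b : R) (yOmega : R -> R)
    (u : R -> R) (y : R -> R -> R) : Prop :=
  [/\ Uad T a b u, weak_state T alpha u y &
    forall (w : R -> R) (z : R -> R -> R),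
      Uad T a b w -> weak_state T alpha w z ->
      objective T nu mu yOmega u y <= objective T nu mu yOmega w z].

Definition sign_change (f : R -> R) (t : R) : Prop :=
  forall e : R, 0 < e -> exists s r : R,
    [/\ t - e < s < t, t < r < t + e & f s * f r < 0].

Definition switching_point (T nu mu a b : R) (phi : R -> R -> R) (t : R) :
    Prop :=
  0 < t < T /\
  [\/ sign_change (fun s => phi 1 s + mu + nu * b) t,
      sign_change (fun s => phi 1 s + mu) t,
      sign_change (fun s => phi 1 s - mu) t |
      sign_change (fun s => phi 1 s - mu + nu * a) t].

Definition countable_accumulating_only_at (T : R) (E : set R) : Prop :=
  countable E /\ limit_point E `<=` [set T].

End heat_control.

(* Main.v *)
(* Let d be the terminal datum of phi and D(k) = k sinh k + al cosh k. Testing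
   the adjoint equation with cosh (k x) times an exponential in t expresses the
   Laplace transform at k^2 of s |-> phi(1, T - s), truncated at T, as
     (int d(x) cosh (k x) dx) / D(k) + O (k^2 exp (- k^2 T)).
   Summing the reflections at the two ends writes the first term, up to c / k^2,
   as E^(k) / k for the Laplace transform E^ of a function E of exponential type,
   and E^(k) / k is the Laplace transform at k^2 of
     h(s) = (pi s)^(-1/2) int_0^oo exp (- x^2 / (4 s)) E(x) dx.
   By the Phragmen-Doetsch inversion the exponentially small error forces
   phi(1, T - s) = c + h(s) on ]0, T[. As h is real analytic on s > 0, zeros of
   phi(1, .) - c accumulating before T give h = 0, that is
   int d(x) cosh (k x) dx = c D(k) / k^2 for all large k. The affine w with
   w(1) = c and w'(1) = - al c has moment c D(k) / k^2 - al c / k^2, so the same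
   inversion gives d = w on ]0, 1[, and the remaining al c / k^2 forces c = 0; the
   four levels in the statement are nonzero. *)
Require Import Defs.
From HB Require Import structures.
From mathcomp Require Import all_boot all_order all_algebra.
From mathcomp Require Import all_classical all_reals all_analysis.
From mathcomp Require Import measurable_realfun.
From mathcomp Require Import ring lra.

Set Implicit Arguments.
Unset Strict Implicit.
Unset Printing Implicit Defensive.

Import Order.TTheory GRing.Theory Num.Theory.
Import numFieldNormedType.Exports.

Local Open Scope classical_set_scope.
Local Open Scope ring_scope.

(** * Translations, dominated convergence and Fubini for real integrals *)

(** The adjoint state is known only through a weak identity, so no expansion in Robin eigenfunctions
    is at hand and the analyticity of [phi 1] has to come from a formula. In the variable [k] the
    problem is one for waves: [D(k) = exp k (k + al) / 2 (1 - exp (- 2 k) (k - al) / (k + al))],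
    where [exp (- 2 k)] is a round trip across [[0, 1]]. Dividing by [D(k)] therefore amounts to a
    locally finite sum of delayed terms, an honest function; the change from [k] to [k^2] is the
    passage from waves to heat. The level [c] enters this function at once, through [- c / k^2], so
    that zeros of [phi 1 - c] become zeros of a single analytic function. Everything stays on the
    real axis: analyticity is Taylor expansion of Gaussian integrals with an explicit remainder. The
    factor [k^2] of the error is absorbed by lowering [T] to some [T' < T], chosen anew for each
    point since the inversion is local. The rate 3 comes from the reflections; 4 is a value of [k]
    above it and 16 its square. *)

Lemma lebesgue_measure_translate (R : realType) (a : R) (X : set R) :
  measurable X ->
  lebesgue_measure X = pushforward (@lebesgue_measure R) (fun x : R => x + a) X.
Proof.
move=> mX.
have mt : measurable_fun setT (fun x : measurableTypeR R => x + a : measurableTypeR R).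
  exact: measurable_funD.
pose mixin := isMeasurableFun.Build _ _ _ _ _ mt.
pose t : {mfun _ >-> _} := HB.pack (fun x : measurableTypeR R => x + a : measurableTypeR R) mixin.
apply: (@lebesgue_measure_unique R (pushforward (@lebesgue_measure R) t)) => //.
move=> _ [[x y] /= _ <-].
rewrite /pushforward (_ : _ @^-1` _ = `]x - a, y - a]%classic); last first.
  by apply/seteqP; split => z /=; rewrite !in_itv/= ltrBlDr lerBrDr.
rewrite !lebesgue_measure_itv/= !lte_fin ltrD2r.
by case: ifPn => // _; rewrite -!EFinB; congr EFin; ring.
Qed.

Section translate.
Local Open Scope ereal_scope.

Lemma ge0_integral_translate (R : realType) (a : R) (D : set R)
    (f : R -> \bar R) :
  measurable D -> measurable_fun D f -> (forall x, D x -> 0 <= f x) ->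
  \int[lebesgue_measure]_(x in [set x : R | D (x + a)%R]) f (x + a)%R =
  \int[lebesgue_measure]_(x in D) f x.
Proof.
move=> mD mf f0.
have mt : measurable_fun setT
    (fun x : measurableTypeR R => (x + a)%R : measurableTypeR R).
  exact: measurable_funD.
have := @ge0_integral_pushforward _ _ _ _ R _ mt (@lebesgue_measure R) D f mD mf.
move=> /(_ _)/= <-; last by move=> x /set_mem/f0.
apply: eq_measure_integral => A mA _.
exact: esym (lebesgue_measure_translate a mA).
Qed.

Lemma integral_translate (R : realType) (a : R) (D : set R) (f : R -> \bar R) :
  measurable D -> measurable_fun D f ->
  \int[lebesgue_measure]_(x in [set x : R | D (x + a)%R]) f (x + a)%R =
  \int[lebesgue_measure]_(x in D) f x.
Proof.
move=> mD mf; rewrite integralE [RHS]integralE.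
congr (_ - _).
  rewrite -(@ge0_integral_translate R a D f^\+ mD (measurable_funepos mf)).
    by apply: eq_integral => x _; rewrite !funeposE.
  by move=> x _; exact: funepos_ge0.
rewrite -(@ge0_integral_translate R a D f^\- mD (measurable_funeneg mf)).
  by apply: eq_integral => x _; rewrite !funenegE.
by move=> x _; exact: funeneg_ge0.
Qed.

End translate.

Section integrable_EFin.
Context d (T : measurableType d) (R : realType) (mu : {measure set T -> \bar R}).
Variables (D : set T) (f : T -> R) (c : R).
Hypotheses (mD : measurable D) (intf : mu.-integrable D (EFin \o f)).

Lemma integrable_EFinZl : mu.-integrable D (EFin \o (fun x => c * f x)).
Proof. exact: (integrableZl mD c intf). Qed.

Lemma integrable_EFinZr : mu.-integrable D (EFin \o (fun x => f x * c)).
Proof. exact: (integrableZr mD c intf). Qed.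

End integrable_EFin.

Lemma dominated_cvg_Rintegral d (T : measurableType d) (R : realType)
    (mu : {measure set T -> \bar R}) (D : set T) (F : nat -> T -> R)
    (f g : T -> R) :
  measurable D -> (forall n, measurable_fun D (F n)) ->
  (forall x, D x -> F n x @[n --> \oo] --> f x) ->
  mu.-integrable D (EFin \o g) ->
  (forall n x, D x -> `|F n x| <= g x) ->
  mu.-integrable D (EFin \o f) /\
  \int[mu]_(x in D) F n x @[n --> \oo] --> \int[mu]_(x in D) f x.
Proof.
move=> mD mF Ff ig Fg.
have mf : measurable_fun D f by apply: (measurable_fun_cvg mF) => x /Ff.
have [] := @dominated_convergence _ _ _ mu D mD (fun n x => (F n x)%:E)
  (EFin \o f) (EFin \o g).
- by move=> n; apply/measurable_EFinP.
- exact/measurable_EFinP.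
- by apply: aeW => x Dx; apply: cvg_EFin; [exact: nearW|exact: Ff].
- by [].
- by apply: aeW => x n Dx; rewrite lee_fin Fg.
move=> iF _ cF; split => //; apply: fine_cvg.
by rewrite fineK// ; exact: integrable_fin_num.
Qed.

Section Fubini_Rintegral.
Context d1 d2 (T1 : measurableType d1) (T2 : measurableType d2) (R : realType).
Variables (m1 : {sigma_finite_measure set T1 -> \bar R})
  (m2 : {sigma_finite_measure set T2 -> \bar R}).
Variables (A : set T1) (B : set T2) (f : T1 -> T2 -> R).
Hypotheses (mA : measurable A) (mB : measurable B).
Hypothesis mf : measurable_fun (A `*` B) (fun p => f p.1 p.2).

(** Extension by zero, so that Fubini on the whole product applies to a rectangle. *)
Let g (p : T1 * T2) : \bar R := (((fun p => f p.1 p.2) \_ (A `*` B)) p)%:E.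

Let mAB : measurable (A `*` B). Proof. exact: measurableX. Qed.

Let mg : measurable_fun setT g.
Proof. by apply/measurable_EFinP; exact: (measurable_restrictT _ mAB).1. Qed.

Let g1 x : A x -> (fun y => g (x, y)) = ((fun y => (f x y)%:E) \_ B)%E.
Proof.
move=> Ax; apply/funext => y; rewrite /g !patchE.
have [By|By] := boolP (y \in B).
  by rewrite mem_set//; split => //=; exact/set_mem.
by rewrite memNset// => -[_ /= /mem_set]; exact/negP.
Qed.

Let g1N x : ~ A x -> (fun y => g (x, y)) = cst 0%E.
Proof.
by move=> Ax; apply/funext => y; rewrite /g !patchE memNset// => -[].
Qed.

Let g2 y : B y -> (fun x => g (x, y)) = ((fun x => (f x y)%:E) \_ A)%E.
Proof.
move=> By; apply/funext => x; rewrite /g !patchE.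
have [Ax|Ax] := boolP (x \in A).
  by rewrite mem_set//; split => //=; exact/set_mem.
by rewrite memNset// => -[/= /mem_set + _]; exact/negP.
Qed.

Let g2N y : ~ B y -> (fun x => g (x, y)) = cst 0%E.
Proof.
by move=> By; apply/funext => x; rewrite /g !patchE memNset// => -[].
Qed.

Let intg1 x : (\int[m2]_y g (x, y))%E =
  ((fun x => \int[m2]_(y in B) (f x y)%:E) \_ A)%E x.
Proof.
rewrite patchE; have [/set_mem Ax|/negP Ax] := boolP (x \in A).
  by rewrite [RHS]integral_mkcond -g1.
by rewrite g1N ?integral0// => /mem_set.
Qed.

Let intg2 y : (\int[m1]_x g (x, y))%E =
  ((fun y => \int[m1]_(x in A) (f x y)%:E) \_ B)%E y.
Proof.
rewrite patchE; have [/set_mem Ax|/negP Ax] := boolP (y \in B).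
  by rewrite [RHS]integral_mkcond -g2.
by rewrite g2N ?integral0// => /mem_set.
Qed.

Lemma integrable_prod_of12 :
  (\int[m1]_(x in A) \int[m2]_(y in B) (`|f x y|)%:E < +oo)%E ->
  (m1 \x m2)%E.-integrable (A `*` B) (fun p => (f p.1 p.2)%:E).
Proof.
move=> fin.
suff : (m1 \x m2)%E.-integrable setT g.
  move=> ig; apply/integrable_mkcond => //.
  apply: eq_integrable ig => // p _; rewrite /g !patchE.
  by case: ifPn.
apply: (@integrable12ltyP _ _ _ _ _ m1 m2 g mg).2.
suff -> : (\int[m1]_x \int[m2]_y `|g (x, y)| =
    \int[m1]_(x in A) \int[m2]_(y in B) (`|f x y|)%:E)%E by [].
rewrite [RHS]integral_mkcond; apply: eq_integral => x _.
rewrite patchE; have [/set_mem Ax|/negP Ax] := boolP (x \in A).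
  rewrite [RHS]integral_mkcond; apply: eq_integral => y _.
  have /(congr1 (fun h => h y))-> := g1 Ax.
  by rewrite !patchE; case: ifPn => // _; rewrite abse0.
apply: integral0_eq => y _.
have /(congr1 (fun h => h y))-> : (fun y => g (x, y)) = cst 0%E.
  by apply: g1N => /mem_set.
by rewrite abse0.
Qed.

Lemma integrable_prod_of21 :
  (\int[m2]_(y in B) \int[m1]_(x in A) (`|f x y|)%:E < +oo)%E ->
  (m1 \x m2)%E.-integrable (A `*` B) (fun p => (f p.1 p.2)%:E).
Proof.
move=> fin.
suff : (m1 \x m2)%E.-integrable setT g.
  move=> ig; apply/integrable_mkcond => //.
  apply: eq_integrable ig => // p _; rewrite /g !patchE.
  by case: ifPn.
apply: (@integrable21ltyP _ _ _ _ _ m1 m2 g mg).2.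
suff -> : (\int[m2]_y \int[m1]_x `|g (x, y)| =
    \int[m2]_(y in B) \int[m1]_(x in A) (`|f x y|)%:E)%E by [].
rewrite [RHS]integral_mkcond; apply: eq_integral => y _.
rewrite patchE; have [/set_mem By|/negP By] := boolP (y \in B).
  rewrite [RHS]integral_mkcond; apply: eq_integral => x _.
  have /(congr1 (fun h => h x))-> := g2 By.
  by rewrite !patchE; case: ifPn => // _; rewrite abse0.
apply: integral0_eq => x _.
have /(congr1 (fun h => h x))-> : (fun x => g (x, y)) = cst 0%E.
  by apply: g2N => /mem_set.
by rewrite abse0.
Qed.

Hypothesis if12 : (m1 \x m2)%E.-integrable (A `*` B)
  (fun p => (f p.1 p.2)%:E).

Let ig : (m1 \x m2)%E.-integrable setT g.
Proof.
move: if12 => /(integrable_mkcond _ mAB).1.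
by apply: eq_integrable => // p _; rewrite /g !patchE; case: ifPn.
Qed.

(** All slices, not almost all, are integrable: the inner extended-real integral is then finite at
    every point and agrees with its [fine], with no null set to carry along. *)
Hypothesis if1 : forall x, A x -> m2.-integrable B (fun y => (f x y)%:E).
Hypothesis if2 : forall y, B y -> m1.-integrable A (fun x => (f x y)%:E).

Let R1 : (fun x => \int[m2]_y g (x, y))%E =
  (EFin \o (fun x => \int[m2]_(y in B) f x y)%R) \_ A.
Proof.
apply/funext => x; rewrite intg1 !patchE; case: ifPn => // /set_mem Ax.
by rewrite /= /Rintegral fineK//; apply: integrable_fin_num => //; exact: if1.
Qed.

Let R2 : (fun y => \int[m1]_x g (x, y))%E =
  (EFin \o (fun y => \int[m1]_(x in A) f x y)%R) \_ B.
Proof.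
apply/funext => y; rewrite intg2 !patchE; case: ifPn => // /set_mem Ax.
by rewrite /= /Rintegral fineK//; apply: integrable_fin_num => //; exact: if2.
Qed.

Lemma integrable_Rfubini1 :
  m1.-integrable A (EFin \o (fun x => \int[m2]_(y in B) f x y)%R).
Proof.
apply/integrable_mkcond => //; rewrite -R1.
exact: integrable_fubini_F.
Qed.

Lemma measurable_Rfubini2 :
  measurable_fun B (fun y => \int[m1]_(x in A) f x y)%R.
Proof.
apply/measurable_EFinP; apply/(measurable_restrictT _ mB).2; 
by have := measurable_fubini_G ig; rewrite /fubini_G R2.
Qed.

Lemma Rfubini1 : \int[(m1 \x m2)%E]_(p in A `*` B) f p.1 p.2 =
  \int[m1]_(x in A) \int[m2]_(y in B) f x y.
Proof.
have := integral12_prod_meas1 ig.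
rewrite /fubini_F R1 -integral_mkcond => /(congr1 fine) h.
rewrite [RHS]h; congr fine; rewrite integral_mkcond; apply: eq_integral => p _.
by rewrite /g !patchE; case: ifPn.
Qed.

Lemma Rfubini2 : \int[(m1 \x m2)%E]_(p in A `*` B) f p.1 p.2 =
  \int[m2]_(y in B) \int[m1]_(x in A) f x y.
Proof.
have := integral21_prod_meas1 ig.
rewrite /fubini_G R2 -integral_mkcond => /(congr1 fine) h.
rewrite [RHS]h; congr fine; rewrite integral_mkcond; apply: eq_integral => p _.
by rewrite /g !patchE; case: ifPn.
Qed.

End Fubini_Rintegral.

Lemma is_derive_expRM (R : realType) (c x : R) :
  is_derive x 1 (fun x => expR (c * x)) (c * expR (c * x)).
Proof.
by apply: is_derive_eq; rewrite /GRing.scale/= mulr1 mulrC.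
Qed.

Lemma continuous_expRM (R : realType) (c : R) :
  continuous (fun x : R => expR (c * x)).
Proof.
move=> x; apply/differentiable_continuous/derivable1_diffP.
by have [] := is_derive_expRM c x.
Qed.

Lemma measurable_expRM (R : realType) (c : R) D :
  measurable_fun D (fun x : R => expR (c * x)).
Proof.
apply: measurable_funTS; apply: continuous_measurable_fun.
exact: continuous_expRM.
Qed.

Lemma integral_expR_tail (R : realType) (k a : R) : 0 < k ->
  (\int[lebesgue_measure]_(x in `[a, +oo[) (expR (- k * x))%:E)%E =
  (expR (- k * a) / k)%:E.
Proof.
move=> k0.
pose F (x : R) : R := - k^-1 * expR (- k * x).
have dF (x : R) : is_derive x 1 F (expR (- k * x)).
  apply: is_derive_eq; rewrite /GRing.scale/=.
  by field; rewrite gt_eqF.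
have cF (x : R) : {for x, continuous F}.
  by apply/differentiable_continuous/derivable1_diffP; have [] := dF x.
rewrite (@ge0_continuous_FTC2y _ _ F _ 0).
- by rewrite -EFinB /F sub0r mulNr opprK mulrC.
- by move=> x _; exact: expR_ge0.
- by apply: continuous_subspaceT; exact: continuous_expRM.
- rewrite -[X in _ --> X](mulr0 (- k^-1)); apply: cvgMr.
  under eq_fun do rewrite mulNr.
  apply: (@cvg_comp _ _ _ ( *%R k) (fun x => expR (- x))); last exact: cvgr_expR.
  by apply: gt0_cvgMry => //; exact: cvg_id.
- by move=> x _; have [] := dF x.
- by apply: cvg_at_right_filter; exact: cF.
- by move=> x _; rewrite derive1E; have [_ ->] := dF x.
Qed.


Lemma Rintegral_expR_itv (R : realType) (c a b : R) : c != 0 -> a < b ->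
  \int[lebesgue_measure]_(x in `[a, b]) expR (c * x) =
  (expR (c * b) - expR (c * a)) / c.
Proof.
move=> c0 ab.
pose F (x : R) : R := c^-1 * expR (c * x).
have dF (x : R) : is_derive x 1 F (expR (c * x)).
  by apply: is_derive_eq; rewrite /GRing.scale/=; field.
have cF (x : R) : {for x, continuous F}.
  by apply/differentiable_continuous/derivable1_diffP; have [] := dF x.
rewrite /Rintegral (@continuous_FTC2 _ _ F)//.
- by rewrite -EFinB /= /F mulrBl !(mulrC c^-1).
- by apply: continuous_subspaceT; exact: continuous_expRM.
- split; first by move=> x _; have [] := dF x.
  + by apply: cvg_at_right_filter; exact: cF.
  + by apply: cvg_at_left_filter; exact: cF.
- by move=> x _; rewrite derive1E; have [_ ->] := dF x.
Qed.

(** * Laplace transforms of functions of exponential type *)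

Section laplace.
Context {R : realType}.
Local Notation mu := (@lebesgue_measure R).
Implicit Types (f M : R -> R) (k l K : R).

(** The bound holds at every point rather than almost everywhere, so it passes to pointwise limits
    and to delayed functions; at [x = 0] it gives [0 <= K]. *)
Definition exp_type K l f := measurable_fun `[(0 : R), +oo[ f /\
  forall x, 0 <= x -> `|f x| <= K * expR (l * x).

Definition laplace f k : R :=
  \int[mu]_(x in `[0, +oo[) (expR (- k * x) * f x).

Lemma integrable_expR_tail k (a : R) : 0 < k ->
  mu.-integrable `[a, +oo[ (EFin \o (fun x : R => expR (- k * x))).
Proof.
move=> k0; apply/integrableP; split.
  by apply/measurable_EFinP; exact: measurable_expRM.
under eq_integral do rewrite /= ger0_norm ?expR_ge0//.
by rewrite integral_expR_tail// ltry.
Qed.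

Lemma exp_type_integrable K l f k : exp_type K l f -> l < k ->
  mu.-integrable `[0, +oo[ (EFin \o (fun x => expR (- k * x) * f x)).
Proof.
move=> [mf bf] lk.
have ig : mu.-integrable `[0, +oo[
    (fun x => K%:E * (expR (- (k - l) * x))%:E)%E.
  apply: integrableZl => //.
  by apply: integrable_expR_tail; rewrite subr_gt0.
apply: le_integrable ig => //.
  apply/measurable_EFinP; apply: measurable_funM => //.
  exact: measurable_expRM.
move=> x /=; rewrite in_itv/= andbT => x0.
rewrite lee_fin [leRHS]ger0_norm; last first.
  rewrite mulr_ge0 ?expR_ge0//.
  have := bf x x0; rewrite -(pmulr_lge0 _ (expR_gt0 (l * x))).
  exact: le_trans.
rewrite normrM ger0_norm ?expR_ge0//.
apply: (le_trans (ler_wpM2l (expR_ge0 _) (bf x x0))).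
suff -> : expR (- k * x) * (K * expR (l * x)) = K * expR (- (k - l) * x) by [].
by rewrite mulrCA -expRD; congr (_ * expR _); ring.
Qed.

Lemma laplace_add K l f K' g k : exp_type K l f -> exp_type K' l g -> l < k ->
  laplace (fun x => f x + g x) k = laplace f k + laplace g k.
Proof.
move=> ef eg lk; rewrite /laplace -RintegralD//; last 2 first.
- exact: exp_type_integrable ef lk.
- exact: exp_type_integrable eg lk.
by apply: eq_Rintegral => x _; rewrite mulrDr.
Qed.

Lemma laplace_scale K l f c k : exp_type K l f -> l < k ->
  laplace (fun x => c * f x) k = c * laplace f k.
Proof.
move=> ef lk; rewrite /laplace -RintegralZl//; last first.
  exact: exp_type_integrable ef lk.
by apply: eq_Rintegral => x _; rewrite mulrCA.
Qed.

Lemma exp_type_add K l f K' g : exp_type K l f -> exp_type K' l g ->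
  exp_type (K + K') l (fun x => f x + g x).
Proof.
move=> [mf bf] [mg bg]; split; first exact: measurable_funD.
move=> x x0; rewrite mulrDl (le_trans (ler_normD _ _))//.
by rewrite lerD// ?bf// bg.
Qed.

Lemma exp_type_norm K l f : exp_type K l f -> exp_type K l (fun x => `|f x|).
Proof.
move=> [mf bf]; split; first exact: measurableT_comp.
by move=> x x0; rewrite normr_id bf.
Qed.

Lemma exp_type_ge0 K l f : exp_type K l f -> 0 <= K.
Proof.
move=> [_ /(_ 0 (lexx _))]; rewrite mulr0 expR0 mulr1; exact: le_trans.
Qed.

Lemma exp_type_scale K l f c : exp_type K l f ->
  exp_type (`|c| * K) l (fun x => c * f x).
Proof.
move=> [mf bf]; split; first exact: measurable_funM.
by move=> x x0; rewrite normrM -mulrA ler_wpM2l// bf.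
Qed.

Lemma exp_type_cst K c l : 0 <= l -> `|c| <= K -> exp_type K l (fun=> c).
Proof.
move=> l0 cK; split; first exact: measurable_cst.
move=> x x0; rewrite (le_trans cK)// ler_peMr ?(le_trans _ cK)//.
by rewrite -expR0 ler_expR mulr_ge0.
Qed.

Lemma exp_typeW K K' l f : K <= K' -> exp_type K l f -> exp_type K' l f.
Proof.
move=> KK' [mf bf]; split => // x x0; rewrite (le_trans (bf x x0))//.
by rewrite ler_wpM2r// expR_ge0.
Qed.

Lemma laplace_cst c k : 0 < k -> laplace (fun=> c) k = c / k.
Proof.
move=> k0; rewrite /laplace RintegralZr//; last exact: integrable_expR_tail.
by rewrite /Rintegral integral_expR_tail//= mulr0 expR0 mul1r mulrC.
Qed.

Definition delay (a : R) f (x : R) : R := if a <= x then f (x - a) else 0.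

Lemma exp_type_delay (a : R) K l f : 0 <= a -> exp_type K l f ->
  exp_type (K * expR (- l * a)) l (delay a f).
Proof.
move=> a0 [mf bf].
have K0 : 0 <= K by have := bf 0 (lexx _); rewrite mulr0 expR0 mulr1; exact: le_trans.
split.
  rewrite (_ : delay a f = (fun x => f (x - a)) \_ `[a, +oo[); last first.
    by apply/funext => x; rewrite patchE mem_setE in_itv/= andbT.
  apply/measurable_restrict => //.
  apply: (@measurable_comp _ _ _ _ _ _ `[(0 : R), +oo[) => //.
  - move=> _ [x [_ ax] <-] /=; move: ax; rewrite /= !in_itv/= !andbT.
    by rewrite subr_ge0.
  - exact: measurable_funB.
move=> x x0; rewrite /delay; case: ifPn => ax; last first.
  by rewrite normr0 mulr_ge0 ?expR_ge0// mulr_ge0 ?expR_ge0.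
rewrite (le_trans (bf _ _))// ?subr_ge0// -mulrA -expRD.
suff -> : l * (x - a) = - l * a + l * x by [].
by ring.
Qed.

Lemma laplace_delay (a : R) K l f k : 0 <= a -> exp_type K l f -> l < k ->
  laplace (delay a f) k = expR (- k * a) * laplace f k.
Proof.
move=> a0 ef lk.
pose g x := expR (- k * x) * f (x - a).
have mg : measurable_fun `[a, +oo[ g.
  apply: measurable_funM; first exact: measurable_expRM.
  apply: (@measurable_comp _ _ _ _ _ _ `[(0 : R), +oo[) => //.
  - move=> _ [x ax <-] /=; move: ax; rewrite /= !in_itv/= !andbT.
    by rewrite subr_ge0.
  - by case: ef.
  - exact: measurable_funB.
rewrite /laplace -RintegralZl//; last exact: exp_type_integrable ef lk.
transitivity (\int[mu]_(x in `[a, +oo[) g x).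
  rewrite Rintegral_mkcond [RHS]Rintegral_mkcond; apply: eq_Rintegral => x _.
  rewrite !patchE !mem_setE !in_itv/= !andbT /delay.
  case: (leP a x) => ax; last by rewrite mulr0; case: ifP.
  by rewrite (le_trans a0 ax).
rewrite /Rintegral; congr fine.
rewrite -(@integral_translate R a `[a, +oo[ (EFin \o g))//; last first.
  exact/measurable_EFinP.
rewrite (_ : [set x : R | `[a, +oo[%classic (x + a)] = `[0, +oo[%classic);
  last first.
  by apply/seteqP; split => x /=; rewrite !in_itv/= !andbT lerDr.
apply: eq_integral => x _; rewrite /g /= addrK mulrA -expRD.
by congr ((expR _ * _)%:E); ring.
Qed.

End laplace.

(** * Convolution with a decaying exponential *)

Section expconv.
Context {R : realType}.
Local Notation mu := (@lebesgue_measure R).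
Implicit Types (f M : R -> R) (k l K al : R).

(** The solution of [W' + al W = M] with [W(0) = 0]; on Laplace transforms it divides by the Robin
    factor [k + al]. *)
Definition expconv al M (x : R) : R :=
  \int[mu]_(r in `[0, x]) (expR (- al * (x - r)) * M r).

Lemma exp_type_integrable_itv K l M al (x : R) : exp_type K l M ->
  mu.-integrable `[0, x] (EFin \o (fun r => expR (al * r) * M r)).
Proof.
move=> [mM bM]; apply: measurable_bounded_integrable => //.
- exact: compact_finite_measure (@segment_compact _ _ _).
- apply: measurable_funM; first exact: measurable_expRM.
  apply: measurable_funS mM => //.
  exact: subset_itvl.
have K0 : 0 <= K by have := bM 0 (lexx _); rewrite mulr0 expR0 mulr1; exact: le_trans.
exists (K * expR ((`|al| + `|l|) * `|x|)); split; first exact: num_real.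
move=> y xy r /=; rewrite in_itv/= => /andP[r0 rx].
apply/ltW/le_lt_trans/xy; rewrite normrM ger0_norm ?expR_ge0//.
apply: (le_trans (ler_wpM2l (expR_ge0 _) (bM r r0))).
rewrite mulrCA ler_wpM2l// -expRD ler_expR mulrDl.
have rx' : r <= `|x| by rewrite (le_trans rx)// ler_norm.
have h (c : R) : c * r <= `|c| * `|x|.
  by rewrite (le_trans (ler_norm _))// normrM (ger0_norm r0) ler_wpM2l.
exact: lerD.
Qed.

(** The integrand of a double integral over the quadrant, cut off by [r <= x] and written as a
    function of [x] times a function of [r]: the slice in [x] is an exponential tail, the slice in
    [r] is the convolution. *)
Let F k al M (r x : R) : R :=
  if r <= x then expR (- (k + al) * x) * (expR (al * r) * M r) else 0.

Let FE k al M (r : R) : 0 <= r ->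
  (fun x => F k al M r x) \_ `[0, +oo[ =
  (fun x => expR (- (k + al) * x) * (expR (al * r) * M r)) \_ `[r, +oo[.
Proof.
move=> r0; apply/funext => x; rewrite !patchE !mem_setE !in_itv/= !andbT /F.
by case: (leP r x) => [rx|_]; [rewrite (le_trans r0 rx)|case: ifP].
Qed.

Let integrable_F1 k al M (r : R) : 0 <= r -> 0 < k + al ->
  mu.-integrable `[0, +oo[ (EFin \o F k al M r).
Proof.
move=> r0 kal; apply/integrable_mkcond => //.
rewrite restrict_EFin FE// -restrict_EFin.
apply/(integrable_mkcond _ _).1 => //.
rewrite (_ : _ \o _ = (fun x => (expR (- (k + al) * x))%:E *
  (expR (al * r) * M r)%:E)%E)//.
by apply: integrableZr => //; exact: integrable_expR_tail.
Qed.

Let integral_F1 k al M (r : R) : 0 <= r -> 0 < k + al ->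
  \int[mu]_(x in `[0, +oo[) F k al M r x = expR (- k * r) * M r / (k + al).
Proof.
move=> r0 kal; rewrite Rintegral_mkcond FE// -Rintegral_mkcond.
rewrite RintegralZr//; last exact: integrable_expR_tail.
rewrite {1}/Rintegral integral_expR_tail//=.
have -> : expR (- k * r) = expR (- (k + al) * r) * expR (al * r).
  by rewrite -expRD; congr expR; ring.
by ring.
Qed.

Let F2E k al M (x : R) : 0 <= x ->
  (fun r => F k al M r x) \_ `[0, +oo[ =
  (fun r => expR (- (k + al) * x) * (expR (al * r) * M r)) \_ `[0, x].
Proof.
move=> x0; apply/funext => r; rewrite !patchE !mem_setE !in_itv/= !andbT /F.
by case: (leP 0 r); case: (leP r x).
Qed.

Let integrable_F2 k al K l M (x : R) : exp_type K l M -> 0 <= x ->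
  mu.-integrable `[0, +oo[ (EFin \o (fun r => F k al M r x)).
Proof.
move=> eM x0; apply/integrable_mkcond => //.
rewrite restrict_EFin F2E// -restrict_EFin.
apply/(integrable_mkcond _ _).1 => //.
rewrite (_ : _ \o _ = (fun r => (expR (- (k + al) * x))%:E *
  (expR (al * r) * M r)%:E)%E)//.
by apply: integrableZl => //; exact: exp_type_integrable_itv eM.
Qed.

Let integral_F2 k al K l M (x : R) : exp_type K l M -> 0 <= x ->
  \int[mu]_(r in `[0, +oo[) F k al M r x = expR (- k * x) * expconv al M x.
Proof.
move=> eM x0; rewrite Rintegral_mkcond F2E// -Rintegral_mkcond.
rewrite RintegralZl//; last exact: exp_type_integrable_itv eM.
rewrite (_ : expconv _ _ _ =
    expR (- al * x) * \int[mu]_(r in `[0, x]) (expR (al * r) * M r)).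
  by rewrite mulrA -expRD; congr (expR _ * _); ring.
rewrite /expconv -RintegralZl//; last exact: exp_type_integrable_itv eM.
apply: eq_Rintegral => r _; rewrite mulrA -expRD.
by congr (expR _ * _); ring.
Qed.

Let measurable_F k al K l M : exp_type K l M ->
  measurable_fun (`[(0 : R), +oo[ `*` `[(0 : R), +oo[)
    (fun p : R * R => F k al M p.1 p.2).
Proof.
move=> [mM _].
have h1 : measurable_fun (`[(0 : R), +oo[ `*` `[(0 : R), +oo[)
    (fun p : R * R => M p.1).
  apply: (@measurable_comp _ _ _ _ _ _ `[(0 : R), +oo[) => //.
    by move=> _ [[r x] [/= r0 _] <-].
  exact: measurable_funTS.
have mDD : measurable (`[(0 : R), +oo[ `*` `[(0 : R), +oo[).
  exact: measurableX.
rewrite /F; apply: measurable_fun_if => //.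
- by apply: measurable_fun_ler; apply: measurable_funTS.
- apply: measurable_funM.
    apply: (@measurableT_comp _ _ _ _ _ _ (fun x : R => expR (- (k + al) * x))).
      exact: measurable_expRM.
    exact: measurable_funTS.
  apply: measurable_funM; last exact: measurable_funS h1.
  apply: (@measurableT_comp _ _ _ _ _ _ (fun x : R => expR (al * x))).
    exact: measurable_expRM.
  exact: measurable_funTS.
Qed.

Lemma expconv_laplace al K l M k : 0 <= al -> exp_type K l M -> l < k -> 0 < k ->
  measurable_fun `[(0 : R), +oo[ (expconv al M) /\
  laplace (expconv al M) k = laplace M k / (k + al).
Proof.
move=> al0 eM lk k0.
have kal : 0 < k + al by rewrite ltr_pwDl.
have mF := @measurable_F k al _ _ _ eM.
have mD : measurable `[(0 : R), +oo[ by [].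
have iM := exp_type_integrable eM lk.
have i12 : (mu \x mu)%E.-integrable (`[(0 : R), +oo[ `*` `[(0 : R), +oo[)
    (fun p => (F k al M p.1 p.2)%:E).
  apply: integrable_prod_of12 => //.
  have -> : (\int[mu]_(r in `[0%R, +oo[) \int[mu]_(x in `[0%R, +oo[)
      (`|F k al M r x|)%:E)%E =
      (\int[mu]_(r in `[0%R, +oo[) ((k + al)^-1 *
        (expR (- k * r) * `|M r|))%:E)%E.
    apply: eq_integral => r; rewrite inE/= in_itv/= andbT => r0.
    transitivity (\int[mu]_(x in `[0%R, +oo[) (F k al (fun r => `|M r|) r x)%:E)%E.
      apply: eq_integral => x _; rewrite /F; case: ifPn => _; last by rewrite normr0.
      by rewrite !normrM !(ger0_norm (expR_ge0 _)).
    rewrite mulrC -(integral_F1 (fun r => `|M r|))// fineK//.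
    by apply: integrable_fin_num => //; exact: integrable_F1.
  apply: integrable_lty => //.
  apply: (@integrableZl _ _ _ mu _ _ (k + al)^-1
    (EFin \o (fun r => expR (- k * r) * `|M r|))) => //.
  exact: exp_type_integrable (exp_type_norm eM) lk.
have if1 x : `[(0 : R), +oo[%classic x ->
    mu.-integrable `[0, +oo[ (fun y => (F k al M x y)%:E).
  by rewrite /= in_itv/= andbT => x0; exact: integrable_F1.
have if2 x : `[(0 : R), +oo[%classic x ->
    mu.-integrable `[0, +oo[ (fun y => (F k al M y x)%:E).
  by rewrite /= in_itv/= andbT => x0; apply: integrable_F2 eM x0.
split.
  (* Fubini makes the inner integral [exp (- k x) expconv al M x] measurable in [x]; multiplying by
     [exp (k x)] removes the weight. *)
  have m2 := @measurable_Rfubini2 _ _ _ _ _ mu mu _ _ _ mD mD i12 if2.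
  have : measurable_fun `[(0:R), +oo[ (fun x => expR (k * x) *
      \int[mu]_(r in `[0, +oo[) F k al M r x).
    by apply: measurable_funM => //; exact: measurable_expRM.
  apply: eq_measurable_fun => x; rewrite inE/= in_itv/= andbT => x0.
  rewrite (integral_F2 _ _ eM)// mulrA -expRD mulNr subrr.
  by rewrite expR0 mul1r.
have := @Rfubini1 _ _ _ _ _ mu mu _ _ _ mD mD i12 if1.
rewrite (@Rfubini2 _ _ _ _ _ mu mu _ _ _ mD mD i12 if2).
rewrite (@eq_Rintegral _ _ _ mu _ (fun x => expR (- k * x) * expconv al M x)); last first.
  by move=> x; rewrite inE/= in_itv/= andbT => x0; exact: integral_F2 eM x0.
rewrite /laplace => ->.
rewrite -RintegralZr//.
by apply: eq_Rintegral => x; rewrite inE/= in_itv/= andbT => x0; exact: integral_F1.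
Qed.

End expconv.

Section expconv_bounds.
Context {R : realType}.
Local Notation mu := (@lebesgue_measure R).
Implicit Types (f M : R -> R) (k l K al : R).

(** On [[0, x]] the bound on [M] is at most its value at [x], and the kernel has mass at most
    [1 / al]. The rate [l] is kept, and the factor [1 / al] will cancel against the coefficient
    [2 al] of the reflection. *)
Lemma exp_type_expconv al K l M : 0 < al -> 0 <= l -> exp_type K l M ->
  exp_type (K / al) l (expconv al M).
Proof.
move=> al0 l0 eM; split.
  have l1 : l < l + 1 by rewrite ltrDl.
  have k0 : 0 < l + 1 by rewrite ltr_wpDl.
  by have [] := expconv_laplace (ltW al0) eM l1 k0.
have K0 := exp_type_ge0 eM.
(* The explicit integral of the exponential asks for a nondegenerate interval, hence the separate
   case [x = 0]. *)
move=> x; rewrite le_eqVlt => /predU1P[<-|x0].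
  rewrite /expconv set_itv1 Rintegral_set1 normr0 mulr_ge0 ?expR_ge0//.
  by rewrite divr_ge0// ltW.
have iE c : mu.-integrable `[0, x] (EFin \o (fun r : R => expR (c * r))).
  apply: continuous_compact_integrable; first exact: segment_compact.
  by apply: continuous_subspaceT; exact: continuous_expRM.
have iM := exp_type_integrable_itv al x eM.
have -> : expconv al M x =
    expR (- al * x) * \int[mu]_(r in `[0, x]) (expR (al * r) * M r).
  rewrite -RintegralZl//; apply: eq_Rintegral => r _; rewrite mulrA -expRD.
  by congr (expR _ * _); ring.
rewrite normrM (ger0_norm (expR_ge0 _)).
apply: (@le_trans _ _ (expR (- al * x) *
    \int[mu]_(r in `[0, x]) (expR (al * r) * (K * expR (l * x))))).
  rewrite ler_wpM2l ?expR_ge0//.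
  apply: (le_trans (le_normr_Rintegral _ _)) => //.
  apply: le_Rintegral => //.
  - exact: integrable_norm.
  - exact: integrable_EFinZr.
  - move=> r /=; rewrite in_itv/= => /andP[r0 rx].
    rewrite normrM (ger0_norm (expR_ge0 _)) ler_wpM2l ?expR_ge0//.
    rewrite (le_trans (eM.2 r r0))// ler_wpM2l// ler_expR ler_wpM2l//.
rewrite RintegralZr// Rintegral_expR_itv ?gt_eqF// mulr0 expR0.
set e := expR (- al * x); set E := expR (al * x).
have eE : e * E = 1 by rewrite -expRD mulNr addNr expR0.
have -> : e * ((E - 1) / al * (K * expR (l * x))) =
  K / al * expR (l * x) * (e * E - e) by ring.
rewrite eE ler_piMr//; first by rewrite mulr_ge0 ?expR_ge0// divr_ge0// ltW.
by rewrite gerBl expR_ge0.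
Qed.

Lemma eq_expconv al M M' (x : R) : (forall r, 0 <= r <= x -> M r = M' r) ->
  expconv al M x = expconv al M' x.
Proof.
move=> MM'; apply: eq_Rintegral => r; rewrite inE/= in_itv/= => rx.
by rewrite MM'.
Qed.

End expconv_bounds.

(** * Summation of the reflections *)

Section reflection.
Context {R : realType}.
Variables (al K : R) (m : R -> R).
Hypotheses (al0 : 0 < al) (em : exp_type K 3 m).

(* [1 - 2 al / (k + al)] is the reflection coefficient [(k - al) / (k + al)] of the
   Robin end; the iteration adds the successive reflections, only finitely many of
   which reach a given point. *)
Fixpoint reflect_iter n : R -> R :=
  if n is n.+1 then
    fun x => m x + delay 2 (fun x => reflect_iter n x +
                            - (2 * al) * expconv al (reflect_iter n) x) x
  else fun=> 0.

Let iterS n x : reflect_iter n.+1 x = m x +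
  delay 2 (fun x => reflect_iter n x +
                    - (2 * al) * expconv al (reflect_iter n) x) x.
Proof. by []. Qed.

(** [1 + 2 al / al = 3]: a reflection costs a factor 3 whatever [al] is. *)
Let exp_type_reflected C M : exp_type C 3 M ->
  exp_type (3 * C) 3 (fun x => M x + - (2 * al) * expconv al M x).
Proof.
move=> eM; have C0 := exp_type_ge0 eM.
have eW := exp_type_scale (- (2 * al)) (exp_type_expconv al0 (ler0n _ 3) eM).
apply: exp_typeW (exp_type_add eM eW).
rewrite normrN ger0_norm; last by rewrite mulr_ge0// ltW.
have -> : 2 * al * (C / al) = 2 * C by field; rewrite gt_eqF.
by lra.
Qed.

(** The delay by 2 at rate 3 contributes [exp (- 6)], so the bound [2 K] reproduces itself:
    [K + 3 (2 K) exp (- 6) <= 2 K]. This needs [6 <= exp 6], read off [1 + 6 <= exp 6]; with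
    [1 + 2 l <= exp (2 l)] as the tool, [l = 3] is the least integer rate that works. *)
Let exp_type_iter n : exp_type (2 * K) 3 (reflect_iter n).
Proof.
have K0 := exp_type_ge0 em.
elim: n => [|n IH] /=.
  by apply: exp_type_cst => //; rewrite normr0 mulr_ge0.
have := exp_type_add em (exp_type_delay (ler0n _ 2) (exp_type_reflected IH)).
apply: exp_typeW; rewrite [leRHS]mulr_natl mulr2n lerD2l.
rewrite mulrA (_ : 3 * 2 = 6%:R); last by rewrite -natrM.
rewrite -mulrA mulrCA ler_piMr// mulNr expRN ler_pdivrMr ?expR_gt0// mul1r.
by apply: le_trans (expR_ge1Dx _); lra.
Qed.

Let laplace_iter n k : 3 < k -> laplace (reflect_iter n.+1) k =
  laplace m k + expR (- k * 2) * (1 - 2 * al / (k + al)) *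
    laplace (reflect_iter n) k.
Proof.
move=> k3 /=; have k0 : 0 < k by rewrite (lt_trans _ k3).
have eM := exp_type_iter n.
have eW := exp_type_expconv al0 (ler0n _ 3) eM.
rewrite (laplace_add em (exp_type_delay (ler0n _ 2) (exp_type_reflected eM)))//.
congr (_ + _); rewrite (laplace_delay _ (exp_type_reflected eM))//.
rewrite (laplace_add eM (exp_type_scale _ eW))// (laplace_scale _ eW)//.
rewrite (expconv_laplace (ltW al0) eM k3 k0).2.
by ring.
Qed.

(** As reflections are delayed by 2, the value at [x] depends on the previous iterate on
    [[0, x - 2]] only; each pass settles one more interval of length 2. *)
Let iter_stable n (x : R) : 0 <= x -> x < 2 * n%:R ->
  reflect_iter n.+1 x = reflect_iter n x.
Proof.
elim: n x => [|n IH] x x0; first by rewrite mulr0 ltNge x0.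
move=> xn; rewrite iterS [RHS]iterS; congr (_ + _); rewrite /delay.
case: ifPn => // x2.
have h r : 0 <= r <= x - 2 -> reflect_iter n.+1 r = reflect_iter n r.
  move=> /andP[r0 rx]; apply: IH => //; rewrite (le_lt_trans rx)//.
  by move: xn; rewrite -natr1; lra.
rewrite h; last by rewrite subr_ge0 x2 lexx.
by congr (_ + _ * _); exact: eq_expconv.
Qed.

Let iter_stableW n p (x : R) : (n <= p)%N -> 0 <= x -> x < 2 * n%:R ->
  reflect_iter p x = reflect_iter n x.
Proof.
move=> np x0 xn; elim: p np => [|p IH]; first by rewrite leqn0 => /eqP ->.
rewrite leq_eqVlt => /predU1P[->//|]; rewrite ltnS => np.
rewrite iter_stable ?IH// (lt_le_trans xn)// ler_wpM2l// ler_nat//.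
Qed.

Lemma reflection_exists : exists2 M, exp_type (2 * K) 3 M &
  forall k, 3 < k -> laplace M k =
    laplace m k + expR (- k * 2) * (1 - 2 * al / (k + al)) * laplace M k.
Proof.
(* Any index [n] with [x < 2 n] gives the final value; [truncn x + 1] already exceeds [x]. *)
pose M x := reflect_iter (Num.truncn x).+1 x.
have Mcvg x : 0 <= x -> reflect_iter n x @[n --> \oo] --> M x.
  move=> x0; apply: cvg_near_cst; near=> n.
  have xn : x < (Num.truncn x).+1%:R by rewrite truncnS_gt.
  apply: iter_stableW => //.
    by near: n; exact: nbhs_infty_ge.
  by rewrite (lt_le_trans xn)// ler_peMl// ler1n.
have eM : exp_type (2 * K) 3 M.
  split.
    apply: (@measurable_fun_cvg _ _ _ _ reflect_iter).
      by move=> n; have [] := exp_type_iter n.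
    by move=> x /=; rewrite in_itv/= andbT; exact: Mcvg.
  by move=> x x0; apply: (exp_type_iter _).2.
exists M => // k k3.
(* The bound [2 K exp (3 x)] is common to all iterates, so the recursion between transforms passes
   to the limit. *)
have Lcvg : laplace (reflect_iter n) k @[n --> \oo] --> laplace M k.
  have ik := @exp_type_integrable R (2 * K) 3
    (fun x => 2 * K * expR (3 * x)) k _ k3.
  have [|||||_] := @dominated_cvg_Rintegral _ _ _
    (@lebesgue_measure R) `[0, +oo[ (fun n x => expR (- k * x) * reflect_iter n x)
    (fun x => expR (- k * x) * M x)
    (fun x => expR (- k * x) * (2 * K * expR (3 * x))) => //.
  - move=> n; apply: measurable_funM; first exact: measurable_expRM.
    by have [] := exp_type_iter n.
  - move=> x /=; rewrite in_itv/= andbT => x0.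
    by apply: cvgMr; exact: Mcvg.
  - apply: ik; split.
      by apply: measurable_funM => //; exact: measurable_expRM.
    move=> x x0; rewrite ger0_norm// mulr_ge0 ?expR_ge0//.
    exact: exp_type_ge0 (exp_type_iter 0).
  - move=> n x /=; rewrite in_itv/= andbT => x0.
    rewrite normrM (ger0_norm (expR_ge0 _)) ler_wpM2l ?expR_ge0//.
    exact: (exp_type_iter n).2.
have L1 : laplace (reflect_iter n.+1) k @[n --> \oo] --> laplace m k +
    expR (- k * 2) * (1 - 2 * al / (k + al)) * laplace M k.
  under eq_fun do rewrite laplace_iter//.
  by apply: cvgD; [exact: cvg_cst|apply: cvgMr].
have /cvg_lim <- // := L1.
apply/esym/cvg_lim => //.
by move: Lcvg; rewrite -(@cvg_shiftS _ (fun n => laplace (reflect_iter n) k)).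
Unshelve. all: end_near. Qed.

End reflection.

(** * The heat kernel of the half-line *)

Section gauss_cdf.
Context {R : realType}.
Local Notation mu := (@lebesgue_measure R).

(** An unnormalized error function, increasing from [0] to [sqrt pi]; it serves to write an explicit
    antiderivative. *)
Definition gauss_cdf (z : R) : R := \int[mu]_(t in `]-oo, z]) gauss_fun t.

Lemma is_derive_gauss_cdf (z : R) : is_derive z 1 gauss_cdf (gauss_fun z).
Proof.
have zz : z < z + 1 by rewrite ltrDl.
have ig : mu.-integrable `]-oo, z + 1] (EFin \o @gauss_fun R).
  by apply: integrableS integrableT_gauss.
have [d1 d2] := continuous_FTC1 zz ig (ltNyr z) (@continuous_gauss_fun R z).
by apply: DeriveDef; [exact: d1|rewrite -derive1E].
Qed.

Let Rintegral_gauss : \int[mu]_x gauss_fun x = Num.sqrt (pi : R).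
Proof. by rewrite /Rintegral integralT_gauss. Qed.

Lemma gauss_cdf_cvgy (z : nat -> R) : z n @[n --> \oo] --> +oo ->
  gauss_cdf (z n) @[n --> \oo] --> Num.sqrt (pi : R).
Proof.
move=> zy; rewrite -Rintegral_gauss.
have -> : (fun n => gauss_cdf (z n)) =
    (fun n => \int[mu]_x (gauss_fun \_ `]-oo, z n]) x).
  by apply/funext => n; rewrite /gauss_cdf Rintegral_mkcond.
have [||||//] := @dominated_cvg_Rintegral _ _ _ mu setT
  (fun n => gauss_fun \_ `]-oo, z n]) (@gauss_fun R) (@gauss_fun R) _ _ _
  (@integrableT_gauss R).
- by [].
- move=> n; apply/(measurable_restrictT _ _).1 => //.
  by apply: measurable_funTS; exact: measurable_gauss_fun.
- move=> x _; apply: cvg_near_cst; near=> n.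
  rewrite patchE mem_set//= in_itv/=.
  by near: n; move/cvgryPge : zy; exact.
- move=> n x _; rewrite patchE; case: ifPn => _.
    by rewrite ger0_norm// gauss_fun_ge0.
  by rewrite normr0 gauss_fun_ge0.
Unshelve. all: end_near. Qed.

Lemma gauss_cdf_cvgNy (z : nat -> R) : z n @[n --> \oo] --> -oo ->
  gauss_cdf (z n) @[n --> \oo] --> (0 : R).
Proof.
move=> zy.
have -> : (fun n => gauss_cdf (z n)) =
    (fun n => \int[mu]_x (gauss_fun \_ `]-oo, z n]) x).
  by apply/funext => n; rewrite /gauss_cdf Rintegral_mkcond.
have [||||_] := @dominated_cvg_Rintegral _ _ _ mu setT
  (fun n => gauss_fun \_ `]-oo, z n]) (fun=> (0 : R)) (@gauss_fun R) _ _ _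
  (@integrableT_gauss R).
- by [].
- move=> n; apply/(measurable_restrictT _ _).1 => //.
  by apply: measurable_funTS; exact: measurable_gauss_fun.
- move=> x _; apply: cvg_near_cst; near=> n.
  rewrite patchE memNset//= in_itv/=; apply/negP; rewrite -ltNge.
  by near: n; move/cvgrNyPlt : zy; exact.
- move=> n x _; rewrite patchE; case: ifPn => _.
    by rewrite ger0_norm// gauss_fun_ge0.
  by rewrite normr0 gauss_fun_ge0.
by rewrite /Rintegral integral0.
Unshelve. all: end_near. Qed.

End gauss_cdf.

Section heat_kernel.
Context {R : realType}.
Local Notation mu := (@lebesgue_measure R).
Implicit Types k r s : R.

(** Twice the Gauss kernel [(4 pi s)^(-1/2) exp (- r^2 / (4 s))]: on the half-line with reflecting
    end, the image source doubles the value at the end. *)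
Definition heat_kernel r s : R :=
  (Num.sqrt pi * Num.sqrt s)^-1 * expR (- (r ^+ 2 / (4 * s))).

Lemma heat_kernel_ge0 r s : 0 <= heat_kernel r s.
Proof. by rewrite mulr_ge0 ?expR_ge0// invr_ge0 mulr_ge0// sqrtr_ge0. Qed.

Let sqrtpi_gt0 : 0 < Num.sqrt (pi : R).
Proof. by rewrite sqrtr_gt0 pi_gt0. Qed.

(** With [s = x^2], an antiderivative of the Laplace integrand of the heat kernel. The squares
    [(k x + r / (2 x))^2] and [(k x - r / (2 x))^2] differ from [k^2 x^2 + r^2 / (4 x^2)] by [k r]
    and [- k r], which the exponential factors cancel; the terms [r / (2 x^2)] of the two inner
    derivatives cancel each other. *)
Let H k r (x : R) : R := (k * Num.sqrt pi)^-1 *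
  (expR (k * r) * gauss_cdf (k * x + r / 2 * x^-1) +
   expR (- (k * r)) * gauss_cdf (k * x - r / 2 * x^-1)).

Let is_derive_H k r (x : R) : 0 < k -> 0 < x ->
  is_derive x 1 (H k r)
    (2 / Num.sqrt pi * expR (- (k ^+ 2 * x ^+ 2 + r ^+ 2 / (4 * x ^+ 2)))).
Proof.
move=> k0 x0; have x0' : x != 0 by rewrite gt_eqF.
pose a1 (x : R) : R := k * x + r / 2 * x^-1.
pose a2 (x : R) : R := k * x - r / 2 * x^-1.
have d1 : is_derive x 1 a1 (k - r / 2 * x ^- 2).
  have dV := @is_deriveV _ id x 1 1 x0' (is_derive_id x 1).
  by apply: is_derive_eq; rewrite /GRing.scale/=; ring.
have d2 : is_derive x 1 a2 (k + r / 2 * x ^- 2).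
  have dV := @is_deriveV _ id x 1 1 x0' (is_derive_id x 1).
  by apply: is_derive_eq; rewrite /GRing.scale/=; ring.
have g1 := is_derive1_comp (is_derive_gauss_cdf (a1 x)) d1.
have g2 := is_derive1_comp (is_derive_gauss_cdf (a2 x)) d2.
have -> : H k r = (fun x => (k * Num.sqrt pi)^-1 *
  (expR (k * r) * (gauss_cdf \o a1) x + expR (- (k * r)) * (gauss_cdf \o a2) x)).
  by [].
apply: is_derive_eq; rewrite /GRing.scale/= /gauss_fun.
set e := expR (- (k ^+ 2 * _ + _)).
have e1 : expR (k * r) * expR (- a1 x ^+ 2) = e.
  rewrite -expRD; congr expR; rewrite /a1; field; exact: x0'.
have e2 : expR (- (k * r)) * expR (- a2 x ^+ 2) = e.
  rewrite -expRD; congr expR; rewrite /a2; field; exact: x0'.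
rewrite [X in _ * (X + _)]mulrA e1 [X in _ * (_ + X)]mulrA e2.
by field; rewrite x0' !gt_eqF.
Qed.

Let N (n : nat) : R := n.+1%:R.

Let N_gt0 n : 0 < N n. Proof. by rewrite ltr0n. Qed.

Let N_ge1 n : 1 <= N n. Proof. by rewrite ler1n. Qed.

Let Ny : N n @[n --> \oo] --> +oo.
Proof. by rewrite (@cvg_shiftS _ (fun n => n%:R : R)); exact: cvgr_idn. Qed.

Let is_derive_Hsqrt k r s : 0 < k -> 0 < s ->
  is_derive s 1 (H k r \o Num.sqrt) (expR (- k ^+ 2 * s) * heat_kernel r s).
Proof.
move=> k0 s0; have qs0 : 0 < Num.sqrt s by rewrite sqrtr_gt0.
apply: (is_derive_eq (is_derive1_comp (is_derive_H r k0 qs0) (is_derive1_sqrt s0))).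
rewrite sqr_sqrtr ?ltW// /heat_kernel opprD expRD !mulNr.
by field; rewrite !gt_eqF.
Qed.

Lemma continuous_heat_kernel r s : 0 < s ->
  {for s, continuous (heat_kernel r)}.
Proof.
move=> s0.
apply: (@continuousM _ _ (fun s => (Num.sqrt pi * Num.sqrt s)^-1)
  (fun s => expR (- (r ^+ 2 / (4 * s))))).
  apply: continuousV; first by rewrite mulf_neq0// gt_eqF// sqrtr_gt0.
  by apply: continuousM; [exact: cst_continuous|exact: sqrt_continuous].
apply: continuous_comp; last exact: continuous_expR.
apply: continuousN; apply: continuousM; first exact: cst_continuous.
apply: continuousV; first by rewrite mulf_neq0// gt_eqF.
by apply: continuousM; [exact: cst_continuous|exact: cvg_id].
Qed.

Lemma measurable_heat_kernel r :
  measurable_fun `](0 : R), +oo[ (heat_kernel r).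
Proof.
apply: open_continuous_measurable_fun => //.
by move=> s; rewrite inE/= in_itv/= andbT; exact: continuous_heat_kernel.
Qed.

Let itv_pos n : (N n) ^- 2 <= (N n) ^+ 2.
Proof.
rewrite (@le_trans _ _ 1)//.
  by rewrite invf_le1 ?exprn_gt0// exprn_ege1.
by rewrite exprn_ege1.
Qed.

(** The transform pair behind subordination: a transform at [k^2] in time becomes an exponential of
    rate [k] in space. *)
Lemma integral_heat_kernel k r : 0 < k -> 0 < r ->
  (\int[mu]_(s in `]0%R, +oo[) (expR (- k ^+ 2 * s) * heat_kernel r s)%:E =
   (expR (- k * r) / k)%:E)%E.
Proof.
move=> k0 r0.
(* The endpoints are squares because the antiderivative is [H] evaluated at [sqrt s]. *)
pose D n : set (measurableTypeR R) := `[(N n) ^- 2, (N n) ^+ 2]%classic.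
have DE : \bigcup_n D n = `]0, +oo[%classic.
  apply/seteqP; split => [s [n _]|s] /=; rewrite ?/D/= !in_itv/= andbT.
    move=> /andP[h _]; apply: lt_le_trans h.
    by rewrite invr_gt0 exprn_gt0.
  move=> s0; pose n := Num.truncn (s + s^-1); exists n => //=.
  have : s + s^-1 < N n by rewrite truncnS_gt.
  have : N n <= N n ^+ 2 by rewrite expr2 ler_peMl// ltW.
  have : 0 < s^-1 by rewrite invr_gt0.
  move=> h1 h2 h3; rewrite in_itv/=; apply/andP; split; last by lra.
  by rewrite -[leRHS]invrK lef_pV2 ?posrE ?invr_gt0// ?exprn_gt0//; lra.
have ndD : {homo D : n m / (n <= m)%N >-> (n <= m)%O}.
  move=> n m nm; apply/subsetPset => s; rewrite /D/= !in_itv/= => /andP[h1 h2].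
  have Nnm : N n ^+ 2 <= N m ^+ 2.
    by rewrite lerXn2r ?nnegrE ?(ltW (N_gt0 _))// /N ler_nat ltnS.
  rewrite (le_trans h2)// andbT; apply: le_trans h1.
  by rewrite lef_pV2 ?posrE ?exprn_gt0.
have DP n s : D n s -> 0 < s.
  rewrite /D/= in_itv/= => /andP[h _]; apply: lt_le_trans h.
  by rewrite invr_gt0 exprn_gt0.
have mk : measurable_fun `](0 : R), +oo[ (fun s => expR (- k ^+ 2 * s) * heat_kernel r s).
  by apply: measurable_funM; [exact: measurable_expRM|exact: measurable_heat_kernel].
have mD n : measurable (D n) by exact: measurable_itv.
have := @ge0_nondecreasing_set_cvg_integral _ _ _ D
  (fun s => (expR (- k ^+ 2 * s) * heat_kernel r s)%:E) mu ndD mD.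
rewrite DE => h.
apply/esym; apply: (cvg_unique _ _ (h _ _)) => {h} //; last 2 first.
- move=> n; apply/measurable_EFinP; apply: measurable_funS mk => // s /DP.
  by rewrite /= in_itv/= andbT.
- by move=> n s _; rewrite lee_fin mulr_ge0 ?expR_ge0// heat_kernel_ge0.
have FTC n : (\int[mu]_(s in D n) (expR (- k ^+ 2 * s) * heat_kernel r s)%:E =
    (H k r (N n) - H k r (N n)^-1)%:E)%E.
  have dF s : D n s -> is_derive s 1 (H k r \o Num.sqrt)
      (expR (- k ^+ 2 * s) * heat_kernel r s).
    by move=> /DP s0; exact: is_derive_Hsqrt.
  have cF s : D n s -> {for s, continuous (H k r \o Num.sqrt)}.
    by move=> /dF[ds _]; exact/differentiable_continuous/derivable1_diffP.
  (* For [n = 0] the interval is the single point 1, to which the fundamental theorem is not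
     applied. *)
  have := itv_pos n; rewrite le_eqVlt => /predU1P[Neq|Nlt].
    have N1 : N n = 1.
      apply/eqP; rewrite -(@eqrXn2 _ 4)//= ?ltW// expr1n.
      rewrite (_ : 4 = 2 + 2)%N// exprD -{1}Neq mulVf//.
      by rewrite gt_eqF// exprn_gt0.
    by rewrite /D Neq set_itv1 integral_set1 N1 invr1 subrr.
  rewrite (@continuous_FTC2 _ _ (H k r \o Num.sqrt))//.
  - by rewrite /= -exprVn !sqrtr_sqr !ger0_norm// ?invr_ge0 ltW.
  - apply: continuous_in_subspaceT => s; rewrite inE => /DP s0.
    apply: (@continuousM _ _ (fun s => expR (- k ^+ 2 * s)) (heat_kernel r)).
      exact: continuous_expRM.
    exact: continuous_heat_kernel.
  - split.
    + by move=> s /subset_itv_oo_cc/dF[].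
    + by apply: cvg_at_right_filter; apply: cF; rewrite /D/= bound_itvE.
    + by apply: cvg_at_left_filter; apply: cF; rewrite /D/= bound_itvE.
  - move=> s sn; rewrite derive1E.
    by have [|_ ->//] := dF s; exact: subset_itv_oo_cc sn.
rewrite (funext FTC) /mkset.
apply: cvg_EFin; first exact: nearW.
rewrite /comp/=.
have kpi : k * Num.sqrt pi != 0 by rewrite mulf_neq0// gt_eqF.
(* At infinity both Gaussian terms tend to [sqrt pi]; at [0] the argument [k x - r / (2 x)] goes to
   [-oo], as [0 < r], and its term drops out. Only the term in [exp (- k r)] survives in the
   difference. *)
have -> : expR (- k * r) / k = (k * Num.sqrt pi)^-1 *
    (expR (k * r) * Num.sqrt pi + expR (- (k * r)) * Num.sqrt pi) -
    (k * Num.sqrt pi)^-1 * (expR (k * r) * Num.sqrt pi + expR (- (k * r)) * 0).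
  by rewrite mulNr; field; rewrite !gt_eqF.
have lin (c d : R) : 0 < c -> c * N n - d @[n --> \oo] --> +oo.
  move=> c0; apply/cvgryPge => A; near=> n.
  have : (A + d) / c <= N n by near: n; move/cvgryPge : Ny; exact.
  by rewrite ler_pdivrMr// mulrC; lra.
have r20 : 0 < r / 2 by rewrite divr_gt0.
have N1 n : 0 < (N n)^-1 <= 1 by rewrite invr_gt0 N_gt0 invf_le1 ?N_ge1.
have rN n : 0 <= r / 2 * (N n)^-1 <= r / 2.
  have /andP[h1 h2] := N1 n.
  by apply/andP; split; [apply: mulr_ge0; exact: ltW|apply: ler_piMr => //; exact: ltW].
have c1 : k * N n + r / 2 * (N n)^-1 @[n --> \oo] --> +oo.
  apply/cvgryPge => A; near=> n.
  have : A <= k * N n - 0 by near: n; move/cvgryPge : (lin k 0 k0); exact.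
  by have /andP[] := rN n; set z := _ / _ * _; lra.
have c2 : k * N n - r / 2 * (N n)^-1 @[n --> \oo] --> +oo.
  apply/cvgryPge => A; near=> n.
  have : A <= k * N n - r / 2.
    by near: n; move/cvgryPge : (lin k (r / 2) k0); exact.
  by have /andP[] := rN n; set z := _ / _ * _; lra.
have kN n : 0 <= k * (N n)^-1 <= k.
  have /andP[h1 h2] := N1 n.
  by apply/andP; split; [apply: mulr_ge0; exact: ltW|apply: ler_piMr => //; exact: ltW].
have c3 : k * (N n)^-1 + r / 2 * (N n)^-1^-1 @[n --> \oo] --> +oo.
  apply/cvgryPge => A; near=> n; rewrite invrK.
  have : A <= r / 2 * N n - 0.
    by near: n; move/cvgryPge : (lin _ 0 r20); exact.
  by have /andP[] := kN n; set z := k * _^-1; lra.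
have c4 : k * (N n)^-1 - r / 2 * (N n)^-1^-1 @[n --> \oo] --> -oo.
  apply/cvgrNyPle => A; near=> n; rewrite invrK.
  have : - A <= r / 2 * N n - k.
    by near: n; move/cvgryPge : (lin _ k r20); exact.
  by have /andP[] := kN n; set z := k * _^-1; lra.
apply: cvgB; apply: cvgMr; apply: cvgD; apply: cvgMr.
- exact: gauss_cdf_cvgy.
- exact: gauss_cdf_cvgy.
- exact: gauss_cdf_cvgy.
- exact: gauss_cdf_cvgNy.
Unshelve. all: end_near. Qed.

End heat_kernel.

(** * From a Laplace transform at k to one at k^2 *)

Section subordination.
Context {R : realType}.
Local Notation mu := (@lebesgue_measure R).
Implicit Types (E : R -> R) (k l K u s : R).

(** Completing the square: [(l + 1) x - u x^2 <= (l + 1)^2 / (4 u)]. The resulting rate [- 1] is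
    negative, so integrability can be read off at [k = 0]. *)
Lemma exp_type_gauss K l E u : 0 < u -> exp_type K l E ->
  exp_type (K * expR ((l + 1) ^+ 2 / (4 * u))) (- 1)
    (fun x => expR (- (u * x ^+ 2)) * E x).
Proof.
move=> u0 [mE bE]; split.
  apply: measurable_funM => //; apply: measurable_funTS.
  apply: measurableT_comp => //; apply: measurable_funN.
  by apply: measurable_funM => //; exact: measurable_funX.
move=> x x0; rewrite normrM (ger0_norm (expR_ge0 _)).
apply: (le_trans (ler_wpM2l (expR_ge0 _) (bE x x0))).
rewrite mulrCA -mulrA ler_wpM2l//; first exact: exp_type_ge0 (conj mE bE).
rewrite -!expRD ler_expR -subr_ge0.
rewrite (_ : _ - _ = (2 * u * x - (l + 1)) ^+ 2 / (4 * u)); last first.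
  by field; rewrite gt_eqF.
by rewrite divr_ge0 ?sqr_ge0// mulr_ge0// ltW.
Qed.

(** In the variable [x^2] this is a Laplace transform in [u], whence its analyticity on [u > 0]. *)
Definition gauss_laplace E u : R :=
  \int[mu]_(x in `[0, +oo[) (expR (- (u * x ^+ 2)) * E x).

Lemma integrable_gauss_laplace K l E u : 0 < u -> exp_type K l E ->
  mu.-integrable `[0, +oo[ (EFin \o (fun x => expR (- (u * x ^+ 2)) * E x)).
Proof.
move=> u0 /(exp_type_gauss u0) /exp_type_integrable => /(_ 0 (ltrN10 _)).
by apply: eq_integrable => // x _; rewrite /= mulNr mul0r oppr0 expR0 mul1r.
Qed.

(* The heat kernel of the half-line with a reflecting end, [exp (- x^2 / (4 s)) / sqrt (pi s)],
   integrated against [E]. *)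
Definition heat_transform E s : R :=
  (Num.sqrt pi * Num.sqrt s)^-1 * gauss_laplace E (4 * s)^-1.

Let f k E s r : R := expR (- k ^+ 2 * s) * heat_kernel r s * E r.

Let measurable_f k E : measurable_fun `[(0 : R), +oo[ E ->
  measurable_fun (`](0 : R), +oo[ `*` `](0 : R), +oo[)
    (fun p : R * R => f k E p.1 p.2).
Proof.
move=> mE.
have mDD : measurable (`](0 : R), +oo[ `*` `](0 : R), +oo[).
  exact: measurableX.
have m1 (h : R -> R) : measurable_fun `](0 : R), +oo[ h ->
    measurable_fun (`](0 : R), +oo[ `*` `](0 : R), +oo[) (fun p : R * R => h p.1).
  move=> mh; apply: (@measurable_comp _ _ _ _ _ _ `](0 : R), +oo[) => //.
    by move=> _ [[r x] [/= r0 _] <-].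
  exact: measurable_funTS.
have m2 (h : R -> R) : measurable_fun `](0 : R), +oo[ h ->
    measurable_fun (`](0 : R), +oo[ `*` `](0 : R), +oo[) (fun p : R * R => h p.2).
  move=> mh; apply: (@measurable_comp _ _ _ _ _ _ `](0 : R), +oo[) => //.
    by move=> _ [[r x] [/= _ x0] <-].
  exact: measurable_funTS.
have mc (h : R -> R) : (forall s, 0 < s -> {for s, continuous h}) ->
    measurable_fun `](0 : R), +oo[ h.
  move=> ch; apply: open_continuous_measurable_fun => //.
  by move=> s; rewrite inE/= in_itv/= andbT; exact: ch.
apply: measurable_funM; last first.
  apply: m2; apply: measurable_funS mE => // x /=.
  by rewrite !in_itv/= !andbT; exact: ltW.
apply: measurable_funM.
  by apply: (m1 (fun s => expR (- k ^+ 2 * s))); exact: measurable_expRM.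
apply: measurable_funM.
  apply: (m1 (fun s => (Num.sqrt pi * Num.sqrt s)^-1)); apply: mc => s s0.
  apply: continuousV; first by rewrite mulf_neq0// gt_eqF// sqrtr_gt0 ?pi_gt0.
  by apply: continuousM; [exact: cst_continuous|exact: sqrt_continuous].
apply: measurableT_comp => //; apply: measurable_funN.
apply: measurable_funM.
  by apply: (m2 (fun r => r ^+ 2)); apply: measurable_funX.
apply: (m1 (fun s => (4 * s)^-1)); apply: mc => s s0.
apply: continuousV; first by rewrite mulf_neq0// gt_eqF.
by apply: continuousM; [exact: cst_continuous|exact: cvg_id].
Qed.

Lemma integrable_heat_kernel k r : 0 < k -> 0 < r ->
  mu.-integrable `]0, +oo[
    (EFin \o (fun s => expR (- k ^+ 2 * s) * heat_kernel r s)).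
Proof.
move=> k0 r0; apply/integrableP; split.
  apply/measurable_EFinP; apply: measurable_funM; first exact: measurable_expRM.
  exact: measurable_heat_kernel.
under eq_integral do rewrite /= ger0_norm ?mulr_ge0 ?expR_ge0 ?heat_kernel_ge0//.
by rewrite integral_heat_kernel// ltry.
Qed.

(** Fubini, with the integral in [s] done first: the kernel yields [exp (- k r) / k], and the
    absolute integral is that of [exp (- k r) |E r| / k], finite as [l < k]. The half-line in [r] is
    open because [integral_heat_kernel] requires [0 < r]. *)
Lemma heat_transform_laplace K l E k : exp_type K l E -> l < k -> 0 < k ->
  mu.-integrable `]0, +oo[
    (EFin \o (fun s => expR (- k ^+ 2 * s) * heat_transform E s)) /\
  \int[mu]_(s in `]0, +oo[) (expR (- k ^+ 2 * s) * heat_transform E s) =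
  laplace E k / k.
Proof.
move=> eE lk k0.
have mD : measurable `](0 : R), +oo[ by [].
have mf := measurable_f k eE.1.
have sub0 : `](0 : R), +oo[ `<=` `[0, +oo[.
  by move=> x /=; rewrite !in_itv/= !andbT; exact: ltW.
have iE := exp_type_integrable eE lk.
have if2 r : `](0 : R), +oo[%classic r ->
    mu.-integrable `]0, +oo[ (fun s => (f k E s r)%:E).
  rewrite /= in_itv/= andbT => r0.
  exact: integrable_EFinZr (integrable_heat_kernel k0 r0).
have fE s : f k E s = (fun r => expR (- k ^+ 2 * s) *
  (Num.sqrt pi * Num.sqrt s)^-1 * (expR (- ((4 * s)^-1 * r ^+ 2)) * E r)).
  by apply/funext => r; rewrite /f /heat_kernel (mulrC (r ^+ 2)) !mulrA.
have if1 s : `](0 : R), +oo[%classic s ->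
    mu.-integrable `]0, +oo[ (fun r => (f k E s r)%:E).
  rewrite /= in_itv/= andbT => s0; rewrite fE.
  apply: integrable_EFinZl => //.
  apply: (@integrableS _ _ _ mu _ _ _ _ _ sub0) => //.
  by apply: integrable_gauss_laplace eE; rewrite invr_gt0 mulr_gt0.
have i12 : (mu \x mu)%E.-integrable (`](0 : R), +oo[ `*` `](0 : R), +oo[)
    (fun p => (f k E p.1 p.2)%:E).
  apply: integrable_prod_of21 => //.
  have -> : (\int[mu]_(r in `]0%R, +oo[) \int[mu]_(s in `]0%R, +oo[)
      (`|f k E s r|)%:E)%E =
      (\int[mu]_(r in `]0%R, +oo[) (k^-1 * (expR (- k * r) * `|E r|))%:E)%E.
    apply: eq_integral => r; rewrite inE/= in_itv/= andbT => r0.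
    transitivity (\int[mu]_(s in `]0%R, +oo[)
        ((expR (- k ^+ 2 * s) * heat_kernel r s)%:E * (`|E r|)%:E))%E.
      apply: eq_integral => s _; rewrite /f normrM.
      by rewrite (@ger0_norm _ (_ * heat_kernel _ _))// mulr_ge0 ?expR_ge0 ?heat_kernel_ge0.
    rewrite integralZr//; last exact: integrable_heat_kernel.
    by rewrite integral_heat_kernel// -EFinM mulrAC mulrC.
  apply: integrable_lty => //; apply: (@integrableS _ _ _ mu _ _ _ _ _ sub0) => //.
  apply: (@integrable_EFinZl _ _ _ mu _ (fun r => expR (- k * r) * `|E r|)) => //.
  exact: exp_type_integrable (exp_type_norm eE) lk.
have inner s : 0 < s -> \int[mu]_(r in `]0, +oo[) f k E s r =
    expR (- k ^+ 2 * s) * heat_transform E s.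
  move=> s0; rewrite Rintegral_itv_obnd_cbnd; last first.
    by apply: if1; rewrite /= in_itv/= andbT.
  rewrite fE RintegralZl//; first by rewrite mulrA.
  by apply: integrable_gauss_laplace eE; rewrite invr_gt0 mulr_gt0.
split.
  have := @integrable_Rfubini1 _ _ _ _ _ mu mu _ _ _ mD mD i12 if1.
  apply: eq_integrable => // s; rewrite inE/= in_itv/= andbT => s0.
  by rewrite /= inner.
transitivity (\int[mu]_(s in `]0, +oo[) \int[mu]_(r in `]0, +oo[) f k E s r).
  by apply: eq_Rintegral => s; rewrite inE/= in_itv/= andbT => s0; rewrite inner.
rewrite -(@Rfubini1 _ _ _ _ _ mu mu _ _ _ mD mD i12 if1).
rewrite (@Rfubini2 _ _ _ _ _ mu mu _ _ _ mD mD i12 if2).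
transitivity (\int[mu]_(r in `]0, +oo[) (k^-1 * (expR (- k * r) * E r))).
  apply: eq_Rintegral => r; rewrite inE/= in_itv/= andbT => r0.
  rewrite /f RintegralZr//; last exact: integrable_heat_kernel.
  by rewrite /Rintegral integral_heat_kernel//= mulrAC mulrC.
rewrite Rintegral_itv_obnd_cbnd; last first.
  apply: (@integrableS _ _ _ mu _ _ _ _ _ sub0) => //.
  exact: integrable_EFinZl.
by rewrite RintegralZl// mulrC.
Qed.

End subordination.

Section exponential_series.
Context {R : realType}.
Implicit Types x : R.

Lemma series_exp_le x n : 0 <= x -> series (exp_coeff x) n <= expR x.
Proof.
move=> x0; apply: nondecreasing_cvgn_le; last exact: is_cvg_series_exp_coeff.
apply/nondecreasing_seqP => m; rewrite /series/= big_nat_recr//= lerDl.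
exact: exp_coeff_ge0.
Qed.

Lemma norm_series_exp_le x n : `|series (exp_coeff x) n| <= expR `|x|.
Proof.
apply: le_trans (series_exp_le n (normr_ge0 x)).
apply: (le_trans (ler_norm_sum _ _ _)).
by apply: ler_sum => i _; rewrite !exp_coeffE normrM normrX normfV normr_nat.
Qed.

End exponential_series.

(** * Inversion of the Laplace transform up to an exponentially small error *)

Section phragmen.
Context {R : realType}.
Local Notation mu := (@lebesgue_measure R).
Variables (T T' C p0 : R) (r : R -> R).
Hypotheses (T0 : 0 < T) (T'T : T' <= T).
Hypothesis ir : mu.-integrable `]0, T] (EFin \o r).
Hypothesis rC : forall p, p0 <= p ->
  `|\int[mu]_(s in `]0, T]) (expR (- p * s) * r s)| <= C * expR (- p * T').

Let mD : measurable `](0 : R), T]. Proof. by []. Qed.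

Let bounded_int (h : R -> R) (M : R) : measurable_fun `](0 : R), T] h ->
  (forall s, 0 < s <= T -> `|h s| <= M) ->
  mu.-integrable `]0, T] (EFin \o (fun s => h s * r s)).
Proof.
move=> mh hM.
have mr : measurable_fun `](0 : R), T] r.
  by have /measurable_int/measurable_EFinP := ir.
have := @integrable_EFinZl _ _ _ mu _ _ M mD (integrable_norm ir).
apply: le_integrable => //.
  by apply/measurable_EFinP; apply: measurable_funM.
move=> s /=; rewrite in_itv/= => sT; rewrite lee_fin !normrM normr_id.
by rewrite ler_wpM2r// (le_trans (hM s sT))// ler_norm.
Qed.

(* For large [p], [1 - exp (- exp (p (x - s)))] approaches the indicator of [s < x];
   expanded in powers of [exp (p (x - s))], it only involves the Laplace transform
   of [r] at multiples of [p]. *)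
Let a n (x p s : R) : R := 1 - series (exp_coeff (- expR (p * (x - s)))) n.

Let measurable_a n x p : measurable_fun `](0 : R), T] (a n x p).
Proof.
have me : measurable_fun `](0 : R), T] (fun s => - expR (p * (x - s))).
  apply: measurable_funN; apply: measurableT_comp => //.
  by apply: measurable_funM => //; exact: measurable_funB.
apply: measurable_funB => //; rewrite /series/=.
apply: measurable_sum => i.
by apply: measurable_funM => //; exact: measurable_funX.
Qed.

Let exp_le (x p s : R) : 0 <= p -> 0 <= x -> 0 < s -> expR (p * (x - s)) <= expR (p * x).
Proof. by move=> p0' x0 s0; rewrite ler_expR ler_wpM2l// gerBl ltW. Qed.

Let a_le n (x p s : R) : 0 <= p -> 0 <= x -> 0 < s ->
  `|a n x p s| <= 1 + expR (expR (p * x)).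
Proof.
move=> p0' x0 s0; rewrite (le_trans (ler_normB _ _))// normr1 lerD2l.
rewrite (le_trans (norm_series_exp_le _ _))// ler_expR normrN.
by rewrite ger0_norm ?expR_ge0// exp_le.
Qed.

(** The term of degree [j] is, up to sign, [exp (j p x) / j!] times the transform of [r] at [j p],
    hence at most [C exp (- j p (T' - x)) / j!]; multiples of [p] stay above [p0]. *)
Let int_a n x p : 0 <= p -> p0 <= p -> 0 < p -> 0 <= x ->
  `|\int[mu]_(s in `]0, T]) (a n.+1 x p s * r s)| <=
  C * (series (exp_coeff (expR (- p * (T' - x)))) n.+1 - 1).
Proof.
move=> p0' pp0 pgt0 x0; elim: n => [|n IH].
  (* The constant term of the series cancels the 1 in [a], so only transforms at [j p] with [1 <= j]
     occur. *)
  rewrite /series/= big_nat1 /exp_coeff/= expr0 fact0 divr1 subrr mulr0.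
  under eq_Rintegral do rewrite /a /series/= big_nat1 /exp_coeff/= expr0 fact0
    divr1 subrr mul0r.
  by rewrite /Rintegral integral0 normr0.
have aS s : a n.+2 x p s * r s = a n.+1 x p s * r s +
    (- ((- 1) ^+ n.+1 / n.+1`!%:R * expR (n.+1%:R * p * x))) *
    (expR (- (n.+1%:R * p) * s) * r s).
  rewrite /a /series/= big_nat_recr//= opprD addrA mulrDl; congr (_ + _).
  rewrite exp_coeffE/= [in LHS]exprNn -expRM_natl.
  rewrite [in LHS](_ : n.+1%:R * (p * (x - s)) =
    n.+1%:R * p * x + - (n.+1%:R * p) * s); last by ring.
  by rewrite expRD; ring.
under eq_Rintegral do rewrite aS.
have ie q : 0 <= q -> mu.-integrable `]0, T] (EFin \o (fun s => expR (- q * s) * r s)).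
  move=> q0; apply: (@bounded_int _ 1); first exact: measurable_expRM.
  move=> s /andP[s0 _]; rewrite ger0_norm ?expR_ge0// -expR0 ler_expR mulNr oppr_le0.
  by rewrite mulr_ge0// ltW.
have np : p <= n.+1%:R * p by rewrite ler_peMl// ler1n.
have inp := ie _ (le_trans p0' np).
rewrite RintegralD//; last 2 first.
- apply: (bounded_int (measurable_a _ _ _)) => s /andP[s0 _].
  exact: a_le.
- exact: integrable_EFinZl.
rewrite (le_trans (ler_normD _ _))//.
rewrite [in leRHS]/series/= big_nat_recr//= -/(series _ _) addrAC mulrDr lerD//.
rewrite RintegralZl// normrM normrN normrM.
rewrite (ger0_norm (expR_ge0 _)) normrM normrX normrN1 expr1n mul1r.
rewrite normfV normr_nat.
have := rC (le_trans pp0 np).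
move=> /(ler_wpM2l (mulr_ge0 (_ : 0 <= n.+1`!%:R^-1) (expR_ge0 (n.+1%:R * p * x)))).
rewrite invr_ge0 ler0n => /(_ isT) /le_trans; apply.
rewrite exp_coeffE/= -expRM_natl.
rewrite (_ : n.+1%:R * (- p * (T' - x)) = n.+1%:R * p * x + - (n.+1%:R * p) * T');
  last by ring.
rewrite expRD le_eqVlt; apply/orP; left; apply/eqP; ring.
Qed.

(** Here [p] is fixed and the degree tends to infinity, dominated by [1 + exp (exp (p x))]. The
    bound obtained tends to [0] as [p] grows, provided [x < T']. *)
Let e_int x p : 0 <= p -> p0 <= p -> 0 < p -> 0 <= x ->
  `|\int[mu]_(s in `]0, T]) ((1 - expR (- expR (p * (x - s)))) * r s)| <=
  C * (expR (expR (- p * (T' - x))) - 1).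
Proof.
move=> p1 pp0 p2 x0.
have [||||_] := @dominated_cvg_Rintegral _ _ _ mu `]0, T]
  (fun n s => a n.+1 x p s * r s)
  (fun s => (1 - expR (- expR (p * (x - s)))) * r s)
  (fun s => (1 + expR (expR (p * x))) * `|r s|) mD.
- move=> n; apply: measurable_funM; first exact: measurable_a.
  by have /measurable_int/measurable_EFinP := ir.
- move=> s _; apply: cvgMl; apply: cvgB; first exact: cvg_cst.
  rewrite (@cvg_shiftS _ (series (exp_coeff (- expR (p * (x - s)))))).
  exact: is_cvg_series_exp_coeff.
- exact: integrable_EFinZl (integrable_norm ir).
- move=> n s /=; rewrite in_itv/= => /andP[s0 _].
  by rewrite normrM ler_wpM2r// a_le.
move=> cv.
have cv' : C * (series (exp_coeff (expR (- p * (T' - x)))) n.+1 - 1) @[n --> \oo]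
    --> C * (expR (expR (- p * (T' - x))) - 1).
  apply: cvgMr; apply: cvgB; last exact: cvg_cst.
  rewrite (@cvg_shiftS _ (series (exp_coeff (expR (- p * (T' - x)))))).
  exact: is_cvg_series_exp_coeff.
apply: ler_cvg_to (cvg_norm cv) cv' _.
by apply: nearW => n; exact: int_a.
Qed.

Lemma phragmen_integral (x : R) : 0 < x -> x < T' ->
  \int[mu]_(s in `]0, x]) r s = 0.
Proof.
move=> x0 xT'.
have xT : x < T by rewrite (lt_le_trans xT').
(* The value [1 - exp (- 1)] is the true limit at [s = x], so the convergence holds at every
   point. *)
pose h s : R := if s < x then 1 else if s == x then 1 - expR (- 1) else 0.
have mr : measurable_fun `](0 : R), T] r.
  by have /measurable_int/measurable_EFinP := ir.
pose p (n : nat) : R := n%:R + Num.max p0 1.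
have p1 n : 1 <= p n by rewrite ler_wpDl// le_max lexx orbT.
have pp0 n : p0 <= p n by rewrite ler_wpDl// le_max lexx.
have py c : 0 < c -> p n * c @[n --> \oo] --> +oo.
  move=> c0; apply/cvgryPge => A; near=> n.
  rewrite -ler_pdivrMr// (@le_trans _ _ n%:R)//; last first.
    by rewrite lerDl le_max ler01 orbT.
  by near: n; exact: nbhs_infty_ger.
have cexp (c : R) : 0 < c -> expR (- (p n * c)) @[n --> \oo] --> (0 : R).
  by move=> c0; exact: cvg_comp (py _ c0) (@cvgr_expR R).
have [||||ih] := @dominated_cvg_Rintegral _ _ _ mu `]0, T]
  (fun n s => (1 - expR (- expR (p n * (x - s)))) * r s)
  (fun s => h s * r s) (fun s => `|r s|) mD.
- move=> n; apply: measurable_funM => //; apply: measurable_funB => //.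
  apply: measurableT_comp => //; apply: measurable_funN.
  apply: measurableT_comp => //; apply: measurable_funM => //.
  exact: measurable_funB.
- move=> s _; apply: cvgMl; rewrite /h.
  case: (ltgtP s x) => sx.
  + rewrite -[X in _ --> X]subr0; apply: cvgB; first exact: cvg_cst.
    apply: cvg_comp (@cvgr_expR R); apply/cvgryPge => A.
    have := py (x - s); rewrite subr_gt0 => /(_ sx)/cvgryPge => /(_ A).
    apply: filterS => n /le_trans; apply.
    by rewrite (le_trans _ (expR_ge1Dx _))// lerDr.
  + rewrite -[X in _ --> X](subrr 1); apply: cvgB; first exact: cvg_cst.
    rewrite -[X in _ --> X]expR0; apply: continuous_cvg.
      exact: continuous_expR.
    rewrite -[X in _ --> X]oppr0; apply: cvgN.
    have := cexp (s - x); rewrite subr_gt0 => /(_ sx).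
    by under eq_fun do rewrite -mulrN opprB.
  + by rewrite sx subrr; under eq_fun do rewrite mulr0 expR0; exact: cvg_cst.
- exact: integrable_norm ir.
- move=> n s _; rewrite normrM ler_piMl//.
  rewrite ger0_norm ?subr_ge0 -?expR0 ?ler_expR ?oppr_le0 ?expR_ge0//.
  by rewrite expR0 gerBl expR_ge0.
move=> cv.
have {}cv : \int[mu]_(s in `]0, T]) (h s * r s) = 0.
  apply: (cvg_unique _ cv) => //; apply: norm_cvg0.
  apply: (@squeeze_cvgr _ _ _ _ (fun=> 0)
    (fun n => C * (expR (expR (- (p n * (T' - x)))) - 1))); last 2 first.
  - exact: cvg_cst.
  - rewrite -[X in _ --> X](mulr0 C); apply: cvgMr.
    rewrite -[X in _ --> X](subrr 1); apply: cvgB; last exact: cvg_cst.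
    rewrite -[X in _ --> X]expR0; apply: continuous_cvg.
      exact: continuous_expR.
    by apply: cexp; rewrite subr_gt0.
  - apply: nearW => n; rewrite normr_ge0/=.
    have p00 : 0 < p n by rewrite (lt_le_trans ltr01).
    by have := e_int (ltW p00) (pp0 n) p00 (ltW x0); rewrite mulNr.
have s1 : `](0 : R), x] `<=` `]0, T] by apply: subset_itvl; rewrite bnd_simp ltW.
have s2 : `](0 : R), x[ `<=` `]0, T] by apply: subset_itvl; rewrite bnd_simp ltW.
have ir1 : mu.-integrable `]0, x] (EFin \o r).
  exact: (@integrableS _ _ _ mu _ _ _ _ _ s1).
have ih1 : mu.-integrable `]0, x] (EFin \o (fun s => h s * r s)).
  exact: (@integrableS _ _ _ mu _ _ _ _ _ s1).
rewrite -Rintegral_itv_bndo_bndc; last first.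
  exact: (@integrableS _ _ _ mu _ _ _ _ _ s2).
transitivity (\int[mu]_(s in `]0, x[) (h s * r s)).
  apply: eq_Rintegral => s; rewrite inE/= in_itv/= => /andP[_ sx].
  by rewrite /h sx mul1r.
rewrite Rintegral_itv_bndo_bndc; last first.
  exact: (@integrableS _ _ _ mu _ _ _ _ _ s2).
have := @Rintegral_itvB _ (fun s => h s * r s) (BRight 0) (BRight T) x ih.
rewrite !bnd_simp => /(_ (ltW x0) (ltW xT)); rewrite cv sub0r => /eqP.
rewrite eqr_oppLR => /eqP ->.
rewrite (_ : Rintegral _ _ _ = \int[mu]_(s in `]x, T]) 0).
  by rewrite /Rintegral integral0 oppr0.
apply: eq_Rintegral => s; rewrite inE/= in_itv/= => /andP[xs _].
by rewrite /h ltNge ltW//= gt_eqF// mul0r.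
Unshelve. all: end_near. Qed.

Lemma phragmen_eq0 (x : R) : {in `]0, T'[, forall s, {for s, continuous r}} ->
  0 < x -> x < T' -> r x = 0.
Proof.
move=> cr x0 xT'.
have xT : x < T by rewrite (lt_le_trans xT').
have cx : {for x, continuous r} by apply: cr; rewrite in_itv/= x0.
have ax : (BRight 0 < BRight x)%O by rewrite bnd_simp.
have [_ <-] := continuous_FTC1 xT ir ax cx.
rewrite derive1E (@near_eq_derive _ _ _ _ (fun=> 0))//; first exact: derive_cst.
have /near_in_itvoo : x \in `]0, T'[ by rewrite in_itv/= x0.
apply: filterS => y; rewrite in_itv/= => /andP[y0 yT'].
exact: phragmen_integral.
Qed.

End phragmen.

Section exponential_remainder.
Context {R : realType}.

Lemma exp_coeff_le_expR (x : R) n : 0 <= x -> x ^+ n / n`!%:R <= expR x.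
Proof.
move=> x0; apply: le_trans (series_exp_le n.+1 x0).
rewrite /series/= big_nat_recr//= lerDr.
by apply: sumr_ge0 => i _; exact: exp_coeff_ge0.
Qed.

Lemma exprn_le_expR (c x : R) n : 0 < c -> 0 <= x ->
  x ^+ n <= n`!%:R / c ^+ n * expR (c * x).
Proof.
move=> c0 x0; have cx : 0 <= c * x by rewrite mulr_ge0// ltW.
have := exp_coeff_le_expR n cx.
rewrite ler_pdivrMr ?ltr0n ?fact_gt0// exprMn => h.
rewrite mulrAC ler_pdivlMr ?exprn_gt0//.
by rewrite mulrC [leRHS]mulrC.
Qed.

(** The term of degree [i + n] is at most [|x|^n |x|^i / i!]. Giving up the factor [1 / n!] is
    harmless, since [n] stays fixed wherever the bound is used. *)
Lemma expR_remainder (x : R) n :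
  `|expR x - series (exp_coeff x) n| <= `|x| ^+ n * expR `|x|.
Proof.
have cv : series (exp_coeff x) (m + n)%N - series (exp_coeff x) n @[m --> \oo] -->
    expR x - series (exp_coeff x) n.
  apply: cvgB; last exact: cvg_cst.
  rewrite (@cvg_shiftn n _ (series (exp_coeff x))).
  exact: is_cvg_series_exp_coeff.
apply: ler_cvg_to (cvg_norm cv) (cvg_cst _) _.
apply: nearW => m.
rewrite /series/= (@big_cat_nat _ _ _ n 0 (m + n)%N)//= ?leq_addl//.
rewrite [X in `|X|]addrAC subrr add0r.
rewrite -{1}[n]add0n big_addn addnK (le_trans (ler_norm_sum _ _ _))//.
apply: (@le_trans _ _ (`|x| ^+ n * series (exp_coeff `|x|) m)); last first.
  by rewrite ler_wpM2l ?exprn_ge0// series_exp_le.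
rewrite /series/= mulr_sumr; apply: ler_sum => i _.
rewrite normrM normrX normfV normr_nat addnC exprD -mulrA ler_wpM2l ?exprn_ge0//.
rewrite ler_wpM2l ?exprn_ge0// lef_pV2 ?posrE ?ltr0n ?fact_gt0// ler_nat.
by rewrite leq_fact// leq_addl.
Qed.

End exponential_remainder.

(** * Analyticity of Gaussian integrals in the rate *)

Section gauss_laplace_identity.
Context {R : realType}.
Local Notation mu := (@lebesgue_measure R).
Variables (E : R -> R) (K l : R).
Hypothesis eE : exp_type K l E.
Implicit Types u h : R.

Let w u (x : R) : R := expR (- (u * x ^+ 2)) * E x.

(** A factor growing like [exp (u' x^2)] uses up the part [u'] of the Gaussian rate [u], and what is
    left still dominates [E]. *)
Let damped u u' (A : R) (v : R -> R) : u' < u -> measurable_fun `[(0 : R), +oo[ v ->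
  (forall x, `|v x| <= A * expR (u' * x ^+ 2)) ->
  mu.-integrable `[0, +oo[ (EFin \o (fun x => v x * w u x)) /\
  `|\int[mu]_(x in `[0, +oo[) (v x * w u x)| <=
  A * \int[mu]_(x in `[0, +oo[) `|w (u - u') x|.
Proof.
move=> uu' mv vA.
have mE := eE.1.
have iw := integrable_gauss_laplace (_ : 0 < u - u') eE.
have {}iw : mu.-integrable `[0, +oo[ (EFin \o (fun x => `|w (u - u') x|)).
  by apply: integrable_norm; apply: iw; rewrite subr_gt0.
have mw : measurable_fun `[(0 : R), +oo[ (w u).
  apply: measurable_funM => //; apply: measurableT_comp => //.
  by apply: measurable_funN; apply: measurable_funM.
have le x : `|v x * w u x| <= A * `|w (u - u') x|.
  rewrite normrM; apply: (le_trans (ler_wpM2r (normr_ge0 _) (vA x))).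
  rewrite /w !normrM !(ger0_norm (expR_ge0 _)) -mulrA.
  rewrite [expR (u' * _) * _]mulrA -expRD.
  rewrite (_ : u' * x ^+ 2 + _ = - ((u - u') * x ^+ 2))//; by ring.
have i1 : mu.-integrable `[0, +oo[ (EFin \o (fun x => v x * w u x)).
  have := @integrable_EFinZl _ _ _ mu _ _ A (_ : measurable `[(0 : R), +oo[) iw.
  move=> /(_ (measurable_itv _)).
  apply: le_integrable => //.
    by apply/measurable_EFinP; exact: measurable_funM.
  by move=> x _; rewrite lee_fin (le_trans (le x))// ler_norm.
split => //.
rewrite -RintegralZl//; apply: (le_trans (le_normr_Rintegral _ _)) => //.
apply: le_Rintegral => //; first exact: integrable_norm.
exact: integrable_EFinZl.
Qed.

(** Up to the sign [(- 1)^n], the derivative of order [n] of [gauss_laplace E] at [u]. *)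
Let moment u n : R := \int[mu]_(x in `[0, +oo[) ((x ^+ 2) ^+ n * w u x).

Let msqr (c : R) : measurable_fun `[(0 : R), +oo[ (fun x : R => c * x ^+ 2).
Proof. exact: measurable_funM. Qed.

Let mseries h n :
  measurable_fun `[(0 : R), +oo[ (fun x => series (exp_coeff (- h * x ^+ 2)) n).
Proof.
rewrite /series/=; apply: measurable_sum => i.
by apply: measurable_funM => //; apply: measurable_funX; exact: msqr.
Qed.

Let series_le h n (x : R) :
  `|series (exp_coeff (- h * x ^+ 2)) n| <= 1 * expR (`|h| * x ^+ 2).
Proof.
rewrite mul1r (le_trans (norm_series_exp_le _ _))// ler_expR.
by rewrite normrM normrN (ger0_norm (sqr_ge0 x)).
Qed.

Let moment_integrable u n : 0 < u ->
  mu.-integrable `[0, +oo[ (EFin \o (fun x => (x ^+ 2) ^+ n * w u x)).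
Proof.
move=> u0; have u2 : u / 2 < u by lra.
apply: (damped (A := n`!%:R / (u / 2) ^+ n) u2 _ _).1.
  by apply: measurable_funX; exact: exprn_measurable.
move=> x; rewrite (ger0_norm (exprn_ge0 _ (sqr_ge0 x))).
by apply: exprn_le_expR; [rewrite divr_gt0|exact: sqr_ge0].
Qed.

Let seriesS u h n (x : R) : series (exp_coeff (- h * x ^+ 2)) n.+1 * w u x =
  series (exp_coeff (- h * x ^+ 2)) n * w u x +
  (- h) ^+ n / n`!%:R * ((x ^+ 2) ^+ n * w u x).
Proof.
rewrite {1}/series/= big_nat_recr//= mulrDl; congr (_ + _).
rewrite exp_coeffE/= exprMn.
by move: ((- h) ^+ n) ((x ^+ 2) ^+ n) => A B; ring.
Qed.

Let series_moment u h n : 0 < u -> `|h| < u ->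
  (forall j, (j < n)%N -> moment u j = 0) ->
  \int[mu]_(x in `[0, +oo[) (series (exp_coeff (- h * x ^+ 2)) n * w u x) = 0.
Proof.
move=> u0 hu; elim: n => [|n IH] m0.
  under eq_Rintegral do rewrite /series/= big_geq// mul0r.
  by rewrite /Rintegral integral0.
under eq_Rintegral do rewrite seriesS.
have im := moment_integrable n u0.
rewrite RintegralD//; last 2 first.
- exact: (damped hu (mseries h n) (series_le h n)).1.
- exact: integrable_EFinZl.
rewrite IH; last by move=> j /ltnW jn; apply: m0; rewrite ltnS.
by rewrite RintegralZl// -/(moment u n) m0// mulr0 add0r.
Qed.

Let gauss_laplaceD u h : gauss_laplace E (u + h) =
  \int[mu]_(x in `[0, +oo[) (expR (- h * x ^+ 2) * w u x).
Proof.
apply: eq_Rintegral => x _; rewrite /w mulrA -expRD.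
by congr (expR _ * _); ring.
Qed.

(** The rate [u] is shared out: a quarter for [exp (|h| x^2)], a quarter for the power [x^(2 n)],
    and half is left for [E]. *)
Let remainder u h n : 0 < u -> `|h| <= u / 4 ->
  `|gauss_laplace E (u + h) -
    \int[mu]_(x in `[0, +oo[) (series (exp_coeff (- h * x ^+ 2)) n * w u x)| <=
  `|h| ^+ n * (n`!%:R / (u / 4) ^+ n * \int[mu]_(x in `[0, +oo[) `|w (u - u / 2) x|).
Proof.
move=> u0 hu; have hu' : `|h| < u by rewrite (le_lt_trans hu)//; lra.
have u2 : u / 2 < u by lra.
have mexp : measurable_fun `[(0 : R), +oo[ (fun x => expR (- h * x ^+ 2)).
  by apply: measurableT_comp => //; exact: msqr.
rewrite gauss_laplaceD -RintegralB//; last 2 first.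
- apply: (damped (A := 1) hu' mexp _).1 => x.
  rewrite mul1r ger0_norm ?expR_ge0// ler_expR ler_wpM2r ?sqr_ge0//.
  by rewrite -normrN ler_norm.
- exact: (damped hu' (mseries h n) (series_le h n)).1.
under eq_Rintegral do rewrite -mulrBl.
rewrite mulrA; apply: (damped u2 _ _).2.
  by apply: measurable_funB.
move=> x; apply: (le_trans (expR_remainder _ _)).
rewrite normrM normrN (ger0_norm (sqr_ge0 x)).
have x2 := sqr_ge0 x.
have e1 : expR (`|h| * x ^+ 2) <= expR (u / 4 * x ^+ 2).
  by rewrite ler_expR ler_wpM2r.
have e2 : (x ^+ 2) ^+ n <= n`!%:R / (u / 4) ^+ n * expR (u / 4 * x ^+ 2).
  by apply: exprn_le_expR => //; rewrite divr_gt0.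
have -> : expR (u / 2 * x ^+ 2) = expR (u / 4 * x ^+ 2) * expR (u / 4 * x ^+ 2).
  by rewrite -expRD; congr expR; field.
rewrite exprMn -!mulrA ler_wpM2l ?exprn_ge0//.
rewrite [leRHS](_ : _ = (n`!%:R / (u / 4) ^+ n * expR (u / 4 * x ^+ 2)) *
  expR (u / 4 * x ^+ 2)); last by rewrite !mulrA.
by apply: ler_pM => //; exact: exprn_ge0.
Qed.

(* [gauss_laplace E] is the sum of its Taylor series at [u] in a disk of radius [u],
   hence the steps of proportion less than 1 in the continuation below. *)
Let moments_eq0 u : 0 < u ->
  (forall e, 0 < e -> exists h, [/\ h != 0, `|h| < e & gauss_laplace E (u + h) = 0]) ->
  forall n, moment u n = 0.
Proof.
move=> u0 zero n; elim/ltn_ind: n => n IH.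
pose C := (n.+1)`!%:R / (u / 4) ^+ n.+1 * \int[mu]_(x in `[0, +oo[) `|w (u - u / 2) x|.
suff : `|moment u n / n`!%:R| <= 0.
  by rewrite normr_le0 mulf_eq0 invr_eq0 pnatr_eq0 gtn_eqF ?fact_gt0// orbF => /eqP.
rewrite leNgt; apply/negP => m0.
have C0 : 0 <= C.
  rewrite mulr_ge0 ?Rintegral_ge0// divr_ge0// exprn_ge0// divr_ge0// ltW//.
(* Once the lower moments vanish, a zero at [u + h] gives [|moment u n / n!| <= C |h|], which a zero
   close enough to [u] contradicts. [C + 1] avoids dividing by zero. *)
have e0 : 0 < Num.min (u / 4) (`|moment u n / n`!%:R| / (C + 1)).
  by rewrite lt_min !divr_gt0//=; rewrite ltr_wpDl.
have [h [h0 + Zh]] := zero _ e0.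
rewrite lt_min => /andP[h1 h2].
have hu : `|h| < u by lra.
have := remainder n.+1 u0 (ltW h1).
under eq_Rintegral do rewrite seriesS.
have im := moment_integrable n u0.
rewrite RintegralD//; last 2 first.
- exact: (damped hu (mseries h n) (series_le h n)).1.
- exact: integrable_EFinZl.
rewrite series_moment// RintegralZl// -/(moment u n) Zh !add0r normrN.
rewrite -/C -mulrA normrM normrX normrN exprSr -mulrA ler_pM2l ?exprn_gt0 ?normr_gt0//.
rewrite [X in `|X|]mulrC; move: h2; rewrite ltr_pdivlMr ?ltr_wpDl// => h2.
rewrite leNgt (le_lt_trans _ h2)// ler_wpM2l//; lra.
Qed.

(** The Taylor polynomials, dominated by [exp (|h| x^2)], converge under the integral for every
    [|h| < u], and all of them integrate to [0]. *)
Let zero_disk u : 0 < u ->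
  (forall e, 0 < e -> exists h, [/\ h != 0, `|h| < e & gauss_laplace E (u + h) = 0]) ->
  forall h, `|h| < u -> gauss_laplace E (u + h) = 0.
Proof.
move=> u0 zero h hu; have m0 := moments_eq0 u0 zero.
rewrite gauss_laplaceD.
have [||||_] := @dominated_cvg_Rintegral _ _ _ mu `[0, +oo[
  (fun n x => series (exp_coeff (- h * x ^+ 2)) n * w u x)
  (fun x => expR (- h * x ^+ 2) * w u x)
  (fun x => 1 * `|w (u - `|h|) x|) (measurable_itv _).
- move=> n; apply/measurable_EFinP; apply: (measurable_int mu).
  exact: (damped hu (mseries h n) (series_le h n)).1.
- by move=> x _; apply: cvgMl; exact: is_cvg_series_exp_coeff.
- apply: integrable_EFinZl => //; apply: integrable_norm.
  by apply: integrable_gauss_laplace eE; rewrite subr_gt0.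
- move=> n x _; rewrite normrM.
  apply: (le_trans (ler_wpM2r (normr_ge0 _) (series_le h n x))).
  rewrite !mul1r /w !normrM !(ger0_norm (expR_ge0 _)) mulrA -expRD.
  rewrite (_ : `|h| * x ^+ 2 + _ = - ((u - `|h|) * x ^+ 2))//; by ring.
under eq_fun do rewrite series_moment//.
by move=> cv; rewrite (cvg_unique _ cv (cvg_cst 0)).
Qed.

Lemma gauss_laplace_identity u : 0 < u ->
  (forall e, 0 < e -> exists h, [/\ h != 0, `|h| < e & gauss_laplace E (u + h) = 0]) ->
  forall v, 0 < v -> gauss_laplace E v = 0.
Proof.
move=> u0 zero.
(* Each step gains [u / 2]. From zeros on []0, a[] with [u <= a], the disk around [3 a / 4] reaches
   [3 a / 2 >= a + u / 2], and its centre is a limit of known zeros because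
   [3 a / 4 + a / 8 < a]. *)
have step n v : 0 < v < u + n%:R * (u / 2) -> gauss_laplace E v = 0.
  elim: n v => [|n IH] v /andP[v0].
    rewrite mul0r addr0 => vu; rewrite (_ : v = u + (v - u)); last by ring.
    by apply: zero_disk => //; rewrite ltr_norml; apply/andP; split; lra.
  set a := u + n%:R * (u / 2) in IH.
  have au : u <= a by rewrite lerDl mulr_ge0// divr_ge0// ltW.
  rewrite -natr1 mulrDl mul1r addrA -/a => va.
  rewrite (_ : v = 3 / 4 * a + (v - 3 / 4 * a)); last by ring.
  apply: zero_disk; first by lra.
  - move=> e e0; exists (Num.min (e / 2) (a / 8)); split.
    + by rewrite gt_eqF// lt_min !divr_gt0//=; lra.
    + rewrite ger0_norm; first by rewrite gt_min; apply/orP; left; lra.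
      by rewrite le_min !divr_ge0//; lra.
    + apply: IH; apply/andP; split.
        by rewrite ltr_wpDr//; [rewrite le_min !divr_ge0//; lra|lra].
      have : Num.min (e / 2) (a / 8) <= a / 8 by rewrite ge_min lexx orbT.
      lra.
  - by rewrite ltr_norml; apply/andP; split; lra.
move=> v v0; apply: (step (Num.truncn (v / (u / 2))).+1).
rewrite v0/=.
have : v / (u / 2) < (Num.truncn (v / (u / 2))).+1%:R by rewrite truncnS_gt.
by rewrite ltr_pdivrMr ?divr_gt0//; lra.
Qed.

(** The case [n = 1] of [remainder] is a Lipschitz bound at [u]. *)
Lemma continuous_gauss_laplace u : 0 < u -> {for u, continuous (gauss_laplace E)}.
Proof.
move=> u0; apply/cvgrPdist_le => e e0.
pose B := 1%N`!%:R / (u / 4) ^+ 1 * \int[mu]_(x in `[0, +oo[) `|w (u - u / 2) x|.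
have B0 : 0 <= B by rewrite mulr_ge0 ?Rintegral_ge0// divr_ge0// exprn_ge0// divr_ge0// ltW.
near=> v.
have hu : `|v - u| <= u / 4.
  by rewrite distrC; near: v; apply: cvgr_dist_le => //; rewrite divr_gt0.
have he : `|v - u| <= e / (B + 1).
  by rewrite distrC; near: v; apply: cvgr_dist_le => //; rewrite divr_gt0// ltr_wpDl.
have := remainder 1 u0 hu.
rewrite subrKC (_ : Rintegral _ _ _ = gauss_laplace E u); last first.
  apply: eq_Rintegral => x _; rewrite /series/= big_nat1.
  by rewrite exp_coeffE/= expr0 ?fact0 ?invr1 !mul1r.
rewrite distrC -/B expr1 => /le_trans; apply.
apply: (@le_trans _ _ (`|v - u| * (B + 1))); first by rewrite ler_wpM2l// lerDl.
by rewrite -ler_pdivlMr// ltr_wpDl.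
Unshelve. all: end_near. Qed.

End gauss_laplace_identity.

Lemma within_comp_continuous (X Y Z : topologicalType) (A : set X) (B : set Y)
    (f : X -> Y) (g : Y -> Z) :
  (forall x, A x -> B (f x)) -> continuous f -> {within B, continuous g} ->
  {within A, continuous (fun x => g (f x))}.
Proof.
move=> AB cf /subspace_continuousP cg; apply/subspace_continuousP => x Ax.
apply: (@cvg_comp _ _ _ f g _ (within B (nbhs (f x)))); last exact/cg/AB.
move=> U; rewrite /within/= nbhs_simpl/= => /cf; rewrite nbhs_simpl/=.
by apply: filterS => y h Ay; exact/h/AB.
Qed.

(** * Hyperbolic moments and the Robin end *)

Section robin.
Context {R : realType}.
Local Notation mu := (@lebesgue_measure R).
Implicit Types (d : R -> R) (k c al : R).

Definition cosh (x : R) : R := (expR x + expR (- x)) / 2.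
Definition sinh (x : R) : R := (expR x - expR (- x)) / 2.

Definition cosh_moment d k : R := \int[mu]_(x in `[0, 1]) (d x * cosh (k * x)).

(** The boundary operator [v_x + al v] at [x = 1], applied to [cosh (k x)]. *)
Definition robin_symbol al k : R := k * sinh k + al * cosh k.

Lemma robin_symbol_gt0 al k : 0 < al -> 0 <= k -> 0 < robin_symbol al k.
Proof.
move=> al0 k0; apply: ltr_wpDl; last first.
  by rewrite mulr_gt0// divr_gt0// addr_gt0 ?expR_gt0.
by rewrite mulr_ge0// divr_ge0// subr_ge0 ler_expR; lra.
Qed.

Lemma cosh_ge1 (x : R) : 1 <= cosh x.
Proof.
have := expR_gt0 x => e0.
rewrite /cosh expRN ler_pdivlMr// mul1r -subr_ge0.
have -> : expR x + (expR x)^-1 - 2 = (expR x - 1) ^+ 2 / expR x.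
  by field; rewrite gt_eqF.
by rewrite divr_ge0 ?sqr_ge0// ltW.
Qed.

Lemma cosh_le (x y : R) : `|x| <= y -> cosh x <= cosh y.
Proof.
move=> xy; have y0 : 0 <= y by rewrite (le_trans _ xy).
have e0 := expR_gt0 x; have f0 := expR_gt0 y.
rewrite /cosh ler_pM2r ?invr_gt0// !expRN -subr_ge0.
have -> : expR y + (expR y)^-1 - (expR x + (expR x)^-1) =
    (expR y - expR x) * (expR (x + y) - 1) / (expR x * expR y).
  by rewrite expRD; field; rewrite !gt_eqF.
move: xy; rewrite ler_norml => /andP[h1 h2].
rewrite divr_ge0 ?mulr_ge0 ?(ltW e0) ?(ltW f0)// subr_ge0 ?ler_expR//.
by rewrite -expR0 ler_expR; lra.
Qed.

Lemma within_continuousM (X : topologicalType) (A : set X) (f g : X -> R) :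
  {within A, continuous f} -> {within A, continuous g} ->
  {within A, continuous (fun x => f x * g x)}.
Proof. by move=> cf cg x; apply: cvgM; [exact: cf|exact: cg]. Qed.

Lemma within_continuousMr (A : set R) (f : R -> R) c :
  {within A, continuous f} -> {within A, continuous (fun x => f x * c)}.
Proof. by move=> cf x; apply: cvgMl; exact: cf. Qed.

Lemma continuous_integrable (a b : R) (f : R -> R) :
  {within `[a, b], continuous f} -> mu.-integrable `[a, b] (EFin \o f).
Proof.
by move=> cf; apply: continuous_compact_integrable => //; exact: segment_compact.
Qed.

Lemma within_expRM (A : set R) c : {within A, continuous (fun x : R => expR (c * x))}.
Proof. exact/continuous_subspaceT/continuous_expRM. Qed.

Lemma integrable_expR_mul d c : {within `[0, 1], continuous d} ->
  mu.-integrable `[0, 1] (EFin \o (fun x => expR (c * x) * d x)).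
Proof.
move=> cd; apply: continuous_integrable; apply: within_continuousM => //.
exact: within_expRM.
Qed.

Lemma cosh_momentE d k : {within `[0, 1], continuous d} ->
  2 * cosh_moment d k = \int[mu]_(x in `[0, 1]) (expR (k * x) * d x) +
    \int[mu]_(x in `[0, 1]) (expR (- k * x) * d x).
Proof.
move=> cd; rewrite -RintegralD//; [|exact: integrable_expR_mul..].
rewrite /cosh_moment -RintegralZl//.
  by apply: eq_Rintegral => x _; rewrite /cosh mulNr; field.
have := integrable_EFinZl 2^-1 _
  (integrableD _ (integrable_expR_mul k cd) (integrable_expR_mul (- k) cd)).
move=> /(_ (measurable_itv _) (measurable_itv _)).
by apply: eq_integrable => // x _; rewrite /= /cosh mulNr; congr EFin; field.
Qed.

Lemma continuous_segment_bounded d : {within `[0, 1], continuous d} ->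
  exists2 K, 0 < K & forall x, 0 <= x <= 1 -> `|d x| <= K.
Proof.
move=> cd.
have := compact_bounded (continuous_compact cd (@segment_compact R 0 1)).
move=> [M [_ /(_ (`|M| + 1))]] h.
exists (`|M| + 1) => [|x x01]; first by rewrite ltr_wpDl.
by apply: h; [rewrite ltr_pwDr// ler_norm|exists x => //=; rewrite in_itv].
Qed.

(* [2 exp (- k) cosh (k x) = exp (- k (1 - x)) + exp (- k (1 + x))] turns moments over
   [0, 1] into Laplace transforms over [0, 2]. *)
Definition folded d (x : R) : R := if x <= 2 then d `|1 - x| else 0.

Lemma exp_type_folded d K : {within `[0, 1], continuous d} ->
  (forall x, 0 <= x <= 1 -> `|d x| <= K) -> exp_type K 3 (folded d).
Proof.
move=> cd dK.
have K0 : 0 <= K by apply: le_trans (dK 0 _) => //; rewrite lexx ler01.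
have n01 (x : R) : 0 <= x -> x <= 2 -> 0 <= `|1 - x| <= 1.
  by move=> x0 x2; rewrite normr_ge0/= ler_norml; apply/andP; split; lra.
split.
  apply: (@eq_measurable_fun _ _ _ _ _ ((fun x => d `|1 - x|) \_ `[0, 2])).
    move=> x; rewrite inE/= in_itv/= andbT => x0.
    by rewrite patchE mem_setE in_itv/= x0 /folded; case: ifP.
  apply/measurable_restrict => //.
  apply: (@measurable_comp _ _ _ _ _ _ `[(0 : R), 1]) => //.
  - move=> _ [x [_ x02] <-] /=; move: x02; rewrite /= !in_itv/= => /andP[x0 x2].
    exact: n01.
  - exact: subspace_continuous_measurable_fun.
  - by apply: measurableT_comp => //; exact: measurable_funB.
move=> x x0; apply: (@le_trans _ _ K).
  by rewrite /folded; case: ifPn => x2; [exact/dK/n01|rewrite normr0].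
by rewrite ler_peMr// -expR0 ler_expR mulr_ge0.
Qed.

Lemma laplace_folded d k : {within `[0, 1], continuous d} -> 3 < k ->
  laplace (folded d) k = 2 * expR (- k) * cosh_moment d k.
Proof.
move=> cd k3; have [K K0 dK] := continuous_segment_bounded cd.
have em := exp_type_folded cd dK.
have im := exp_type_integrable em k3.
pose g (x : R) : R := expR (- k * x) * d `|1 - x|.
have gE : {in `[0, 2]%classic : set R, forall x, expR (- k * x) * folded d x = g x}.
  by move=> x; rewrite inE/= in_itv/= => /andP[_ x2]; rewrite /folded x2.
have s02 : `[(0 : R), 2] `<=` `[0, +oo[ by exact: subset_itvl.
have ig : mu.-integrable `[0, 2] (EFin \o g).
  have := @integrableS _ _ _ mu _ _ _ (measurable_itv _) (measurable_itv _) s02 im.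
  by apply: eq_integrable => // x /gE /= ->.
have -> : laplace (folded d) k = \int[mu]_(x in `[0, 2]) g x.
  rewrite /laplace Rintegral_mkcond [RHS]Rintegral_mkcond.
  apply: eq_Rintegral => x _; rewrite !patchE !mem_setE !in_itv/= !andbT.
  rewrite /folded; case: (leP 0 x) => //= x0; case: ifP => //.
  by rewrite mulr0.
have b1 : (BLeft (0 : R) <= BRight 1)%O by rewrite bnd_simp.
have b2 : (BRight (1 : R) <= BRight 2)%O by rewrite bnd_simp; lra.
have := Rintegral_itvB ig b1 b2.
move=> /eqP; rewrite subr_eq => /eqP ->.
rewrite mulrAC (cosh_momentE _ cd) mulrDl addrC; congr (_ + _).
  rewrite -RintegralZr//; last exact: integrable_expR_mul.
  rewrite [RHS]Rintegration_by_substitution_onem//; last 2 first.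
  - by rewrite lexx ler01.
  - apply: within_continuousMr.
    by apply: within_continuousM => //; exact: within_expRM.
  rewrite /unstable.onem subrr; apply: eq_Rintegral => x; rewrite inE/= in_itv/= => /andP[x0 x1].
  rewrite /g ger0_norm ?subr_ge0// [RHS]mulrAC -expRD.
  by congr (expR _ * _); ring.
rewrite -RintegralZr//; last exact: integrable_expR_mul.
have s12 : `](1 : R), 2] `<=` `[0, 2] by apply: subset_itvr; rewrite bnd_simp.
rewrite Rintegral_itv_obnd_cbnd; last first.
  exact: (@integrableS _ _ _ mu _ _ _ _ _ s12).
have s12' : `[(1 : R), 2] `<=` `[0, 2] by apply: subset_itvr; rewrite bnd_simp.
have ig' := @integrableS _ _ _ mu _ _ _ (measurable_itv _) (measurable_itv _) s12' ig.
rewrite /Rintegral; congr fine.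
rewrite -(@integral_translate R 1 `[1, 2] (EFin \o g))//; last first.
  exact: measurable_int ig'.
rewrite (_ : [set x : R | `[1, 2]%classic (x + 1)] = `[0, 1]%classic); last first.
  apply/seteqP; split => x /=; rewrite !in_itv/= => /andP[h1 h2];
    by apply/andP; split; lra.
apply: eq_integral => x; rewrite inE/= in_itv/= => /andP[x0 x1].
rewrite /g /= (_ : 1 - (x + 1) = - x); last by ring.
rewrite normrN ger0_norm// mulrAC -expRD.
by congr ((expR _ * _)%:E); ring.
Qed.

(** With [L] the transform of the reflection sum [M] started from [folded d], the recursion solves
    to [L / (k + al) = cosh_moment d k / D(k)]. Subtracting [al] times the exponential convolution
    of [M] turns [L] into [k L / (k + al)], whose factor [k] the division by [k] removes; the
    constant [- c] adds [- c / k^2]. *)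
Lemma robin_transform al c d : 0 < al -> {within `[0, 1], continuous d} ->
  exists E K, exp_type K 3 E /\ forall k, 3 < k ->
    robin_symbol al k * (laplace E k / k) =
    cosh_moment d k - c / k ^+ 2 * robin_symbol al k.
Proof.
move=> al0 cd; have [K K0 dK] := continuous_segment_bounded cd.
have em := exp_type_folded cd dK.
have [M eM LM] := reflection_exists al0 em.
have eW := exp_type_expconv al0 (ler0n _ 3) eM.
have eM1 := exp_type_add eM (exp_type_scale (- al) eW).
have ec := @exp_type_cst R `|- c| (- c) 3 (ler0n _ 3) (lexx _).
have eE := exp_type_add eM1 ec.
exists (fun x => M x + - al * expconv al M x + - c); eexists; split.
  exact: eE.
move=> k k3; have k0 : 0 < k by lra.
rewrite (laplace_add eM1 ec)// (laplace_add eM (exp_type_scale _ eW))//.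
rewrite (laplace_scale _ eW)// laplace_cst// (expconv_laplace (ltW al0) eM k3 k0).2.
have := LM k k3; rewrite laplace_folded//.
have -> : expR (- k * 2) = expR (- k) * expR (- k) by rewrite -expRD; congr expR; ring.
set L := laplace M k; set H := cosh_moment d k; rewrite /robin_symbol /sinh /cosh.
have := expRxMexpNx_1 k; set e := expR k; set e' := expR (- k) => ee' LE.
have kal : k + al != 0 by rewrite gt_eqF// addr_gt0.
have e0 : e != 0 by rewrite gt_eqF// expR_gt0.
have e'E : e' = e^-1 by rewrite -[RHS]mulr1 -ee' mulKf.
(* Multiplied by [(k + al) exp k], with [exp (- k)] replaced by the inverse of [exp k], the
   recursion becomes an identity of rational functions. *)
have HE : H = (k * ((e - e') / 2) + al * ((e + e') / 2)) * (L / (k + al)).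
  have : (k + al) * e * L = (k + al) * e * (2 * e' * H + e' * e' * (1 - 2 * al / (k + al)) * L).
    by rewrite -LE.
  rewrite e'E => h.
  have -> : H = (k + al)^-1 / 2 * ((k + al) * e * (2 * e^-1 * H + e^-1 * e^-1 * (1 - 2 * al / (k + al)) * L) -
     (k - al) / e * L) by field; rewrite kal e0.
  by rewrite -h; field; rewrite kal e0.
rewrite HE; field; rewrite kal gt_eqF//.
Qed.

End robin.

(** * Rigidity of the terminal datum *)

Section cauchy_data.
Context {R : realType}.
Local Notation mu := (@lebesgue_measure R).
Implicit Types (d : R -> R) (k c al : R).

Lemma continuous_cosh k : continuous (fun x : R => cosh (k * x)).
Proof.
have -> : (fun x => cosh (k * x)) =
    (fun x => (expR (k * x) + expR (- k * x)) / 2).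
  by apply/funext => x; rewrite /cosh mulNr.
by move=> x; apply: cvgMl; apply: cvgD; exact: continuous_expRM.
Qed.

Lemma integrable_cosh_mul d k : {within `[0, 1], continuous d} ->
  mu.-integrable `[0, 1] (EFin \o (fun x => d x * cosh (k * x))).
Proof.
move=> cd; apply: continuous_integrable; apply: within_continuousM => //.
exact/continuous_subspaceT/continuous_cosh.
Qed.

Lemma norm_Rintegral01_le (f : R -> R) K :
  mu.-integrable `[0, 1] (EFin \o f) -> (forall x, 0 <= x <= 1 -> `|f x| <= K) ->
  `|\int[mu]_(x in `[0, 1]) f x| <= K.
Proof.
move=> intf fK; apply: (le_trans (le_normr_Rintegral _ _)) => //.
have -> : K = \int[mu]_(x in `[0, 1]) K.
  by rewrite Rintegral_cst//= lebesgue_measure_itv/= lte_fin ltr01 oppr0 adde0 mulr1.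
apply: le_Rintegral => //; first exact: integrable_norm.
  by apply: continuous_integrable; apply: continuous_subspaceT => x; exact: cvg_cst.
Qed.

(* The affine function with Cauchy data [w(1) = c], [w'(1) = - al c]. *)
Let w al c (x : R) : R := c * (1 + al - al * x).

Let continuous_w al c : continuous (w al c).
Proof.
move=> x; apply: cvgMr; apply: cvgB; first exact: cvg_cst.
by apply: cvgMr; exact: cvg_id.
Qed.

(** Two integrations by parts, with [w'' = 0]: the end [x = 1] gives the term in the symbol, and the
    slope at [x = 0] leaves [w'(0) / k^2 = - al c / k^2]. *)
Let cosh_moment_affine al c k : 0 < k ->
  cosh_moment (w al c) k = c / k ^+ 2 * robin_symbol al k - al * c / k ^+ 2.
Proof.
move=> k0; have k0' : k != 0 by rewrite gt_eqF.
pose A (x : R) : R := c / (2 * k) * (1 + al - al * x) * (expR (k * x) - expR (- k * x)) +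
  al * c / (2 * k ^+ 2) * (expR (k * x) + expR (- k * x)).
have dA (x : R) : is_derive x 1 A (w al c x * cosh (k * x)).
  apply: is_derive_eq; rewrite /GRing.scale/= /w /cosh -[- (k * x)]mulNr.
  by field.
have cA (x : R) : {for x, continuous A}.
  by apply/differentiable_continuous/derivable1_diffP; have [] := dA x.
rewrite /cosh_moment /Rintegral (@continuous_FTC2 _ _ A)//.
- rewrite -EFinB/= /A /robin_symbol /sinh /cosh !mulr0 !mulr1 expR0.
  by field.
- apply: continuous_subspaceT => x.
  by apply: cvgM; [exact: continuous_w|exact: continuous_cosh].
- split; first by move=> x _; have [] := dA x.
  + by apply: cvg_at_right_filter; exact: cA.
  + by apply: cvg_at_left_filter; exact: cA.
- by move=> x _; rewrite derive1E; have [_ ->] := dA x.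
Qed.

Lemma cauchy_data_eq0 al c d : 0 < al -> {within `[0, 1], continuous d} ->
  (forall k, 3 < k -> cosh_moment d k = c / k ^+ 2 * robin_symbol al k) -> c = 0.
Proof.
move=> al0 cd Hd.
pose r x := d x - w al c x.
have cr : {within `[0, 1], continuous r}.
  move=> x; apply: cvgB; first exact: cd.
  exact: (continuous_subspaceT (@continuous_w al c)).
have Hr k : 3 < k -> cosh_moment r k = al * c / k ^+ 2.
  move=> k3; have k0 : 0 < k by lra.
  have -> : cosh_moment r k = cosh_moment d k - cosh_moment (w al c) k.
    rewrite /cosh_moment -RintegralB//.
    - by apply: eq_Rintegral => x _; rewrite mulrBl.
    - exact: integrable_cosh_mul.
    - apply: integrable_cosh_mul.
      exact/continuous_subspaceT/continuous_w.
  by rewrite Hd// cosh_moment_affine//; ring.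
have [K K0 rK] := continuous_segment_bounded cr.
have cr1 : {within `[0, 1], continuous (fun x => r (1 - x))}.
  apply: (@within_comp_continuous _ _ _ _ `[(0 : R), 1] (fun x : R => 1 - x)) => //.
    by move=> x /=; rewrite !in_itv/= => /andP[h1 h2]; apply/andP; split; lra.
  by move=> x; apply: cvgB; [exact: cvg_cst|exact: cvg_id].
have ir1 := continuous_integrable cr1.
have s01 : `](0 : R), 1] `<=` `[0, 1] by apply: subset_itvr; rewrite bnd_simp.
have ir1' := @integrableS _ _ _ mu _ _ _ (measurable_itv _) (measurable_itv _) s01 ir1.
(* Twice the [cosh] moment is the sum of the integrals against [exp (k x)] and [exp (- k x)]. The
   moment is [al c / k^2] and the second integral is at most [K], so the first stays bounded; under
   [x] to [1 - x] it becomes [exp k] times a Laplace transform, which is thus of order [exp (- k)],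
   small enough to invert up to length 1. *)
have bound k : 4 <= k ->
    `|\int[mu]_(x in `]0, 1]) (expR (- k * x) * r (1 - x))| <=
    (2 * `|al * c| + K) * expR (- k * 1).
  move=> k4; have k3 : 3 < k by lra.
  have ie : mu.-integrable `[0, 1] (EFin \o (fun x => expR (- k * x) * r (1 - x))).
    by apply: continuous_integrable; apply: within_continuousM => //; exact: within_expRM.
  rewrite Rintegral_itv_obnd_cbnd; last first.
    exact: (@integrableS _ _ _ mu _ _ _ _ _ s01).
  have -> : \int[mu]_(x in `[0, 1]) (expR (- k * x) * r (1 - x)) =
      \int[mu]_(x in `[0, 1]) (expR (k * x) * r x) * expR (- k).
    rewrite -RintegralZr//; last exact: integrable_expR_mul.
    rewrite [RHS]Rintegration_by_substitution_onem//; last 2 first.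
    - by rewrite lexx ler01.
    - apply: within_continuousMr.
      by apply: within_continuousM => //; exact: within_expRM.
    rewrite /unstable.onem subrr; apply: eq_Rintegral => x _.
    rewrite [RHS]mulrAC -expRD.
    by congr (expR _ * _); ring.
  rewrite normrM (ger0_norm (expR_ge0 _)) mulr1 ler_wpM2r ?expR_ge0//.
  have := cosh_momentE k cr; rewrite Hr// => /eqP; rewrite -subr_eq => /eqP <-.
  rewrite (le_trans (ler_normB _ _))// lerD//.
    rewrite normrM (ger0_norm (ler0n _ 2)) ler_wpM2l// normrM ler_piMr//.
    by rewrite normfV invf_le1 ger0_norm ?sqr_ge0// ?exprn_gt0 ?exprn_ege1//; lra.
  apply: norm_Rintegral01_le; first exact: integrable_expR_mul.
  move=> x x01; rewrite normrM (ger0_norm (expR_ge0 _)) (le_trans _ (rK x x01))//.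
  rewrite ler_piMl// -expR0 ler_expR mulNr oppr_le0 mulr_ge0//; last by case/andP: x01.
  by lra.
have r0 (x : R) : 0 < x < 1 -> r x = 0.
  move=> /andP[x0 x1].
  have [cr1' _ _] := (continuous_within_itvP _ (@ltr01 R)).1 cr1.
  have := @phragmen_eq0 R 1 1 _ 4 (fun x => r (1 - x)) (lexx _) ir1' bound (1 - x) cr1'.
  by rewrite subKr; apply; lra.
(* Any [k > 3] would do: one vanishing moment already gives [al c = 0]. *)
have : cosh_moment r 4 = 0.
  have i4 := integrable_cosh_mul 4 cr.
  rewrite /cosh_moment -Rintegral_itv_obnd_cbnd; last first.
    exact: (@integrableS _ _ _ mu _ _ _ _ _ s01).
  rewrite -Rintegral_itv_bndo_bndc; last first.
    apply: (@integrableS _ _ _ mu `[0, 1]) => //.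
    by move=> x /=; rewrite !in_itv/= => /andP[/ltW-> /ltW->].
  rewrite (_ : Rintegral _ _ _ = \int[mu]_(x in `]0, 1[) 0).
    by rewrite /Rintegral integral0.
  by apply: eq_Rintegral => x; rewrite inE/= in_itv/= => /r0 ->; rewrite mul0r.
rewrite Hr; last by lra.
move=> /eqP; rewrite mulf_eq0 invr_eq0 expf_eq0/= pnatr_eq0/= orbF.
by rewrite mulf_eq0 gt_eqF//= => /eqP.
Qed.

End cauchy_data.

(** * Cutoffs and integration by parts in the cylinder *)

Section cutoff.
Context {R : realType}.
Local Notation mu := (@lebesgue_measure R).

(** Test functions are asked to be [C1] only, so the square of the positive part is smooth enough to
    build cutoffs. *)
Definition pos_sqr (z : R) : R := Num.max z 0 ^+ 2.

Lemma is_derive_pos_sqr (z : R) : is_derive z 1 pos_sqr (2 * Num.max z 0).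
Proof.
have [z0|z0|->] := ltgtP z 0.
- apply: (@near_eq_is_derive _ _ _ (fun=> 0 : R)).
    near=> y; rewrite /pos_sqr max_r ?expr0n//; apply: ltW.
    by near: y; exact: lt_nbhsl.
  by rewrite mulr0; exact: is_derive_cst.
- apply: (@near_eq_is_derive _ _ _ (fun y : R => y ^+ 2)).
    near=> y; rewrite /pos_sqr max_l//; apply: ltW.
    by near: y; exact: lt_nbhsr.
  by apply: is_derive_eq; rewrite /GRing.scale/=; ring.
- rewrite mulr0.
  have c : (fun h : R => h^-1 *: ((pos_sqr \o shift 0) (h *: 1) - pos_sqr 0))
      @ 0^' --> (0 : R).
    apply/cvgr0Pnorm_le => e e0; near=> h.
    rewrite /= scaler1 /= addr0 [pos_sqr 0]/pos_sqr maxxx expr0n/= subr0.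
    have hne : h != 0 by near: h; exact: nbhs_dnbhs_neq.
    rewrite /GRing.scale/= normrM normfV ler_pdivrMl ?normr_gt0//.
    have he : `|h| <= e by near: h; exact: dnbhs0_le.
    rewrite /pos_sqr normrX expr2 ler_pM//.
      by case: (leP h 0) => // h0; rewrite normr0.
    by case: (leP h 0) => // h0; rewrite normr0 ltW.
  apply: DeriveDef; first by apply/cvg_ex; exists 0.
  exact: cvg_lim c.
Unshelve. all: end_near. Qed.

Lemma pos_sqr_ge0 (z : R) : 0 <= pos_sqr z. Proof. exact: sqr_ge0. Qed.

Lemma pos_sqr_le0 (z : R) : z <= 0 -> pos_sqr z = 0.
Proof. by move=> z0; rewrite /pos_sqr max_r// expr0n. Qed.

Lemma pos_sqr_gt0 (z : R) : 0 < z -> 0 < pos_sqr z.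
Proof. by move=> z0; rewrite /pos_sqr max_l ?exprn_gt0// ltW. Qed.

(** A [C1] step from 0 to 1 across [[0, 1]]; the two squares in the denominator never vanish
    together. *)
Definition ramp (z : R) : R := pos_sqr z / (pos_sqr z + pos_sqr (1 - z)).

Definition dramp (z : R) : R :=
  (2 * Num.max z 0 * pos_sqr (1 - z) + pos_sqr z * (2 * Num.max (1 - z) 0)) /
  (pos_sqr z + pos_sqr (1 - z)) ^+ 2.

Let den_gt0 (z : R) : 0 < pos_sqr z + pos_sqr (1 - z).
Proof.
have [z0|z0] := leP z 0.
  by rewrite ltr_wpDl ?pos_sqr_ge0// pos_sqr_gt0//; lra.
by rewrite ltr_pwDl ?pos_sqr_ge0// pos_sqr_gt0.
Qed.

Lemma ramp_ge0 z : 0 <= ramp z.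
Proof. by rewrite divr_ge0 ?pos_sqr_ge0// ltW. Qed.

Lemma ramp_le1 z : ramp z <= 1.
Proof. by rewrite ler_pdivrMr// mul1r lerDl pos_sqr_ge0. Qed.

Lemma ramp0 z : z <= 0 -> ramp z = 0.
Proof. by move=> z0; rewrite /ramp pos_sqr_le0// mul0r. Qed.

Lemma ramp1 z : 1 <= z -> ramp z = 1.
Proof.
move=> z1; rewrite /ramp [pos_sqr (1 - z)]pos_sqr_le0 ?addr0 ?divff//; last by lra.
by rewrite gt_eqF// pos_sqr_gt0//; lra.
Qed.

Lemma dramp_ge0 z : 0 <= dramp z.
Proof.
have m0 (y : R) : 0 <= Num.max y 0 by rewrite le_max lexx orbT.
have p0 := pos_sqr_ge0.
by rewrite divr_ge0 ?sqr_ge0// addr_ge0//; apply: mulr_ge0 => //; exact: mulr_ge0.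
Qed.

Lemma dramp1 z : 1 <= z -> dramp z = 0.
Proof.
move=> z1; have z1' : 1 - z <= 0 by lra.
by rewrite /dramp (pos_sqr_le0 z1') (max_r z1') !mulr0 addr0 mul0r.
Qed.

Lemma is_derive_ramp (z : R) : is_derive z 1 ramp (dramp z).
Proof.
have d1 := is_derive_pos_sqr z.
have d2 : is_derive z 1 (fun y => pos_sqr (1 - y)) (- (2 * Num.max (1 - z) 0)).
  have e : is_derive z 1 (fun y : R => 1 - y) (-1).
    by apply: is_derive_eq; rewrite add0r mul1r.
  by have := @is_derive1_comp R pos_sqr (fun y => 1 - y) z _ _ (is_derive_pos_sqr (1 - z)) e; rewrite mulrN1.
have dn : is_derive z 1 (fun y => pos_sqr y + pos_sqr (1 - y))
  (2 * Num.max z 0 - 2 * Num.max (1 - z) 0) by exact: is_deriveD.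
have n0 : pos_sqr z + pos_sqr (1 - z) != 0 by rewrite gt_eqF.
have dV := @is_deriveV _ _ z _ 1 n0 dn.
apply: (is_derive_eq (is_deriveM d1 dV)); rewrite /GRing.scale/= /dramp.
by field.
Qed.

Lemma continuous_max0 : continuous (fun z : R => Num.max z 0).
Proof.
move=> z; apply: (@continuous_max _ _ id (fun=> 0 : R^o)); first exact: cvg_id.
exact: cvg_cst.
Qed.

Lemma continuous_pos_sqr : continuous pos_sqr.
Proof.
by move=> z; apply/differentiable_continuous/derivable1_diffP; have [] := is_derive_pos_sqr z.
Qed.

Lemma continuous_dramp : continuous dramp.
Proof.
have c1 : continuous (fun z : R => 1 - z).
  by move=> z; apply: cvgB; [exact: cvg_cst|exact: cvg_id].
have c2 : continuous (fun z : R => pos_sqr (1 - z)).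
  move=> z; apply: (@continuous_comp _ _ _ (fun z : R => 1 - z) pos_sqr).
    exact: c1.
  exact: continuous_pos_sqr.
have c3 : continuous (fun z : R => Num.max (1 - z) 0).
  move=> z; apply: (@continuous_comp _ _ _ (fun z : R => 1 - z) (fun z => Num.max z 0)).
    exact: c1.
  exact: continuous_max0.
move=> z; apply: cvgM.
  apply: cvgD; apply: cvgM.
  - by apply: cvgMr; exact: continuous_max0.
  - exact: c2.
  - exact: continuous_pos_sqr.
  - by apply: cvgMr; exact: c3.
apply: cvgV; first by rewrite gt_eqF// exprn_gt0.
apply: (@continuous_comp _ _ _ (fun z : R => pos_sqr z + pos_sqr (1 - z))
  (fun x => x ^+ 2)); last exact: exprn_continuous.
by apply: cvgD; [exact: continuous_pos_sqr|exact: c2].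
Qed.

End cutoff.

(** * Windows and their boundary layers *)

Section window.
Context {R : realType}.
Local Notation mu := (@lebesgue_measure R).
Local Notation N n := (n.+1%:R : R).

(* The derivative of the left cutoff of [window], an approximate identity at 0. *)
Definition bump n (x : R) : R := N n * dramp (N n * x - 1).

(** The shift by 1 inside each ramp keeps the support in [[1 / N, L - 1 / N]], compact in the open
    interval; the transitions take place within [2 / N] of the ends. *)
Definition window n (L x : R) : R := ramp (N n * x - 1) * ramp (N n * (L - x) - 1).

Definition dwindow n (L x : R) : R :=
  bump n x * ramp (N n * (L - x) - 1) - ramp (N n * x - 1) * bump n (L - x).

Lemma bump_ge0 n x : 0 <= bump n x.
Proof. by rewrite mulr_ge0// dramp_ge0. Qed.

Lemma is_derive_ramp_affine n (x : R) :
  is_derive x 1 (fun x => ramp (N n * x - 1)) (bump n x).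
Proof.
have e : is_derive x 1 (fun y : R => N n * y - 1) (N n).
  by apply: is_derive_eq; rewrite /GRing.scale/= subr0 mulr1.
have := @is_derive1_comp R ramp (fun y => N n * y - 1) x _ _ (is_derive_ramp _) e.
by rewrite mulrC.
Qed.

Lemma is_derive_window n (L x : R) : is_derive x 1 (window n L) (dwindow n L x).
Proof.
have d1 := is_derive_ramp_affine n x.
have e : is_derive x 1 (fun y : R => L - y) (-1).
  by apply: is_derive_eq; rewrite add0r mul1r.
have d2 := @is_derive1_comp R (fun x => ramp (N n * x - 1)) (fun y => L - y) x _ _
  (is_derive_ramp_affine n (L - x)) e.
apply: (is_derive_eq (is_deriveM d1 d2)); rewrite /GRing.scale/= /dwindow.
by ring.
Qed.

Lemma continuous_bump n : continuous (bump n).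
Proof.
move=> x; apply: cvgMr.
apply: (@continuous_comp _ _ _ (fun x : R => N n * x - 1) dramp).
  by apply: cvgB; [apply: cvgMr; exact: cvg_id|exact: cvg_cst].
exact: continuous_dramp.
Qed.

Lemma continuous_ramp_affine n : continuous (fun x => ramp (N n * x - 1)).
Proof.
move=> x; apply/differentiable_continuous/derivable1_diffP.
by have [] := is_derive_ramp_affine n x.
Qed.

Lemma continuous_window n L : continuous (window n L).
Proof.
move=> x; apply/differentiable_continuous/derivable1_diffP.
by have [] := is_derive_window n L x.
Qed.

Lemma continuous_reflect (L : R) (f : R -> R) :
  continuous f -> continuous (fun x => f (L - x)).
Proof.
move=> cf x; apply: (@continuous_comp _ _ _ (fun x : R => L - x) f); last exact: cf.
by apply: cvgB; [exact: cvg_cst|exact: cvg_id].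
Qed.

Lemma continuous_dwindow n L : continuous (dwindow n L).
Proof.
move=> x; apply: cvgB; apply: cvgM.
- exact: continuous_bump.
- exact: (@continuous_reflect L _ (@continuous_ramp_affine n)).
- exact: continuous_ramp_affine.
- exact: (@continuous_reflect L _ (@continuous_bump n)).
Qed.

Lemma window_ge0 n L x : 0 <= window n L x.
Proof. by rewrite mulr_ge0// ramp_ge0. Qed.

Lemma window_le1 n L x : window n L x <= 1.
Proof. by rewrite mulr_ile1// ?ramp_ge0// ramp_le1. Qed.

Lemma window0 n (L x : R) : ~ ((N n)^-1 <= x <= L - (N n)^-1) -> window n L x = 0.
Proof.
move=> /negP; rewrite negb_and -!ltNge /window => /orP[h|h].
  by rewrite ramp0 ?mul0r// subr_le0 mulrC -ler_pdivlMr// div1r ltW.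
rewrite [ramp (_ * (L - x) - 1)]ramp0 ?mulr0// subr_le0 mulrC -ler_pdivlMr// div1r.
by rewrite lerBlDr -lerBlDl ltW.
Qed.

Lemma window_cvg1 (L x : R) : 0 < x < L -> window n L x @[n --> \oo] --> (1 : R).
Proof.
move=> /andP[x0 xL]; apply: cvg_near_cst; near=> n.
have Ny (y : R) : 2 / y <= n%:R -> 0 < y -> 1 <= N n * y - 1.
  rewrite -(natr1 n) => + y0; rewrite ler_pdivrMr// mulrDl mul1r => h.
  by lra.
rewrite /window !ramp1 ?mulr1//.
  by apply: Ny; [near: n; exact: nbhs_infty_ger|rewrite subr_gt0].
by apply: Ny => //; near: n; exact: nbhs_infty_ger.
Unshelve. all: end_near. Qed.

Lemma integral_bump_le1 n : \int[mu]_(x in `[0, 1]) bump n x <= 1.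
Proof.
rewrite /Rintegral (@continuous_FTC2 _ _ (fun x => ramp (N n * x - 1)))//=.
- by rewrite mulr0 sub0r [X in _ - X]ramp0 ?subr0 ?ramp_le1//; lra.
- by apply: continuous_subspaceT; exact: continuous_bump.
- split; first by move=> x _; have [] := is_derive_ramp_affine n x.
  + by apply: cvg_at_right_filter; exact: continuous_ramp_affine.
  + by apply: cvg_at_left_filter; exact: continuous_ramp_affine.
- by move=> x _; rewrite derive1E; have [_ ->] := is_derive_ramp_affine n x.
Qed.

(** The ramp has reached 1 at [x = 1] once [2 <= N n]. For [n = 0] the mass is 0, hence the separate
    upper bound [integral_bump_le1]. *)
Lemma integral_bump n : (0 < n)%N -> \int[mu]_(x in `[0, 1]) bump n x = 1.
Proof.
move=> n0; rewrite /Rintegral (@continuous_FTC2 _ _ (fun x => ramp (N n * x - 1)))//=.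
- rewrite mulr0 sub0r [X in _ - X]ramp0 ?subr0; last by lra.
  by rewrite ramp1// mulr1 -(natr1 n) addrK ler1n.
- by apply: continuous_subspaceT; exact: continuous_bump.
- split; first by move=> x _; have [] := is_derive_ramp_affine n x.
  + by apply: cvg_at_right_filter; exact: continuous_ramp_affine.
  + by apply: cvg_at_left_filter; exact: continuous_ramp_affine.
- by move=> x _; rewrite derive1E; have [_ ->] := is_derive_ramp_affine n x.
Qed.

Lemma bump0 n (x : R) : 2 <= N n * x -> bump n x = 0.
Proof. by move=> h; rewrite /bump dramp1 ?mulr0//; lra. Qed.

(** The bump lives in [[1 / N, 2 / N]], inside the interval, so the endpoint value comes with full
    weight 1 rather than one half. *)
Lemma integral_bump_cvg (G : R -> R) : {within `[0, 1], continuous G} ->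
  \int[mu]_(x in `[0, 1]) (bump n x * G x) @[n --> \oo] --> G 0.
Proof.
move=> cG.
have ib n : mu.-integrable `[0, 1] (EFin \o bump n).
  by apply: continuous_integrable; apply: continuous_subspaceT; exact: continuous_bump.
have ibG n : mu.-integrable `[0, 1] (EFin \o (fun x => bump n x * G x)).
  apply: continuous_integrable; apply: within_continuousM => //.
  by apply: continuous_subspaceT; exact: continuous_bump.
have [_ G0 _] := (continuous_within_itvP _ (@ltr01 R)).1 cG.
have iD n : mu.-integrable `[0, 1] (EFin \o (fun x => bump n x * (G 0 - G x))).
  rewrite (_ : _ \o _ = EFin \o (fun x => bump n x * G 0 - bump n x * G x)).
    have iZ : mu.-integrable `[0, 1] (EFin \o (fun x => bump n x * G 0)).
      exact: integrable_EFinZr.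
    exact: (integrableB _ iZ (ibG n)).
  by apply/funext => x /=; rewrite mulrBr.
apply/cvgrPdist_le => e e0.
move/cvgrPdist_le : G0 => /(_ e e0)[d /= d0 hd].
near=> n.
have n0 : (0 < n)%N by near: n; exact: nbhs_infty_gt.
have -> : G 0 - \int[mu]_(x in `[0, 1]) (bump n x * G x) =
    \int[mu]_(x in `[0, 1]) (bump n x * (G 0 - G x)).
  have -> : G 0 = \int[mu]_(x in `[0, 1]) (bump n x * G 0).
    by rewrite RintegralZr// integral_bump// mul1r.
  rewrite -RintegralB//; last exact: integrable_EFinZr.
  by rewrite [in RHS]RintegralZr// integral_bump// mul1r;
    apply: eq_Rintegral => x _; rewrite mulrBr.
rewrite (le_trans (le_normr_Rintegral _ (iD n)))//.
apply: (@le_trans _ _ (\int[mu]_(x in `[0, 1]) (bump n x * e))).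
  apply: le_Rintegral => //.
  - exact: integrable_norm.
  - exact: integrable_EFinZr.
  - move=> x /=; rewrite in_itv/= => /andP[x0 x1].
    rewrite normrM (ger0_norm (bump_ge0 _ _)).
    have [h|h] := leP 2 (N n * x); first by rewrite bump0// !mul0r.
    rewrite ler_wpM2l ?bump_ge0//.
    move: x0; rewrite le_eqVlt => /predU1P[<-|x0]; first by rewrite subrr normr0 ltW.
    apply: hd => //=; rewrite sub0r normrN gtr0_norm//.
    have : 2 / d <= n%:R by near: n; exact: nbhs_infty_ger.
    rewrite ler_pdivrMr// => h2.
    rewrite -(@ltr_pM2l _ (N n))// (lt_le_trans h)// (le_trans h2)//.
    by apply: ler_wpM2r; [exact: ltW|rewrite ler_nat].
rewrite RintegralZr// ler_piMl//; first exact: ltW. exact: integral_bump_le1.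
Unshelve. all: end_near. Qed.

Lemma continuous_reflect_within (L : R) (G : R -> R) : {within `[0, L], continuous G} ->
  {within `[0, L], continuous (fun x => G (L - x))}.
Proof.
apply: within_comp_continuous => [x /=|].
  by rewrite !in_itv/=; lra.
by move=> x; apply: cvgB; [exact: cvg_cst|exact: cvg_id].
Qed.

Lemma Rintegral_reflect (L : R) (G : R -> R) : 0 <= L -> {within `[0, L], continuous G} ->
  \int[mu]_(x in `[0, L]) G (L - x) = \int[mu]_(x in `[0, L]) G x.
Proof.
move=> L0 cG; rewrite /Rintegral; congr fine.
have := @integration_by_substitution_oppr R G (- L) 0.
rewrite oppr_le0 oppr0 opprK => /(_ L0 cG) ->.
have mG : measurable_fun `[- L, 0] (fun x => (G (- x))%:E).
  apply/measurable_EFinP; apply: subspace_continuous_measurable_fun => //.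
  apply: (within_comp_continuous _ _ cG) => [x /=|x]; last exact: cvgN.
  by rewrite !in_itv/=; lra.
rewrite -(@integral_translate R (- L) _ _ (measurable_itv _) mG).
rewrite (_ : [set x | _] = `[0, L]%classic); last first.
  by apply/seteqP; split => x /=; rewrite !in_itv/=; lra.
by apply: eq_integral => x _; rewrite opprB.
Qed.

(** Where one bump is nonzero the opposite cutoff is already 1, as the layers of width [2 / N] stay
    apart; the computation uses [4 <= N]. *)
Lemma dwindowE n (x : R) : (3 < n)%N -> 0 <= x <= 1 ->
  dwindow n 1 x = bump n x - bump n (1 - x).
Proof.
move=> n3 /andP[x0 x1].
have N4 : 4 <= N n by rewrite ler_nat ltnW.
rewrite /dwindow; congr (_ - _).
  have [h|h] := leP 2 (N n * x); first by rewrite bump0// mul0r.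
  by rewrite ramp1 ?mulr1// mulrBr mulr1; lra.
have [h|h] := leP 2 (N n * (1 - x)); first by rewrite bump0// mulr0.
by rewrite ramp1 ?mul1r//; move: h; rewrite mulrBr mulr1; lra.
Qed.

Lemma integral_dwindow_cvg (G : R -> R) : {within `[0, 1], continuous G} ->
  \int[mu]_(x in `[0, 1]) (dwindow n 1 x * G x) @[n --> \oo] --> G 0 - G 1.
Proof.
move=> cG; have cG' := continuous_reflect_within cG.
have cbG n (H : R -> R) : {within `[0, 1], continuous H} ->
    {within `[0, 1], continuous (fun x => bump n x * H x)}.
  move=> cH; apply: within_continuousM => //.
  by apply: continuous_subspaceT; exact: continuous_bump.
have -> : G 0 - G 1 = G 0 - G (1 - 0) by rewrite subr0.
apply: cvg_trans (cvgB (integral_bump_cvg cG) (integral_bump_cvg cG')).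
apply: near_eq_cvg; near=> n.
have n3 : (3 < n)%N by near: n; exact: nbhs_infty_gt.
rewrite !fctE.
have -> : \int[mu]_(x in `[0, 1]) (bump n x * G (1 - x)) =
    \int[mu]_(x in `[0, 1]) (bump n (1 - x) * G (1 - (1 - x))).
  exact: (esym (Rintegral_reflect ler01 (cbG n _ cG'))).
rewrite -RintegralB//.
- apply: eq_Rintegral => x; rewrite inE/= in_itv/= => x01.
  by rewrite dwindowE// subKr mulrBl.
- exact: continuous_integrable (cbG _ _ _).
- exact: continuous_integrable (continuous_reflect_within (cbG n _ cG')).
  
Unshelve. all: end_near. Qed.

(** [dwindow] is not bounded uniformly in [n], but each of its two bumps has mass at most 1; this
    supplies the domination in [t] for the boundary term. *)
Lemma norm_integral_dwindow_le n (G : R -> R) (K : R) : {within `[0, 1], continuous G} ->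
  (forall x, 0 <= x <= 1 -> `|G x| <= K) ->
  `|\int[mu]_(x in `[0, 1]) (dwindow n 1 x * G x)| <= 2 * K.
Proof.
move=> cG GK.
have cb : {within `[0, 1], continuous (bump n)}.
  by apply: continuous_subspaceT; exact: continuous_bump.
have cb' := continuous_reflect_within cb.
have K0 : 0 <= K by rewrite (le_trans _ (GK 0 _))// lexx ler01.
have i1 : mu.-integrable `[0, 1] (EFin \o (fun x => bump n x * K)).
  by apply: integrable_EFinZr => //; exact: continuous_integrable.
have i2 : mu.-integrable `[0, 1] (EFin \o (fun x => bump n (1 - x) * K)).
  by apply: integrable_EFinZr => //; exact: continuous_integrable.
have iG : mu.-integrable `[0, 1] (EFin \o (fun x => dwindow n 1 x * G x)).
  apply: continuous_integrable; apply: within_continuousM => //.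
  by apply: continuous_subspaceT; exact: continuous_dwindow.
rewrite (le_trans (le_normr_Rintegral _ iG))//.
apply: (@le_trans _ _ (\int[mu]_(x in `[0, 1]) (bump n x * K + bump n (1 - x) * K))).
  apply: le_Rintegral => //; first exact: integrable_norm.
    exact: (integrableD _ i1 i2).
  move=> x /=; rewrite in_itv/= => x01; rewrite normrM -mulrDl.
  rewrite ler_pM ?GK//.
  rewrite (le_trans (ler_normB _ _))// (normrM (bump n x)) (normrM (ramp _)).
  rewrite !(ger0_norm (bump_ge0 _ _)) !(ger0_norm (ramp_ge0 _)).
  by apply: lerD; [rewrite ler_piMr|rewrite ler_piMl]; rewrite ?bump_ge0 ?ramp_le1.
rewrite RintegralD// !RintegralZr//; try exact: continuous_integrable.
rewrite Rintegral_reflect// -mulrDl ler_wpM2r//.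
by have := integral_bump_le1 n; lra.
Qed.

End window.

(** * Continuous functions on the closed cylinder *)

Section cylinder.
Context {R : realType}.
Local Notation mu := (@lebesgue_measure R).
Local Notation RxR := (measurableTypeR R * measurableTypeR R)%type.
Variables (T : R) (y : R -> R -> R).
Hypothesis cy : continuous_closed_cyl T y.

Lemma cyl_slice_x t : 0 <= t <= T -> {within `[0, 1], continuous (y ^~ t)}.
Proof.
move=> tT; refine (@within_comp_continuous R (R * R)%type R _ (closed_cyl T)
  (fun x => (x, t)) (fun p => y p.1 p.2) _ _ cy).
- by move=> x x01; split => //=; rewrite in_itv.
- by move=> x; apply: (@cvg_pair _ _ _ (nbhs x) (nbhs x) (nbhs t)); [exact: cvg_id|exact: cvg_cst].
Qed.

Lemma cyl_slice_t x : 0 <= x <= 1 -> {within `[0, T], continuous (y x)}.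
Proof.
move=> x01; refine (@within_comp_continuous R (R * R)%type R _ (closed_cyl T)
  (fun t => (x, t)) (fun p => y p.1 p.2) _ _ cy).
- by move=> t tT; split => //=; rewrite in_itv.
- by move=> t; apply: (@cvg_pair _ _ _ (nbhs t) (nbhs x) (nbhs t)); [exact: cvg_cst|exact: cvg_id].
Qed.

Lemma cyl_bounded : exists2 M, 0 < M &
  forall x t, 0 <= x <= 1 -> 0 <= t <= T -> `|y x t| <= M.
Proof.
have := compact_bounded (continuous_compact cy
  (compact_setX (@segment_compact R 0 1) (@segment_compact R 0 T))).
move=> [M [_ /(_ (`|M| + 1))]] h.
exists (`|M| + 1) => [|x t x01 tT]; first by rewrite ltr_wpDl.
apply: h; first by rewrite ltr_pwDr// ler_norm.
by exists (x, t) => //; split; rewrite /= in_itv.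
Qed.

Lemma measurable_cyl : measurable (cyl T : set RxR).
Proof. exact: measurableX. Qed.

(** Measurability is for the product sigma-algebra, reached by a Caratheodory argument: rounding [x]
    down to a multiple of [1 / (n + 1)] leaves countably many strips on which the function depends
    continuously on [t] alone, and continuity in [x] gives the limit. *)
Lemma measurable_cyl_fun : measurable_fun (cyl T : set RxR) (fun p : RxR => y p.1 p.2).
Proof.
pose f n (p : RxR) := y ((Num.truncn (n.+1%:R * p.1))%:R / n.+1%:R) p.2.
have tb n (x : R) : 0 <= x ->
    (Num.truncn (n.+1%:R * x))%:R / n.+1%:R <= x < 
    (Num.truncn (n.+1%:R * x))%:R / n.+1%:R + n.+1%:R^-1.
  move=> x0; have := @truncn_itv R (n.+1%:R * x).
  rewrite mulr_ge0// => /(_ isT)/andP[h1 h2].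
  rewrite ler_pdivrMr// (mulrC x) h1/= -[X in _ + X]mul1r -mulrDl ltr_pdivlMr//.
  by rewrite (mulrC x) natr1.
apply: (@measurable_fun_cvg _ _ _ _ f).
  move=> n.
  pose E i : set RxR :=
    (`]0, 1[ `&` `[i%:R / n.+1%:R, i.+1%:R / n.+1%:R[) `*` `]0, T[.
  have -> : cyl T = \bigcup_i E i.
    apply/seteqP; split => [[x t] [/= x01 tT]|[x t] [i _ [[x01 _] tT]]]; last by [].
    exists (Num.truncn (n.+1%:R * x)) => //; split => //; split => //=.
    move: x01; rewrite in_itv/= => /andP[x0 _].
    rewrite in_itv/=; have /andP[-> /=] := tb n x (ltW x0).
    by rewrite -[(Num.truncn (n.+1%:R * x)).+1%:R]natr1 mulrDl mul1r.
  have mE i : measurable (E i) by apply: measurableX => //; exact: measurableI.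
  apply/measurable_fun_bigcup => // i.
  (* Strips starting at 1 or beyond are empty; for the others the grid point lies in [[0, 1]], where
     the slice in [t] is continuous. *)
  have [i1|i1] := leP 1 (i%:R / n.+1%:R : R).
    have -> : E i = set0; last exact: measurable_fun_set0.
    apply/seteqP; split => // -[x t] [[/=]]; rewrite !in_itv/=.
    move=> /andP[_ x1] /andP[ix _] _.
    by move: (le_lt_trans (le_trans i1 ix) x1); rewrite ltxx.
  apply: (@eq_measurable_fun _ _ _ _ _ (fun p => y (i%:R / n.+1%:R) p.2)).
    move=> -[x t]; rewrite inE => -[[/= _]]; rewrite in_itv/= => /andP[h1 h2] _.
    rewrite /f/=; congr (y (_ / _) _); congr (_%:R).
    apply/esym/truncn_def; move: h1 h2; rewrite ler_pdivrMr// ltr_pdivlMr//.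
    by rewrite mulrC => -> /=; rewrite mulrC.
  apply: (@measurable_comp _ _ _ _ _ _ `]0, T[) => //.
    by move=> _ [[x t] [_ /= tT] <-].
  apply: (@measurable_funS _ _ _ _ `[0, T]) => //.
    exact: subset_itv_oo_cc.
  apply: subspace_continuous_measurable_fun => //.
  by apply: cyl_slice_t; rewrite divr_ge0//= ltW.
  exact: measurable_funTS.
move=> -[x t] []; rewrite /= !in_itv/= => /andP[x0 x1] /andP[t0 tT].
have tT' : 0 <= t <= T by rewrite !ltW.
have [cx _ _] := (continuous_within_itvP _ (@ltr01 R)).1 (cyl_slice_x tT').
suff h : (Num.truncn (n.+1%:R * x))%:R / n.+1%:R @[n --> \oo] --> x.
  have cx1 : {for x, continuous (y ^~ t)} by apply: cx; rewrite in_itv/= x0 x1.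
  exact: (@cvg_comp nat R R _ (y ^~ t) _ (nbhs x) (nbhs (y x t)) h cx1).
apply: (@squeeze_cvgr _ _ _ _ (fun n => x - n.+1%:R^-1) (fun=> x)).
- apply: nearW => n; have /andP[-> h] := tb n x (ltW x0).
  by rewrite andbT lerBlDr ltW.
- rewrite -[X in _ --> X]subr0; apply: cvgB; first exact: cvg_cst.
  exact: cvg_harmonic.
- exact: cvg_cst.
Qed.

End cylinder.

Lemma Rintegral_itv_oo_cc (R : realType) (a b : R) (f : R -> R) :
  {within `[a, b], continuous f} ->
  \int[@lebesgue_measure R]_(x in `]a, b[) f x =
  \int[@lebesgue_measure R]_(x in `[a, b]) f x.
Proof.
move=> /continuous_integrable intf.
have s1 : `]a, b] `<=` (`[a, b] : set R) by exact: subset_itv_oc_cc.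
have s2 : `]a, b[ `<=` (`[a, b] : set R) by exact: subset_itv_oo_cc.
rewrite Rintegral_itv_bndo_bndc; last first.
  exact: (@integrableS _ _ _ (@lebesgue_measure R) _ _ _ (measurable_itv _) (measurable_itv _) s2).
rewrite Rintegral_itv_obnd_cbnd//.
exact: (@integrableS _ _ _ (@lebesgue_measure R) _ _ _ (measurable_itv _) (measurable_itv _) s1).
Qed.

Section cylinder_integrals.
Context {R : realType}.
Local Notation mu := (@lebesgue_measure R).
Local Notation RxR := (measurableTypeR R * measurableTypeR R)%type.
Local Notation leb2 := (@leb2 R).
Variable T : R.
Hypothesis T0 : 0 < T.

Lemma leb2_cyl_fin : (leb2 (cyl T) < +oo)%E.
Proof.
rewrite /leb2/= product_measure1E//= !lebesgue_measure_itv/= !lte_fin ltr01 T0.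
by rewrite -!EFinB -EFinM ltry.
Qed.

Lemma bounded_cyl_integrable (h : RxR -> R) C : measurable_fun (cyl T) h ->
  (forall p, cyl T p -> `|h p| <= C) -> leb2.-integrable (cyl T) (EFin \o h).
Proof.
move=> mh hC; apply: measurable_bounded_integrable => //.
- exact: measurable_cyl.
- exact: leb2_cyl_fin.
- exists C; split; [exact: num_real|move=> x Cx p /hC h'; exact: le_trans h' (ltW Cx)].
Qed.

(** [|g| <= 1 + g^2], and the cylinder has finite measure. *)
Lemma Lfun2_cyl_integrable (g : RxR -> R) : (g \_ (cyl T)) \in Lfun leb2 2%:E ->
  leb2.-integrable (cyl T) (EFin \o g).
Proof.
move=> g2; have mc := @measurable_cyl R T.
have /set_mem/= mg := sub_Lfun_mfun g2.
have mg' : measurable_fun (cyl T) g by apply/(measurable_restrictT _ mc).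
have ig2 := Lfun2_integrable_sqr g2.
have i1 : leb2.-integrable (cyl T) (EFin \o (fun _ : RxR => 1 : R)).
  apply: (@bounded_cyl_integrable _ 1) => // p _; by rewrite normr1.
have ig2' := @integrableS _ _ _ leb2 _ _ _ measurableT mc (@subsetT _ _) ig2.
have i2 := integrableD mc i1 ig2'.
apply: (le_integrable mc _ _ i2).
  exact/measurable_EFinP.
move=> p cp /=; rewrite patchE mem_set// lee_fin [leRHS]ger0_norm ?addr_ge0 ?sqr_ge0//.
have := sqr_ge0 (`|g p| - 1); rewrite -(real_normK (num_real (g p))).
by have := normr_ge0 (g p); nra.
Qed.

Lemma measurable_cyl_prod (a b : R -> R) : continuous a -> continuous b ->
  measurable_fun (cyl T) (fun p : RxR => a p.1 * b p.2).
Proof.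
move=> ca cb; apply: measurable_funTS; apply: measurable_funM.
  by apply: measurableT_comp; [exact: continuous_measurable_fun|exact: measurable_fst].
by apply: measurableT_comp; [exact: continuous_measurable_fun|exact: measurable_snd].
Qed.

Lemma continuous_prod (a b : R -> R) : continuous a -> continuous b ->
  continuous (fun p : R * R => a p.1 * b p.2).
Proof.
move=> ca cb p; apply: cvgM.
  by apply: (@continuous_comp _ _ _ fst a); [exact: cvg_fst|exact: ca].
by apply: (@continuous_comp _ _ _ snd b); [exact: cvg_snd|exact: cb].
Qed.

Lemma windows_cvg (F : RxR -> R) : leb2.-integrable (cyl T) (EFin \o F) ->
  \int[leb2]_(p in cyl T) (window n 1 p.1 * window n T p.2 * F p) @[n --> \oo] -->
  \int[leb2]_(p in cyl T) F p.
Proof.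
move=> iF; have mc := @measurable_cyl R T.
have mF : measurable_fun (cyl T) F by apply/measurable_EFinP; exact: (measurable_int leb2).
have [||||_] := @dominated_cvg_Rintegral _ _ _ leb2 (cyl T)
  (fun n p => window n 1 p.1 * window n T p.2 * F p) F (fun p => `|F p|) mc; last by [].
- move=> n; apply: measurable_funM => //.
  by apply: measurable_cyl_prod; exact: continuous_window.
- move=> [x t] [/=]; rewrite !in_itv/= => x01 t0T.
  rewrite -[X in _ --> X]mul1r -[X in X * F _]mulr1.
  by apply: cvgMl; apply: cvgM; exact: window_cvg1.
- exact: integrable_norm.
- move=> n p _; rewrite normrM ler_piMl// normrM mulr_ile1//.
    by rewrite ger0_norm ?window_ge0 ?window_le1.
  by rewrite ger0_norm ?window_ge0 ?window_le1.
Qed.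

(** The source of the lateral traces: the derivative of the cutoff in [x] concentrates at [x = 0]
    and [x = 1] with opposite signs, while the cutoff in [t] just tends to 1. *)
Lemma dwindow_windows_cvg (G : R -> R -> R) : continuous_closed_cyl T G ->
  \int[leb2]_(p in cyl T) (dwindow n 1 p.1 * window n T p.2 * G p.1 p.2) @[n --> \oo] -->
  \int[mu]_(t in `[0, T]) (G 0 t - G 1 t).
Proof.
move=> cG; have mc := @measurable_cyl R T.
have mG := measurable_cyl_fun cG.
have [K K0 GK] := cyl_bounded cG.
have cGd : {within `[0, T], continuous (fun t => G 0 t - G 1 t)}.
  move=> t; apply: continuousB; first by apply: (cyl_slice_t cG); rewrite lexx ler01.
  by apply: (cyl_slice_t cG); rewrite lexx ler01.
have iGd := continuous_integrable cGd.
rewrite -(Rintegral_itv_oo_cc cGd).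
have so : `]0, T[ `<=` (`[0, T] : set R) by exact: subset_itv_oo_cc.
have so1 : `]0, 1[ `<=` (`[0, 1] : set R) by exact: subset_itv_oo_cc.
pose f n x t := dwindow n 1 x * window n T t * G x t.
have mf n : measurable_fun (cyl T) (fun p : RxR => f n p.1 p.2).
  exact: (measurable_funM (measurable_cyl_prod (@continuous_dwindow R n 1)
    (@continuous_window R n T)) mG).
have w1 n (L x : R) : `|window n L x| <= 1 by rewrite ger0_norm ?window_ge0 ?window_le1.
have cD n : {within `[0, 1], continuous (dwindow n (1 : R))}.
  by apply: continuous_subspaceT; exact: continuous_dwindow.
have cDG n t : 0 <= t <= T -> {within `[0, 1], continuous (fun x => dwindow n 1 x * G x t)}.
  by move=> tT; apply: within_continuousM => //; exact: cyl_slice_x cG _ tT.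
pose J n t := \int[mu]_(x in `]0, 1[) (dwindow n 1 x * G x t).
have if12 n : leb2.-integrable (cyl T) (EFin \o (fun p : RxR => f n p.1 p.2)).
  have [D D0 dD] := continuous_segment_bounded (cD n).
  apply: (bounded_cyl_integrable (C := D * 1 * K)) => // -[x t] [/=].
  rewrite !in_itv/= => /andP[x0 x1] /andP[t0 tT].
  rewrite normrM (normrM (dwindow _ _ _)); apply: ler_pM => //; last by apply: GK; rewrite !ltW.
  by apply: ler_pM => //; apply: dD; rewrite !ltW.
have if2 n t : `]0, T[%classic t -> mu.-integrable `]0, 1[ (fun x => (f n x t)%:E).
  rewrite /= in_itv/= => /andP[t0 tT].
  apply: (@integrableS _ _ _ mu _ _ _ (measurable_itv _) (measurable_itv _) so1).
  apply: (@continuous_integrable _ 0 1 (fun x => f n x t)).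
  rewrite (_ : (fun x => _) = (fun x => dwindow n 1 x * G x t * window n T t)); last first.
    by apply/funext => x; rewrite /f mulrAC.
  by apply: within_continuousMr; apply: cDG; rewrite !ltW.
have E1 n t : 0 < t < T -> \int[mu]_(x in `]0, 1[) f n x t = window n T t * J n t.
  move=> /andP[t0 tT]; rewrite -RintegralZl//.
    by apply: eq_Rintegral => x _; rewrite /f; ring.
  apply: (@integrableS _ _ _ mu _ _ _ (measurable_itv _) (measurable_itv _) so1).
  by apply: continuous_integrable; apply: cDG; rewrite !ltW.
have E n : \int[leb2]_(p in cyl T) f n p.1 p.2 =
    \int[mu]_(t in `]0, T[) (window n T t * J n t).
  rewrite (@Rfubini2 _ _ _ _ _ mu mu _ _ _ (measurable_itv _) (measurable_itv _) (if12 n) (if2 n)).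
  by apply: eq_Rintegral => t; rewrite inE/= in_itv/=; exact: E1.
rewrite (_ : (fun n => _) = (fun n => \int[mu]_(t in `]0, T[) (window n T t * J n t)));
  last by apply/funext => n; exact: E.
have [||||_] := @dominated_cvg_Rintegral _ _ _ mu `]0, T[
  (fun n t => window n T t * J n t) (fun t => G 0 t - G 1 t) (fun=> 2 * K)
  (measurable_itv _); last by [].
- move=> n.
  apply: (@eq_measurable_fun _ _ _ _ _ (fun t => \int[mu]_(x in `]0, 1[) f n x t)).
    by move=> t; rewrite inE/= in_itv/=; exact: E1.
  exact: (@measurable_Rfubini2 _ _ _ _ _ mu mu _ _ _ (measurable_itv _) (measurable_itv _)
    (if12 n) (if2 n)).
- move=> t; rewrite /= in_itv/= => /andP[t0 tT].
  have tT' : 0 <= t <= T by rewrite !ltW.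
  rewrite -[X in _ --> X]mul1r; apply: cvgM; first by apply: window_cvg1; rewrite t0 tT.
  rewrite (_ : J ^~ t = fun n => \int[mu]_(x in `[0, 1]) (dwindow n 1 x * G x t)).
    exact: (integral_dwindow_cvg (cyl_slice_x cG tT')).
  by apply/funext => n; exact: Rintegral_itv_oo_cc (cDG n t tT').
- apply: (@integrableS _ _ _ mu _ _ _ (measurable_itv _) (measurable_itv _) so).
  by apply: continuous_integrable; apply: continuous_subspaceT => x; exact: cvg_cst.
- move=> n t; rewrite /= in_itv/= => /andP[t0 tT].
  have tT' : 0 <= t <= T by rewrite !ltW.
  rewrite normrM -[leRHS]mul1r; apply: ler_pM => //.
  rewrite /J (Rintegral_itv_oo_cc (cDG n t tT')).
  by apply: (norm_integral_dwindow_le n (cyl_slice_x cG tT')) => x x01; exact: GK.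
Qed.

End cylinder_integrals.

(** * The weak derivative up to the lateral boundary *)

Section weak_integration_by_parts.
Context {R : realType}.
Local Notation mu := (@lebesgue_measure R).
Local Notation RxR := (measurableTypeR R * measurableTypeR R)%type.
Local Notation leb2 := (@leb2 R).

Lemma is_derive_mulr (a a' : R -> R) (c x : R) : is_derive x 1 a (a' x) ->
  is_derive x 1 (fun x => a x * c) (a' x * c).
Proof.
by move=> da; apply: is_derive_eq; rewrite /GRing.scale/= mulr0 add0r mulrC.
Qed.

Lemma is_derive_mull (a a' : R -> R) (c x : R) : is_derive x 1 a (a' x) ->
  is_derive x 1 (fun x => c * a x) (c * a' x).
Proof.
by move=> da; apply: is_derive_eq; rewrite /GRing.scale/=; ring.
Qed.

Lemma is_derive_continuous (a a' : R -> R) : (forall x : R, is_derive x 1 a (a' x)) ->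
  continuous a.
Proof.
move=> da x; apply/differentiable_continuous/derivable1_diffP.
by have [] := da x.
Qed.

Section product.
Variables (a a' b b' : R -> R).
Hypotheses (da : forall x : R, is_derive x 1 a (a' x)) (ca : continuous a').
Hypotheses (db : forall x : R, is_derive x 1 b (b' x)) (cb : continuous b').

Lemma dx_prod x t : dx (fun x t => a x * b t) x t = a' x * b t.
Proof. by rewrite /dx derive1E; have [_ ->] := is_derive_mulr (b t) (da x). Qed.

Lemma dt_prod x t : dt (fun x t => a x * b t) x t = a x * b' t.
Proof. by rewrite /dt derive1E; have [_ ->] := is_derive_mull (a x) (db t). Qed.

Lemma C1_prod : C1 (fun x t => a x * b t).
Proof.
split.
- move=> x t; split; first by have [] := is_derive_mulr (b t) (da x).
  by have [] := is_derive_mull (a x) (db t).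
- rewrite (_ : (fun p => _) = fun p : R * R => a' p.1 * b p.2).
    by apply: continuous_prod => //; exact: is_derive_continuous db.
  by apply/funext => p; rewrite dx_prod.
- rewrite (_ : (fun p => _) = fun p : R * R => a p.1 * b' p.2).
    by apply: continuous_prod => //; exact: is_derive_continuous da.
  by apply/funext => p; rewrite dt_prod.
Qed.

End product.

Variable T : R.
Hypothesis T0 : 0 < T.

Lemma continuous_cyl_integrable (y : R -> R -> R) : continuous_closed_cyl T y ->
  leb2.-integrable (cyl T) (EFin \o (fun p : RxR => y p.1 p.2)).
Proof.
move=> cy; have [K K0 yK] := cyl_bounded cy.
apply: (bounded_cyl_integrable T0 (C := K)) => //; first exact: measurable_cyl_fun cy.
move=> [x t] []; rewrite /= !in_itv/= => /andP[x0 x1] /andP[t0 tT].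
by apply: yK; rewrite !ltW.
Qed.

Lemma integrable_cyl_mul (a b : R -> R) (F : RxR -> R) :
  continuous a -> continuous b -> leb2.-integrable (cyl T) (EFin \o F) ->
  leb2.-integrable (cyl T) (EFin \o (fun p : RxR => a p.1 * b p.2 * F p)).
Proof.
move=> ca cb iF; have mc := @measurable_cyl R T.
have cab : continuous_closed_cyl T (fun x t => a x * b t).
  by apply: continuous_subspaceT; exact: continuous_prod.
have [K K0 abK] := cyl_bounded cab.
have i2 := integrable_EFinZl K mc iF.
apply: (le_integrable mc _ _ i2).
  apply/measurable_EFinP; apply: measurable_funM; first exact: measurable_cyl_prod.
  by apply/measurable_EFinP; exact: (measurable_int leb2).
move=> [x t] []; rewrite /= !in_itv/= => /andP[x0 x1] /andP[t0 tT].
rewrite lee_fin (normrM (a x * b t)) [leRHS]normrM ler_wpM2r//.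
by rewrite (gtr0_norm K0) abK ?ltW.
Qed.

Variables (phi g : R -> R -> R).
Hypothesis cphi : continuous_closed_cyl T phi.
Hypothesis hg : weak_dx T phi g.

Lemma weak_dx_integrable : leb2.-integrable (cyl T) (EFin \o (fun p : RxR => g p.1 p.2)).
Proof. by apply: (Lfun2_cyl_integrable T0); exact: hg.1. Qed.

Variables (om om' ta ta' : R -> R).
Hypotheses (dom : forall x : R, is_derive x 1 om (om' x)) (com : continuous om').
Hypotheses (dta : forall x : R, is_derive x 1 ta (ta' x)) (cta : continuous ta').

Lemma compact_support_windows n : compact_support_in (cyl T)
  (fun x t => (window n 1 x * om x) * (window n T t * ta t)).
Proof.
pose N : R := n.+1%:R^-1; have N0 : 0 < N by rewrite invr_gt0.
exists (`[N, 1 - N] `*` `[N, T - N]); split.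
- by apply: compact_setX; exact: segment_compact.
- move=> [x t] []; rewrite /= !in_itv/= => /andP[x0 x1] /andP[t0 tT].
  split; rewrite /= in_itv/=; apply/andP; split; try exact: lt_le_trans N0 _.
    by rewrite (le_lt_trans x1)// gtrBl.
  by rewrite (le_lt_trans tT)// gtrBl.
- move=> x t h.
  have [hx|/negP hx] := boolP (N <= x <= 1 - N); last by rewrite window0// !mul0r.
  have [ht|/negP ht] := boolP (N <= t <= T - N).
    by case: h; split; rewrite /= in_itv.
  by rewrite (window0 (L := T))// mul0r mulr0.
Qed.

(** [weak_dx] only sees test functions supported inside the cylinder. Windows that fill it extend
    the formula to the lateral sides, where [om 0 = 0] removes the trace at [x = 0]; the ends in [t]
    contribute nothing, as only [x] is differentiated. *)
Lemma weak_dx_ibp : om 0 = 0 ->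
  \int[leb2]_(p in cyl T) (g p.1 p.2 * (om p.1 * ta p.2)) =
  - (\int[leb2]_(p in cyl T) (phi p.1 p.2 * (om' p.1 * ta p.2))) +
  (\int[mu]_(t in `[0, T]) (phi 1 t * (om 1 * ta t))).
Proof.
move=> om0; have co := is_derive_continuous dom; have ct := is_derive_continuous dta.
have mc := @measurable_cyl R T.
pose X (p : RxR) := om p.1 * ta p.2 * g p.1 p.2.
pose Y (p : RxR) := om' p.1 * ta p.2 * phi p.1 p.2.
pose Z x t := om x * ta t * phi x t.
have iX : leb2.-integrable (cyl T) (EFin \o X).
  by apply: integrable_cyl_mul => //; exact: weak_dx_integrable.
have iY : leb2.-integrable (cyl T) (EFin \o Y).
  by apply: integrable_cyl_mul => //; exact: continuous_cyl_integrable.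
have cZ : continuous_closed_cyl T Z.
  have cot : continuous_closed_cyl T (fun x t => om x * ta t).
    by apply: continuous_subspaceT; exact: continuous_prod.
  by move=> p; apply: cvgM; [exact: cot|exact: cphi].
have cX := windows_cvg iX.
have cY := windows_cvg iY.
have cZ1 := dwindow_windows_cvg T0 cZ.
have dn n (x : R) : is_derive x 1 (fun x => window n 1 x * om x)
    (dwindow n 1 x * om x + window n 1 x * om' x).
  apply: (is_derive_eq (is_deriveM (is_derive_window n 1 x) (dom x))).
  by rewrite /GRing.scale/=; ring.
have dn' n (t : R) : is_derive t 1 (fun t => window n T t * ta t)
    (dwindow n T t * ta t + window n T t * ta' t).
  apply: (is_derive_eq (is_deriveM (is_derive_window n T t) (dta t))).
  by rewrite /GRing.scale/=; ring.
have cn n : continuous (fun x => dwindow n (1 : R) x * om x + window n 1 x * om' x).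
  move=> x; apply: cvgD; apply: cvgM; [exact: continuous_dwindow|exact: co|
    exact: continuous_window|exact: com].
have cn' n : continuous (fun t => dwindow n T t * ta t + window n T t * ta' t).
  move=> x; apply: cvgD; apply: cvgM; [exact: continuous_dwindow|exact: ct|
    exact: continuous_window|exact: cta].
(* The product rule for [window n 1] times [om] separates the layer term, with [dwindow], from the
   interior term. *)
have E n : \int[leb2]_(p in cyl T) (dwindow n 1 p.1 * window n T p.2 * Z p.1 p.2) +
    \int[leb2]_(p in cyl T) (window n 1 p.1 * window n T p.2 * Y p) =
    - \int[leb2]_(p in cyl T) (window n 1 p.1 * window n T p.2 * X p).
  have := hg.2 _ (C1_prod (dn n) (cn n) (dn' n) (cn' n)) (compact_support_windows n).
  have -> : \int[leb2]_(p in cyl T) (window n 1 p.1 * window n T p.2 * X p) =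
      \int[leb2]_(p in cyl T) (g p.1 p.2 * (window n 1 p.1 * om p.1 * (window n T p.2 * ta p.2))).
    by apply: eq_Rintegral => p _; rewrite /X; ring.
  move=> <-; rewrite -RintegralD//.
  - apply: eq_Rintegral => p _; rewrite (dx_prod _ (dn n)) /Y /Z; ring.
  - apply: integrable_cyl_mul; [exact: continuous_dwindow|exact: continuous_window|].
    exact: continuous_cyl_integrable.
  - apply: integrable_cyl_mul => //; exact: continuous_window.
have : \int[mu]_(t in `[0, T]) (Z 0 t - Z 1 t) + \int[leb2]_(p in cyl T) Y p =
    - \int[leb2]_(p in cyl T) X p.
  rewrite -(cvg_lim (@Rhausdorff R) (cvgD cZ1 cY)) -(cvg_lim (@Rhausdorff R) (cvgN cX)).
  by congr (lim (_ @ \oo)); apply/funext => n; rewrite !fctE E.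
have -> : \int[leb2]_(p in cyl T) X p =
    \int[leb2]_(p in cyl T) (g p.1 p.2 * (om p.1 * ta p.2)).
  by apply: eq_Rintegral => p _; rewrite /X mulrC.
have -> : \int[leb2]_(p in cyl T) Y p =
    \int[leb2]_(p in cyl T) (phi p.1 p.2 * (om' p.1 * ta p.2)).
  by apply: eq_Rintegral => p _; rewrite /Y mulrC.
have -> : \int[mu]_(t in `[0, T]) (Z 0 t - Z 1 t) =
    - \int[mu]_(t in `[0, T]) (phi 1 t * (om 1 * ta t)).
  rewrite -mulN1r -RintegralZl//.
    by apply: eq_Rintegral => t _; rewrite /Z om0; ring.
  have := continuous_integrable (cyl_slice_t cZ (x := 1) _).
  rewrite lexx ler01 => /(_ isT); apply: eq_integrable => // t _.
  by rewrite /= /Z mulrC.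
have aux (i j k : R) : - i + j = - k -> k = - j + i by lra.
exact: aux.
Qed.

End weak_integration_by_parts.

(** * Boundary values of the adjoint state *)

Section adjoint_identity.
Context {R : realType}.
Local Notation mu := (@lebesgue_measure R).
Local Notation RxR := (measurableTypeR R * measurableTypeR R)%type.
Local Notation leb2 := (@leb2 R).
Variables (T al : R) (yOmega : R -> R) (y phi : R -> R -> R).
Hypotheses (T0 : 0 < T) (hphi : weak_adjoint T al yOmega y phi).

Hypotheses (al0 : 0 < al)
  (cd : {within `[0, 1], continuous (fun x => y x T - yOmega x)}).

Let d (x : R) := y x T - yOmega x.
Let f (t : R) := phi 1 t.
Let Phi k := \int[leb2]_(p in cyl T) (phi p.1 p.2 * cosh (k * p.1)).

Let cphi : continuous_closed_cyl T phi. Proof. by case: hphi. Qed.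

Let cf : {within `[0, T], continuous f}.
Proof. by apply: (cyl_slice_t cphi); rewrite lexx ler01. Qed.

Lemma is_derive_cosh (k x : R) : is_derive x 1 (fun x => cosh (k * x)) (k * sinh (k * x)).
Proof.
rewrite /cosh /sinh; apply: is_derive_eq; rewrite /GRing.scale/=.
by field.
Qed.

Lemma is_derive_sinh (k x : R) : is_derive x 1 (fun x => sinh (k * x)) (k * cosh (k * x)).
Proof.
rewrite /cosh /sinh; apply: is_derive_eq; rewrite /GRing.scale/=.
by field.
Qed.

(** The test function is [cosh (k x)] times [exp (- k^2 (T - t)) - exp (- k^2 T)], the constant
    being subtracted to make it vanish at [t = 0]. Without that constant it would satisfy
    [v_t = v_xx] and the cylinder integrals would cancel; the constant leaves the term in [Phi k].
    No trace appears at [x = 0], where [k sinh (k x)] vanishes. *)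
Lemma adjoint_cosh_identity k :
  k ^+ 2 * expR (- k ^+ 2 * T) * Phi k +
  robin_symbol al k * (\int[mu]_(t in `[0, T])
     (f t * (expR (- k ^+ 2 * T) * expR (k ^+ 2 * t) - expR (- k ^+ 2 * T)))) =
  (1 - expR (- k ^+ 2 * T)) * cosh_moment d k.
Proof.
set p := k ^+ 2; set E := expR (- p * T).
pose ta (t : R) := E * expR (p * t) - E.
pose ta' (t : R) := p * E * expR (p * t).
have dta (t : R) : is_derive t 1 ta (ta' t).
  by rewrite /ta /ta'; apply: is_derive_eq; rewrite /GRing.scale/=; ring.
have cta : continuous ta'.
  by move=> t; apply: cvgMr; exact: continuous_expRM.
have ct := is_derive_continuous dta.
have dc := is_derive_cosh k.
have ck : continuous (fun x : R => cosh (k * x)) := is_derive_continuous dc.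
have cs : continuous (fun x : R => sinh (k * x)) := is_derive_continuous (is_derive_sinh k).
have cks : continuous (fun x : R => k * sinh (k * x)) by move=> x; apply: cvgMr; exact: cs.
have ckc : continuous (fun x : R => k * (k * cosh (k * x))).
  by move=> x; do 2 apply: cvgMr; exact: ck.
have dks (x : R) : is_derive x 1 (fun x : R => k * sinh (k * x)) (k * (k * cosh (k * x))).
  exact: (@is_derive_mull R (fun x => sinh (k * x)) (fun x => k * cosh (k * x)) k x
    (is_derive_sinh k x)).
have [_ [g hg]] := hphi.
move=> /(_ _ (C1_prod dc cks dta cta)) /(_ _).
have ta0 : ta 0 = 0 by rewrite /ta mulr0 expR0 mulr1 subrr.
move=> /(_ (fun x _ => etrans (congr1 _ ta0) (mulr0 _))).
have sinh0 : k * sinh (k * 0) = 0 by rewrite mulr0 /sinh oppr0 subrr mul0r mulr0.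
have := weak_dx_ibp T0 cphi hg dks ckc dta cta sinh0.
have iphi := continuous_cyl_integrable T0 cphi.
have -> : \int[leb2]_(p in cyl T) (g p.1 p.2 * dx (fun x t : R => cosh (k * x) * ta t) p.1 p.2) =
   \int[leb2]_(p in cyl T) (g p.1 p.2 * (k * sinh (k * p.1) * ta p.2)).
  by apply: eq_Rintegral => q _; rewrite (dx_prod _ dc).
move=> ->.
set I := (\int[leb2]_(q in cyl T) (phi q.1 q.2 * (k * (k * _) * _))).
set J := (\int[leb2]_(q in cyl T) (phi q.1 q.2 * dt _ _ _)).
have mc := @measurable_cyl R T.
(* The exponential parts of [ta'] and [p * ta] agree, and their difference is the constant
   [p * E]. *)
have IJ : J - I = p * E * Phi k.
  have i1 : leb2.-integrable (cyl T)
      (EFin \o (fun q : RxR => cosh (k * q.1) * ta' q.2 * phi q.1 q.2)).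
    exact: (integrable_cyl_mul ck cta iphi).
  have i2 : leb2.-integrable (cyl T)
      (EFin \o (fun q : RxR => k * (k * cosh (k * q.1)) * ta q.2 * phi q.1 q.2)).
    exact: (integrable_cyl_mul ckc ct iphi).
  have i3 : leb2.-integrable (cyl T)
      (EFin \o (fun q : RxR => cosh (k * q.1) * 1 * phi q.1 q.2)).
    exact: (integrable_cyl_mul ck (fun x => cvg_cst (1 : R)) iphi).
  have -> : J = \int[leb2]_(q in cyl T) (cosh (k * q.1) * ta' q.2 * phi q.1 q.2).
    by apply: eq_Rintegral => q _; rewrite (dt_prod _ dta) mulrC.
  have -> : I = \int[leb2]_(q in cyl T) (k * (k * cosh (k * q.1)) * ta q.2 * phi q.1 q.2).
    by apply: eq_Rintegral => q _; rewrite mulrC.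
  rewrite -RintegralB//.
  have -> : Phi k = \int[leb2]_(q in cyl T) (cosh (k * q.1) * 1 * phi q.1 q.2).
    by apply: eq_Rintegral => q _; rewrite mulr1 mulrC.
  rewrite -RintegralZl//; apply: eq_Rintegral => q _.
  by rewrite /ta /ta' /p; ring.
have icf (h : R -> R) : continuous h ->
    mu.-integrable `[0, T] (EFin \o (fun t => f t * h t)).
  move=> ch; apply: continuous_integrable; apply: within_continuousM => //.
  exact: continuous_subspaceT.
have -> : \int[mu]_(t in `[0, T]) (phi 1 t * (k * sinh (k * 1) * ta t)) =
    k * sinh k * (\int[mu]_(t in `[0, T]) (f t * ta t)).
  rewrite -RintegralZl//; last exact: icf.
  by apply: eq_Rintegral => t _; rewrite mulr1 /f; ring.
have -> : \int[leb1]_(t in `[0, T]) (phi 1 t * (cosh (k * 1) * ta t)) =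
    cosh k * (\int[mu]_(t in `[0, T]) (f t * ta t)).
  rewrite -RintegralZl//; last exact: icf.
  by apply: eq_Rintegral => t _; rewrite mulr1 /f; ring.
have taT : ta T = 1 - E.
  by rewrite /ta /E -expRD mulNr addNr expR0.
have -> : \int[leb1]_(x in `[0, 1]) ((y x T - yOmega x) * (cosh (k * x) * ta T)) =
    (1 - E) * cosh_moment d k.
  rewrite taT -RintegralZl//; last exact: integrable_cosh_mul.
  by apply: eq_Rintegral => x _; rewrite /d; ring.
move: IJ; rewrite /robin_symbol; set W := Rintegral _ _ _; set V := Phi k.
set H := cosh_moment _ _.
clearbody I J W V H E p => IJ h.
by rewrite -IJ -h; ring.
Qed.

(** The substitution [t = T - s] turns the weight into [exp (- k^2 s)]. All terms but the last carry
    [exp (- k^2 T)], the price of truncating the transform at [T]. *)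
Lemma boundary_laplace k : 0 <= k ->
  \int[mu]_(s in `]0, T]) (expR (- k ^+ 2 * s) * f (T - s)) =
  expR (- k ^+ 2 * T) * ((\int[mu]_(t in `[0, T]) f t)
    - cosh_moment d k / robin_symbol al k - k ^+ 2 * (Phi k / robin_symbol al k))
  + cosh_moment d k / robin_symbol al k.
Proof.
move=> k0; have D0 := robin_symbol_gt0 al0 k0.
have := adjoint_cosh_identity k.
set p := k ^+ 2; set E := expR (- p * T).
have cG : {within `[0, T], continuous (fun s => expR (- p * s) * f (T - s))}.
  apply: within_continuousM; last exact: continuous_reflect_within.
  exact: within_expRM.
have cfe : {within `[0, T], continuous (fun t => f t * (E * expR (p * t)))}.
  apply: within_continuousM => //; apply: continuous_subspaceT => t.
  by apply: cvgMr; exact: continuous_expRM.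
rewrite Rintegral_itv_obnd_cbnd; last first.
  have s1 : `]0, T] `<=` (`[0, T] : set R) by exact: subset_itv_oc_cc.
  apply: (@integrableS _ _ _ mu _ _ _ (measurable_itv _) (measurable_itv _) s1).
  exact: continuous_integrable.
have -> : \int[mu]_(t in `[0, T]) (f t * (E * expR (p * t) - E)) =
    \int[mu]_(s in `[0, T]) (expR (- p * s) * f (T - s)) - E * (\int[mu]_(t in `[0, T]) f t).
  rewrite -(Rintegral_reflect (ltW T0) cG) -RintegralZl//; last exact: continuous_integrable.
  have -> : \int[mu]_(x in `[0, T]) (expR (- p * (T - x)) * f (T - (T - x))) =
      \int[mu]_(t in `[0, T]) (f t * (E * expR (p * t))).
    apply: eq_Rintegral => t _; rewrite subKr mulrC /E -expRD; congr (_ * expR _).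
    by ring.
  rewrite -RintegralB//; last 2 first.
  - exact: continuous_integrable.
  - by apply: integrable_EFinZl => //; exact: continuous_integrable.
  by apply: eq_Rintegral => t _; ring.
set L := (\int[mu]_(s in `[0, T]) (expR (- p * s) * _)).
set F0 := (\int[mu]_(t in `[0, T]) f t).
move: (Phi k) (cosh_moment d k) L F0 => V H L F0.
move: D0; set D := robin_symbol al k => D0.
move=> h; have -> : L = D * (L - E * F0) / D + E * F0.
  by field; rewrite gt_eqF.
have -> : D * (L - E * F0) = (1 - E) * H - p * E * V by rewrite -h; ring.
by field; rewrite gt_eqF.
Qed.

End adjoint_identity.

Section heat_transform_bounds.
Context {R : realType}.
Local Notation mu := (@lebesgue_measure R).
Variables (E : R -> R) (K l : R).
Hypothesis eE : exp_type K l E.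

Lemma continuous_heat_transform s : 0 < s -> {for s, continuous (heat_transform E)}.
Proof.
move=> s0; apply: cvgM.
  apply: cvgV.
    by rewrite mulf_neq0// gt_eqF// sqrtr_gt0// pi_gt0.
  by apply: cvgMr; exact: sqrt_continuous.
apply: (@continuous_comp _ _ _ (fun s : R => (4 * s)^-1) (gauss_laplace E)).
  by apply: cvgV; [rewrite mulf_neq0// gt_eqF|apply: cvgMr; exact: cvg_id].
by apply: (continuous_gauss_laplace eE); rewrite invr_gt0 mulr_gt0.
Qed.

(** On []0, T]] the weight [exp (- k^2 s)] is at least [exp (- k^2 T)], so it can be divided out. *)
Lemma integrable_heat_transform k T : l < k -> 0 < k ->
  mu.-integrable `]0, T] (EFin \o heat_transform E).
Proof.
move=> lk k0; have [ih _] := heat_transform_laplace eE lk k0.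
have s1 : `]0, T] `<=` (`]0, +oo[ : set R) by exact: subset_itvl.
have ih1 := @integrableS _ _ _ mu _ _ _ (measurable_itv _) (measurable_itv _) s1 ih.
have mh : measurable_fun `](0 : R), T] (heat_transform E).
  apply: (@eq_measurable_fun _ _ _ _ _ (fun s => expR (k ^+ 2 * s) *
      (expR (- k ^+ 2 * s) * heat_transform E s))).
    by move=> s _; rewrite mulrA -expRD mulNr subrr expR0 mul1r.
  apply: measurable_funM; first exact: measurable_expRM.
  by apply/measurable_EFinP; exact: (measurable_int mu).
have i2 := @integrable_EFinZl _ _ _ mu _ _ (expR (k ^+ 2 * T)) (measurable_itv _) ih1.
apply: le_integrable i2 => //; first exact/measurable_EFinP.
move=> s /=; rewrite in_itv/= => /andP[s0 sT].
rewrite lee_fin !(normrM (expR _)) !(ger0_norm (expR_ge0 _)) mulrA -expRD.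
rewrite ler_peMl// -expR0 ler_expR mulNr -mulrBr mulr_ge0 ?sqr_ge0// subr_ge0//.
Qed.

(** Beyond [T] the extra decay [exp (- (k^2 - k0^2) s)] is at most its value at [s = T]; what
    remains does not depend on [k]. *)
Lemma heat_transform_tail k0 k T : l < k0 -> 0 < k0 -> k0 <= k -> 0 <= T ->
  `|\int[mu]_(s in `]T, +oo[) (expR (- k ^+ 2 * s) * heat_transform E s)| <=
  expR (- k ^+ 2 * T) * (expR (k0 ^+ 2 * T) *
    \int[mu]_(s in `]T, +oo[) `|expR (- k0 ^+ 2 * s) * heat_transform E s|).
Proof.
move=> lk0 k00 k0k T0.
have s1 : `]T, +oo[ `<=` (`]0, +oo[ : set R) by exact: subset_itvr.
have ih k' : k0 <= k' -> mu.-integrable `]T, +oo[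
    (EFin \o (fun s => expR (- k' ^+ 2 * s) * heat_transform E s)).
  move=> h; apply: (@integrableS _ _ _ mu _ _ _ (measurable_itv _) (measurable_itv _) s1).
  exact: (heat_transform_laplace eE (lt_le_trans lk0 h) (lt_le_trans k00 h)).1.
rewrite (le_trans (le_normr_Rintegral _ (ih k k0k)))// mulrA -expRD.
have i1 := integrable_norm (ih k k0k).
have i2 := integrable_norm (ih k0 (lexx _)).
rewrite -RintegralZl//; apply: le_Rintegral => //; first exact: integrable_EFinZl.
move=> s /=; rewrite in_itv/= andbT => Ts.
rewrite !(normrM (expR _)) !(ger0_norm (expR_ge0 _)) mulrA -expRD.
rewrite ler_wpM2r// ler_expR.
have : (k ^+ 2 - k0 ^+ 2) * T <= (k ^+ 2 - k0 ^+ 2) * s.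
  by apply: ler_wpM2l; [rewrite subr_ge0 ler_sqr ?nnegrE; lra|exact: ltW].
by lra.
Qed.

End heat_transform_bounds.

Section boundary_values.
Context {R : realType}.
Local Notation mu := (@lebesgue_measure R).
Local Notation RxR := (measurableTypeR R * measurableTypeR R)%type.
Local Notation leb2 := (@leb2 R).

Lemma cosh_le_robin_symbol (al k : R) : 0 <= k -> al * cosh k <= robin_symbol al k.
Proof.
move=> k0; rewrite lerDr mulr_ge0// divr_ge0// subr_ge0 ler_expR; lra.
Qed.

(** On [[0, 1]], [cosh (k x) <= cosh k], and the symbol is at least [al cosh k]: the growth in [k]
    cancels. *)
Lemma cosh_moment_ratio_le (al : R) (d : R -> R) (K : R) : 0 < al ->
  {within `[0, 1], continuous d} -> (forall x, 0 <= x <= 1 -> `|d x| <= K) ->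
  forall k, 0 <= k -> `|cosh_moment d k / robin_symbol al k| <= K / al.
Proof.
move=> al0 cd dK k k0; have D0 := robin_symbol_gt0 al0 k0.
have K0 : 0 <= K by rewrite (le_trans _ (dK 0 _))// lexx ler01.
rewrite normrM normfV (gtr0_norm D0) ler_pdivrMr// mulrAC ler_pdivlMr//.
apply: (@le_trans _ _ (K * cosh k * al)); last first.
  by rewrite -mulrA ler_wpM2l// mulrC cosh_le_robin_symbol.
apply: ler_wpM2r; first exact: ltW.
apply: norm_Rintegral01_le; first exact: integrable_cosh_mul.
move=> x x01; rewrite normrM (ger0_norm (le_trans ler01 (cosh_ge1 _))).
apply: ler_pM => //; [by rewrite (le_trans ler01)// cosh_ge1|exact: dK|].
by apply: cosh_le; case/andP: x01 => x0 x1; rewrite ger0_norm ?mulr_ge0// ler_piMr.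
Qed.

Lemma cyl_moment_ratio_le (al T : R) (phi : R -> R -> R) : 0 < al -> 0 < T ->
  continuous_closed_cyl T phi ->
  exists2 M, 0 <= M & forall k, 0 <= k ->
    `|(\int[leb2]_(p in cyl T) (phi p.1 p.2 * cosh (k * p.1))) / robin_symbol al k| <= M.
Proof.
move=> al0 T0 cphi; have mc := @measurable_cyl R T.
have [K K0 phiK] := cyl_bounded cphi.
have iphi := continuous_cyl_integrable T0 cphi.
have i1 (c : R) : leb2.-integrable (cyl T) (EFin \o (fun _ : RxR => c)).
  by apply: (bounded_cyl_integrable T0 (C := `|c|)).
exists (K * T / al) => [|k k0]; first by rewrite divr_ge0 ?mulr_ge0 ?ltW.
have D0 := robin_symbol_gt0 al0 k0.
have ik : leb2.-integrable (cyl T)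
    (EFin \o (fun p : RxR => phi p.1 p.2 * cosh (k * p.1))).
  rewrite (_ : _ \o _ = EFin \o (fun p : RxR => cosh (k * p.1) * 1 * phi p.1 p.2)).
    exact: (integrable_cyl_mul (@continuous_cosh R k) (fun x => cvg_cst (1 : R)) iphi).
  by apply/funext => p /=; rewrite mulr1 mulrC.
rewrite normrM normfV (gtr0_norm D0) ler_pdivrMr// mulrAC ler_pdivlMr//.
apply: (@le_trans _ _ (K * cosh k * T * al)); last first.
  rewrite [K * _ * T]mulrAC -[leLHS]mulrA [cosh k * _]mulrC; apply: ler_wpM2l.
    by rewrite mulr_ge0 ?ltW.
  exact: cosh_le_robin_symbol.
apply: ler_wpM2r; first exact: ltW.
apply: (le_trans (le_normr_Rintegral mc ik)).
have -> : K * cosh k * T = \int[leb2]_(p in cyl T) (K * cosh k).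
  rewrite Rintegral_cst//; congr (_ * _).
  rewrite /leb2/= product_measure1E//= !lebesgue_measure_itv/= !lte_fin ltr01 T0.
  by rewrite -!EFinB -EFinM/= !subr0 mul1r.
apply: le_Rintegral => //; first exact: integrable_norm.
move=> [x t] []; rewrite /= !in_itv/= => /andP[x0 x1] /andP[t0 tT].
rewrite normrM (ger0_norm (le_trans ler01 (cosh_ge1 _))).
apply: ler_pM => //; [by rewrite (le_trans ler01)// cosh_ge1|by apply: phiK; rewrite !ltW|].
have [x0' x1'] := (ltW x0, ltW x1).
by apply: cosh_le; rewrite ger0_norm ?mulr_ge0// ler_piMr.
Qed.

(** [F0] stands for the integral of [phi 1], [h] and [v] for the moment of [d] and the cylinder
    integral, both divided by the symbol, and [tail] for the heat transform beyond [T]. The only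
    growing factor is the [p] before [v], absorbed by [p exp (- p (T - T')) <= 1 / (T - T')]. *)
Lemma laplace_error_le (F0 h v c p T T' A B M tail : R) : T' < T -> 1 <= p -> 0 <= A ->
  `|h| <= B -> `|v| <= M -> `|tail| <= expR (- p * T) * A ->
  `|expR (- p * T) * (F0 - h - p * v) + h - c * ((1 - expR (- p * T)) / p) -
    (h - c / p - tail)| <=
  (`|F0| + B + M / (T - T') + `|c| + A) * expR (- p * T').
Proof.
move=> T'T p1 A0 hB vM tA.
have p0 : 0 < p by lra.
have w0 : 0 < T - T' by rewrite subr_gt0.
have -> : expR (- p * T) * (F0 - h - p * v) + h - c * ((1 - expR (- p * T)) / p) -
    (h - c / p - tail) = expR (- p * T) * (F0 - h - p * v + c / p) + tail.
  by field; rewrite gt_eqF.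
have eE : expR (- p * T) = expR (- p * T') * expR (- (p * (T - T'))).
  by rewrite -expRD; congr expR; ring.
have e0 : 0 < expR (- p * T') := expR_gt0 _.
set e := expR (- p * T') in e0 eE *.
have d1 : expR (- (p * (T - T'))) <= 1.
  by rewrite -expR0 ler_expR oppr_le0 mulr_ge0// ltW.
have d2 : p * expR (- (p * (T - T'))) <= (T - T')^-1.
  rewrite expRN ler_pdivrMr ?expR_gt0// mulrC ler_pdivlMr//.
  by have := expR_ge1Dx (p * (T - T')); lra.
have d0 : 0 < expR (- (p * (T - T'))) := expR_gt0 _.
set dl := expR (- (p * (T - T'))) in d0 d1 d2 eE.
have cp : `|c / p| <= `|c|.
  by rewrite normrM normfV (gtr0_norm p0) ler_piMr// invf_le1.
apply: (le_trans (ler_normD _ _)).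
have n1 : `|F0 - h - p * v + c / p| <= `|F0| + B + p * M + `|c|.
  rewrite (le_trans (ler_normD _ _))// lerD// (le_trans (ler_normB _ _))// lerD//.
    by rewrite (le_trans (ler_normB _ _))// lerD.
  by rewrite normrM gtr0_norm// ler_pM2l.
have B0 : 0 <= B by rewrite (le_trans _ hB).
have M0 : 0 <= M by rewrite (le_trans _ vM).
have n2 : `|expR (- p * T) * (F0 - h - p * v + c / p)| <=
    e * dl * (`|F0| + B + p * M + `|c|).
  by rewrite normrM ger0_norm ?expR_ge0// eE ler_wpM2l// mulr_ge0// ltW.
apply: (le_trans (lerD n2 tA)); rewrite eE.
have -> : e * dl * (`|F0| + B + p * M + `|c|) + e * dl * A =
    e * (dl * (`|F0| + B + `|c| + A) + p * dl * M) by ring.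
rewrite [leRHS]mulrC ler_pM2l//.
have f1 : dl * (`|F0| + B + `|c| + A) <= `|F0| + B + `|c| + A.
  by rewrite ler_piMl// !addr_ge0.
have f2 : p * dl * M <= M / (T - T') by rewrite [leRHS]mulrC ler_wpM2r.
by lra.
Qed.

Variables (T al : R) (yOmega : R -> R) (y phi : R -> R -> R).
Hypotheses (T0 : 0 < T) (hphi : weak_adjoint T al yOmega y phi).
Hypotheses (al0 : 0 < al)
  (cd : {within `[0, 1], continuous (fun x => y x T - yOmega x)}).

Let d (x : R) := y x T - yOmega x.
Let f (t : R) := phi 1 t.

(** [c] is arbitrary because the heat transform of the constant [- c] is [- c] itself. *)
Lemma boundary_heat_transform c : exists E K, [/\ exp_type K 3 E,
  forall k, 3 < k -> robin_symbol al k * (laplace E k / k) =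
    cosh_moment d k - c / k ^+ 2 * robin_symbol al k &
  forall s, 0 < s < T -> phi 1 (T - s) = c + heat_transform E s].
Proof.
have [E [K [eE LE]]] := robin_transform c al0 cd.
exists E, K; split => // s /andP[s0 sT].
have cphi : continuous_closed_cyl T phi by case: hphi.
have cf : {within `[0, T], continuous f}.
  by apply: (cyl_slice_t cphi); rewrite lexx ler01.
have crf := continuous_reflect_within cf.
have [M M0 PM] := cyl_moment_ratio_le al0 T0 cphi.
have [Kd Kd0 dK] := continuous_segment_bounded cd.
have HM := cosh_moment_ratio_le al0 cd dK.
pose r s := f (T - s) - c - heat_transform E s.
(* Halfway between [s] and [T]: [s < T'] allows the inversion at [s], and [T' < T] absorbs the
   factor [p] of the error. *)
pose T' := (s + T) / 2.
have sT' : s < T' by rewrite /T'; lra.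
have T'T : T' < T by rewrite /T'; lra.
have l34 : 3 < 4 :> R by lra.
have l04 : 0 < 4 :> R by lra.
have s1 : `]0, T] `<=` (`[0, T] : set R) by exact: subset_itv_oc_cc.
have ifr : mu.-integrable `]0, T] (EFin \o (fun s => f (T - s) - c)).
  apply: (@integrableS _ _ _ mu _ _ _ (measurable_itv _) (measurable_itv _) s1).
  apply: (@continuous_integrable _ _ _ (fun s => f (T - s) - c)) => x.
  by apply: cvgB; [exact: crf|exact: cvg_cst].
have ih := @integrable_heat_transform R E K 3 eE 4 T l34 l04.
have ir : mu.-integrable `]0, T] (EFin \o r).
  exact: (integrableB _ ifr ih).
pose F0 := \int[mu]_(t in `[0, T]) f t.
pose A := expR (4 ^+ 2 * T) *
    \int[mu]_(s in `]T, +oo[) `|expR (- 4 ^+ 2 * s) * heat_transform E s|.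
have A0 : 0 <= A by rewrite mulr_ge0 ?expR_ge0// Rintegral_ge0.
pose C := `|F0| + Kd / al + M / (T - T') + `|c| + A.
(* [16 = 4^2] makes [k = sqrt p] at least 4, beyond the rate 3 of [E] and not below the reference
   value 4 of the tail bound. *)
have bound p : 16 <= p ->
    `|\int[mu]_(s in `]0, T]) (expR (- p * s) * r s)| <= C * expR (- p * T').
  move=> p16; have p0 : 0 < p by lra.
  pose k := Num.sqrt p.
  have kp : k ^+ 2 = p by rewrite sqr_sqrtr// ltW.
  have k4 : 4 <= k.
    by rewrite -(ler_sqr (R := R)) ?nnegrE ?sqrtr_ge0// kp; lra.
  have k3 : 3 < k by lra.
  have k0 : 0 < k by lra.
  have D0 := robin_symbol_gt0 al0 (ltW k0).
  have E1 := boundary_laplace T0 hphi al0 cd (ltW k0).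
  have [ihk E2] := heat_transform_laplace eE k3 k0.
  have E3 := LE k k3.
  have tl := heat_transform_tail eE l34 l04 k4 (ltW T0).
  have P1 := PM k (ltW k0); have H1 := HM k (ltW k0).
  have i1 : mu.-integrable `]0, T] (EFin \o (fun s => expR (- p * s) * f (T - s))).
    apply: (@integrableS _ _ _ mu _ _ _ (measurable_itv _) (measurable_itv _) s1).
    by apply: continuous_integrable; apply: within_continuousM => //; exact: within_expRM.
  have i2 : mu.-integrable `]0, T] (EFin \o (fun s => expR (- p * s) * c)).
    apply: (@integrableS _ _ _ mu _ _ _ (measurable_itv _) (measurable_itv _) s1).
    by apply: continuous_integrable; apply: within_continuousMr; exact: within_expRM.
  have i12 : mu.-integrable `]0, T]
      (EFin \o (fun s => expR (- p * s) * f (T - s) - expR (- p * s) * c)).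
    exact: (integrableB _ i1 i2).
  have s2 : `]0, T] `<=` (`]0, +oo[ : set R) by exact: subset_itvl.
  have i3 := @integrableS _ _ _ mu _ _ _ (measurable_itv _) (measurable_itv _) s2 ihk.
  have := @Rintegral_itvB _ _ (BRight 0) +oo%O T ihk.
  rewrite !bnd_simp => /(_ (ltW T0) isT) split.
  rewrite kp in E1 E2 E3 tl split i3 ihk.
  have ec : \int[mu]_(s in `]0, T]) (expR (- p * s) * c) = c * ((1 - expR (- p * T)) / p).
    rewrite Rintegral_itv_obnd_cbnd// RintegralZr//; last first.
      by apply: continuous_integrable; exact: within_expRM.
    rewrite (@Rintegral_expR_itv R (- p) 0 T) ?oppr_eq0 ?gt_eqF// mulr0 expR0.
    by field; rewrite gt_eqF.
  have -> : \int[mu]_(s in `]0, T]) (expR (- p * s) * r s) =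
      \int[mu]_(s in `]0, T]) (expR (- p * s) * f (T - s))
      - \int[mu]_(s in `]0, T]) (expR (- p * s) * c)
      - \int[mu]_(s in `]0, T]) (expR (- p * s) * heat_transform E s).
    rewrite -RintegralB// -RintegralB//.
    by apply: eq_Rintegral => x _; rewrite /r; ring.
  rewrite ec E1.
  have -> : \int[mu]_(s in `]0, T]) (expR (- p * s) * heat_transform E s) =
      cosh_moment d k / robin_symbol al k - c / p -
      \int[mu]_(s in `]T, +oo[) (expR (- p * s) * heat_transform E s).
    have <- : laplace E k / k = cosh_moment d k / robin_symbol al k - c / p.
      apply: (mulfI (lt0r_neq0 D0)); rewrite E3 mulrBr; congr (_ - _).
        by rewrite mulrCA divff ?mulr1// gt_eqF.
      exact: mulrC.
    by rewrite -split E2 subKr.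
  apply: laplace_error_le => //; lra.
have cr : {in `]0, T'[, forall s, {for s, continuous r}}.
  move=> x; rewrite in_itv/= => /andP[x0 xT'].
  apply: cvgB; last exact: (continuous_heat_transform eE x0).
  apply: cvgB; last exact: cvg_cst.
  have [crf1 _ _] := (continuous_within_itvP _ T0).1 crf.
  by apply: crf1; rewrite in_itv/= x0/=; lra.
have := @phragmen_eq0 R T T' _ 16 r (ltW T'T) ir bound s cr s0 sT'.
by rewrite /r/f; lra.
Qed.

End boundary_values.

(** * Level sets *)

Section accumulation.
Context {R : realType}.
Implicit Types (E A B : set R) (T t : R).

Lemma limit_pointU A B t : limit_point (A `|` B) t -> limit_point A t \/ limit_point B t.
Proof.
move=> AB; apply: contrapT => /not_orP[/existsNP[U /not_implyP[Ut nU]]].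
move=> /existsNP[V /not_implyP[Vt nV]].
have [s [st [As|Bs] [Us Vs]]] := AB _ (filterI Ut Vt).
  by apply: nU; exists s.
by apply: nV; exists s.
Qed.

Lemma limit_point_sub A B : A `<=` B -> limit_point A `<=` limit_point B.
Proof. by move=> AB t At U /At[s [st /AB Bs Us]]; exists s. Qed.

Lemma countable_accumulating_sub T A B : A `<=` B ->
  countable_accumulating_only_at T B -> countable_accumulating_only_at T A.
Proof.
move=> AB [cB lB]; split; first exact: sub_countable (subset_card_le AB) cB.
exact: subset_trans (limit_point_sub AB) lB.
Qed.

Lemma countable_accumulatingU T A B : countable_accumulating_only_at T A ->
  countable_accumulating_only_at T B -> countable_accumulating_only_at T (A `|` B).
Proof.
move=> [cA lA] [cB lB]; split.
  rewrite -bigcup2E; apply: bigcup_countable => // i _.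
  by case: i => [|[|i]] //=.
by move=> t /limit_pointU[/lA|/lB].
Qed.

Lemma limit_point_itv T E t : E `<=` `[0, T] -> limit_point E t -> 0 <= t <= T.
Proof.
move=> ET Et; apply: contrapT => tT.
have o : open (~` `[0, T]%classic : set R) by apply: closed_openC; exact: itv_closed.
have /Et[s [_ /ET sT]] : nbhs t (~` `[0, T]%classic).
  by apply: open_nbhs_nbhs; split => //=; rewrite in_itv.
exact.
Qed.

(** Bolzano-Weierstrass: an infinite part of [E] in [[0, T - 1 / (n + 1)]] would accumulate before
    [T]. The point [T] may itself belong to [E], so it is added to each finite piece. *)
Lemma countable_accumulatingP T E : E `<=` `[0, T] ->
  (forall t, 0 <= t < T -> ~ limit_point E t) -> countable_accumulating_only_at T E.
Proof.
move=> ET nE; split; last first.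
  move=> t Et; have /andP[t0] := limit_point_itv ET Et.
  rewrite le_eqVlt => /predU1P[//|tT]; exfalso.
  by apply: nE Et; rewrite t0.
pose F n := E `&` `[0, T - n.+1%:R^-1].
have fF n : finite_set (F n).
  apply: contrapT => iF.
  have sF : F n `<=` `[0, T - n.+1%:R^-1] by move=> t [].
  have [|t Ft] := infinite_bounded_limit_point_nonempty iF.
    exists T; split; first exact: num_real.
    move=> x Tx t [/ET + _]; rewrite /= in_itv/= => /andP[t0 tT].
    by rewrite ger0_norm// (le_trans tT)// ltW.
  have /andP[t0 tT] := limit_point_itv sF Ft.
  apply: (nE t); last exact: (limit_point_sub (@subIsetl _ _ _) Ft).
  by rewrite t0 (le_lt_trans tT)// gtrBl invr_gt0.
have sE : E `<=` \bigcup_n (F n `|` [set T]).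
  move=> t Et; have := ET t Et; rewrite /= in_itv/= => /andP[t0].
  rewrite le_eqVlt => /predU1P[->|tT]; first by exists 0%N => //; right.
  have w0 : 0 < T - t by rewrite subr_gt0.
  exists (Num.truncn (T - t)^-1) => //; left; split => //=.
  rewrite in_itv/= t0/= lerBrDl -lerBrDr.
  rewrite -[leRHS]invrK lef_pV2 ?posrE ?invr_gt0//.
  by rewrite ltW// truncnS_gt.
apply: sub_countable (subset_card_le sE) _.
apply: bigcup_countable => // n _; apply: finite_set_countable.
by rewrite finite_setU; split.
Qed.

Lemma sign_change_eq0 (g : R -> R) t : {for t, continuous g} -> sign_change g t -> g t = 0.
Proof.
move=> cg sg; apply: contrapT => /eqP gt0.
have n0 : 0 < `|g t| by rewrite normr_gt0.
move/cvgrPdist_lt : cg => /(_ _ n0)[e /= e0 he].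
have [s [r [/andP[s1 s2] /andP[r1 r2] sr]]] := sg e e0.
have hs : `|g t - g s| < `|g t| by apply: he => /=; rewrite gtr0_norm; lra.
have hr : `|g t - g r| < `|g t| by apply: he => /=; rewrite ltr0_norm; lra.
have [gp|gn] := ltP 0 (g t).
  move: hs hr; rewrite (gtr0_norm gp) !ltr_norml => /andP[_ h1] /andP[_ h2].
  have s3 : 0 < g s by lra.
  have r3 : 0 < g r by lra.
  by move: sr; rewrite ltNge mulr_ge0 ?ltW.
move: hs hr; rewrite (ler0_norm gn) !ltr_norml => /andP[h1 _] /andP[h2 _].
have s3 : g s < 0 by lra.
have r3 : g r < 0 by lra.
by move: sr; rewrite ltNge nmulr_rge0// ltW.
Qed.

End accumulation.

Section boundary_level_sets.
Context {R : realType}.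
Variables (T al : R) (yOmega : R -> R) (y phi : R -> R -> R).
Hypotheses (T0 : 0 < T) (hphi : weak_adjoint T al yOmega y phi).
Hypotheses (al0 : 0 < al)
  (cd : {within `[0, 1], continuous (fun x => y x T - yOmega x)}).

Lemma no_limit_point_level_set c t0 : c != 0 -> 0 <= t0 < T ->
  ~ limit_point [set t | t \in `[0, T] /\ phi 1 t = c] t0.
Proof.
move=> c0 /andP[t00 t0T] lt0.
have [E [K [eE LE hE]]] := boundary_heat_transform T0 hphi al0 cd c.
have zero_gl s : 0 < s < T -> phi 1 (T - s) = c -> gauss_laplace E (4 * s)^-1 = 0.
  move=> sT; rewrite hE// -[RHS]addr0 => /addrI/eqP.
  case/andP: sT => s0 _.
  by rewrite mulf_eq0 invr_eq0 mulf_eq0 !sqrtr_eq0 !leNgt s0 pi_gt0/= => /eqP.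
(* At [t0 = 0] this parameter is [1 / (4 T)], interior to []0, +oo[]: continuation in [u] thus also
   excludes accumulation at the initial time, where the formula for [phi 1] stops. *)
pose u t : R := (4 * (T - t))^-1.
have u0 : 0 < u t0 by rewrite invr_gt0 mulr_gt0// subr_gt0.
have cu : {for t0, continuous u}.
  apply: cvgV; first by rewrite mulf_neq0// gt_eqF// subr_gt0.
  by apply: cvgMr; apply: cvgB; [exact: cvg_cst|exact: cvg_id].
have zero e : 0 < e -> exists h, [/\ h != 0, `|h| < e & gauss_laplace E (u t0 + h) = 0].
  move=> e0.
  have nu : \forall t \near t0, `|u t0 - u t| < e by move/cvgrPdist_lt : cu => /(_ e e0).
  have nT : \forall t \near t0, t < T by exact: lt_nbhsl.
  (* The formula for [phi 1] holds for [s < T], that is [0 < t]; when [t0 = 0], points of [[0, T]]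
     other than [t0] are positive. *)
  have np : \forall t \near t0, t != t0 -> 0 <= t -> 0 < t.
    move: t00; rewrite le_eqVlt => /predU1P[<-|t00].
      by exists 1 => //= t _ tn0 t_ge0; rewrite lt_def tn0.
    by near=> t => _ _; near: t; exact: lt_nbhsr.
  have [t [tt0 [+ ft] [ut [tT tp]]]] := lt0 _ (filterI nu (filterI nT np)).
  rewrite in_itv/= => /andP[t_ge0 _].
  exists (u t - u t0); split.
  - rewrite subr_eq0; apply: contra tt0 => /eqP/invr_inj/(mulfI _)/=.
    by move=> h; rewrite -(subKr T t) h ?subKr// gt_eqF.
  - by rewrite distrC.
  - rewrite subrKC; apply: zero_gl; last by rewrite subKr.
    by have := tp tt0 t_ge0; lra.
have gl0 := gauss_laplace_identity eE u0 zero.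
move/eqP: c0; apply; apply: (cauchy_data_eq0 al0 cd) => k k3.
have k0 : 0 < k by lra.
(* The heat transform vanishes identically, hence so does [laplace E k / k], and the symbol identity
   becomes the hypothesis of [cauchy_data_eq0]. *)
have [_] := heat_transform_laplace eE k3 k0.
rewrite (_ : Rintegral _ _ _ = 0); last first.
  transitivity (\int[@lebesgue_measure R]_(s in `]0, +oo[) (0 : R)); last first.
    by rewrite /Rintegral integral0.
  apply: eq_Rintegral => s; rewrite inE/= in_itv/= andbT => s0.
  by rewrite /heat_transform gl0 ?mulr0// invr_gt0 mulr_gt0.
move=> Lk; have := LE k k3; rewrite -Lk mulr0 => /esym/eqP.
by rewrite subr_eq0 => /eqP.
Unshelve. all: end_near. Qed.

End boundary_level_sets.

Unset Implicit Arguments.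

Theorem lemma5 (R : realType) (T alpha nu mu a b : R) (yOmega : R -> R)
    (u : R -> R) (y phi : R -> R -> R)
    (hT : 0 < T) (halpha : 0 < alpha) (hmu : 0 < mu) (ha : a < 0) (hb : 0 < b)
    (hyOmega : {within `[0, 1], continuous yOmega})
    (hnu : 0 < nu)
    (hu : optimal_pair T alpha nu mu a b yOmega u y)
    (hphi : weak_adjoint T alpha yOmega y phi)
    (hpos : (0 < 'N[leb1]_2
              [EFin \o ((fun x : R => y x T - yOmega x)%R \_ `[0%R, 1%R])])%E) :
  [/\ countable_accumulating_only_at T
        [set t | t \in `[0, T] /\ phi 1 t + mu + nu * b = 0],
      countable_accumulating_only_at T
        [set t | t \in `[0, T] /\ phi 1 t + mu = 0],
      countable_accumulating_only_at T
        [set t | t \in `[0, T] /\ phi 1 t - mu = 0] &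
      countable_accumulating_only_at T
        [set t | t \in `[0, T] /\ phi 1 t - mu + nu * a = 0]] /\
  countable_accumulating_only_at T
     [set t | switching_point T nu mu a b phi t].
Proof.
have cphi : continuous_closed_cyl T phi by case: hphi.
have cd : {within `[0, 1], continuous (fun x => y x T - yOmega x)}.
  have [_ [cy _] _] := hu.
  have cyT : {within `[0, 1], continuous (y ^~ T)}.
    by apply: (cyl_slice_x cy); rewrite lexx ltW.
  by move=> x; apply: cvgB; [exact: cyT|exact: hyOmega].
have cf : {within `[0, T], continuous (phi 1)}.
  by apply: (cyl_slice_t cphi); rewrite lexx ler01.
(* All four functions have the form [phi 1 - c]; the signs of [mu], [nu * b] and [nu * a] make each
   [c] nonzero. *)
have level (g : R -> R) c : c != 0 -> (forall t, g t = phi 1 t - c) ->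
    countable_accumulating_only_at T [set t | t \in `[0, T] /\ g t = 0].
  move=> c0 gE; rewrite (_ : [set t | _] = [set t | t \in `[0, T] /\ phi 1 t = c]).
    apply: countable_accumulatingP => [t []//|t tT].
    exact: (no_limit_point_level_set hT hphi halpha cd).
  apply/seteqP; split => t /= [tT].
    by rewrite gE => /eqP; rewrite subr_eq0 => /eqP.
  by move=> phit; rewrite gE phit subrr.
have nb : 0 < nu * b by rewrite mulr_gt0.
have na : nu * a < 0 by rewrite pmulr_rlt0.
have l1 := level (fun t => phi 1 t + mu + nu * b) (- (mu + nu * b)).
have l2 := level (fun t => phi 1 t + mu) (- mu).
have l3 := level (fun t => phi 1 t - mu) mu.
have l4 := level (fun t => phi 1 t - mu + nu * a) (mu - nu * a).
have {}l1 : countable_accumulating_only_at T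
    [set t | t \in `[0, T] /\ phi 1 t + mu + nu * b = 0].
  by apply: l1 => [|t]; [rewrite oppr_eq0 gt_eqF// addr_gt0|ring].
have {}l2 : countable_accumulating_only_at T [set t | t \in `[0, T] /\ phi 1 t + mu = 0].
  by apply: l2 => [|t]; [rewrite oppr_eq0 gt_eqF|ring].
have {}l3 : countable_accumulating_only_at T [set t | t \in `[0, T] /\ phi 1 t - mu = 0].
  by apply: l3 => //; rewrite gt_eqF.
have {}l4 : countable_accumulating_only_at T
    [set t | t \in `[0, T] /\ phi 1 t - mu + nu * a = 0].
  by apply: l4 => [|t]; [rewrite gt_eqF//; lra|ring].
split; first by split.
(* At a switching point one of the four continuous functions vanishes, so the union of the four
   level sets contains them all. *)
apply: countable_accumulating_sub (countable_accumulatingU (countable_accumulatingU l1 l2)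
  (countable_accumulatingU l3 l4)) => t [/andP[t0 tT] sw].
have tT' : t \in `[0, T] by rewrite in_itv/= !ltW.
have cft : {for t, continuous (phi 1)}.
  by have [cf1 _ _] := (continuous_within_itvP _ hT).1 cf; apply: cf1; rewrite in_itv/= t0.
have cD (g : R -> R) c : {for t, continuous g} -> {for t, continuous (fun s => g s + c)}.
  by move=> cg; apply: cvgD; [exact: cg|exact: cvg_cst].
case: sw => /sign_change_eq0 sw.
- by left; left; split => //; apply: sw; exact: cD (cD _ _ cft).
- by left; right; split => //; apply: sw; exact: cD cft.
- by right; left; split => //; apply: sw; exact: cD cft.
- by right; right; split => //; apply: sw; exact: cD (cD _ _ cft).
Qed.
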